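(* Let $(w_l)_{l\in\mathbb{N}}$ be a sequence of different complex numbers with $\lim_{l\to\infty}|w_l|=\infty$, and let $f:\mathbb{C}\to\mathbb{C}$ be an entire function whose zeros are all simple and are exactly the points $w_l$, $l\in\mathbb{N}$. Let each of $A$ and $B$ be either a non-empty finite set of even cardinality of points of the sequence $(w_l)_{l\in\mathbb{N}}$ or the set of points of a (divergent, infinite) subsequence of $(w_l)_{l\in\mathbb{N}}$. Let $g(z_1)=\prod_{a\in A}(z_1-a)$ if $A$ is finite, and let $g$ be an entire function whose zeros are all simple and are exactly the points of $A$ if $A$ is infinite; define $h$ from $B$ in the same way. Let $$\mathcal{S}(f,g)=\{(z_1,z_2,z_3)\in\mathbb{C}^3: z_2^2=f(z_1),\ z_3^2=g(z_1)\},\qquad \mathcal{S}(f,h)=\{(z_1,z_2,z_3)\in\mathbb{C}^3: z_2^2=f(z_1),\ z_3^2=h(z_1)\}.$$ Then the singular Riemann surfaces $\mathcal{S}(f,g)$ and $\mathcal{S}(f,h)$ are isomorphic if and only if $A$ and $B$ have the same cardinality and there exists a biholomorphism $t:\mathbb{C}\to\mathbb{C}$ which leaves invariant the set $\{w_l:l\in\mathbb{N}\}$ of points of the sequence and satisfies $t(A)=B$.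
   Context: A singular Riemann surface is a one-dimensional complex analytic space in which every point has a neighborhood holomorphically equivalent to some $V_{n,m}=\{(z,w)\in\Delta\times\Delta:z^n=w^m\}$, $n,m\ge1$, with $\Delta$ the unit disc; the point is singular if $\gcd(n,m)\ge 2$, and $\mathrm{Sing}(S)$ denotes the set of singular points. Here $\mathrm{Sing}(\mathcal{S}(f,g))=\{(z_1,z_2,z_3)\in\mathcal{S}(f,g):z_1\in A\}$ and $\mathrm{Sing}(\mathcal{S}(f,h))=\{(z_1,z_2,z_3)\in\mathcal{S}(f,h):z_1\in B\}$. An isomorphism between singular Riemann surfaces $S_1,S_2$ is a homeomorphism $F:S_1\to S_2$ with $F(\mathrm{Sing}(S_1))=\mathrm{Sing}(S_2)$ whose restriction $S_1\setminus\mathrm{Sing}(S_1)\to S_2\setminus\mathrm{Sing}(S_2)$ is holomorphic; $S_1$ and $S_2$ are isomorphic if such an $F$ exists. *)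

(* Defs.v *)
From Stdlib Require Import Reals List Arith.
From Coquelicot Require Import Coquelicot.

Local Open Scope C_scope.

Definition C2 : NormedModule C_AbsRing :=
  prod_NormedModule C_AbsRing C_NormedModule C_NormedModule.
Definition C3 : NormedModule C_AbsRing :=
  prod_NormedModule C_AbsRing C2 C_NormedModule.

(* [F] restricts to a map whose image of [X] is exactly [Y]. *)
Definition maps_onto {T U : Type} (F : T -> U) (X : T -> Prop) (Y : U -> Prop)
  : Prop :=
  forall y, Y y <-> exists x, X x /\ F x = y.

Definition range_of (w : nat -> C) : C -> Prop := fun z => exists l, z = w l.

Definition equipotent (A B : C -> Prop) : Prop :=
  exists phi : C -> C,
    (forall x y, A x -> A y -> phi x = phi y -> x = y) /\ maps_onto phi A B.

Definition enumerates (s : list C) (A : C -> Prop) : Prop :=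
  NoDup s /\ forall a, A a <-> In a s.

Definition entire (f : C -> C) : Prop :=
  forall z : C, @ex_derive C_AbsRing C_NormedModule f z.

Definition simple_zero (f : C -> C) (z : C) : Prop :=
  f z = 0 /\
  exists d : C, @is_derive C_AbsRing C_NormedModule f z d /\ d <> 0.

Definition simple_zeros_exactly (f : C -> C) (Z : C -> Prop) : Prop :=
  (forall z, f z = 0 <-> Z z) /\ (forall z, f z = 0 -> simple_zero f z).

Definition biholomorphism_C (t : C -> C) : Prop :=
  entire t /\
  exists s : C -> C,
    entire s /\ (forall z, s (t z) = z) /\ (forall z, t (s z) = z).

Definition finite_even_subset (w : nat -> C) (A : C -> Prop) : Prop :=
  exists s : list C,
    enumerates s A /\ s <> nil /\ Nat.Even (length s) /\
    forall a, A a -> range_of w a.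

Definition subsequence_set (w : nat -> C) (A : C -> Prop) : Prop :=
  exists phi : nat -> nat,
    (forall i j, (i < j)%nat -> (phi i < phi j)%nat) /\
    forall a, A a <-> exists k, a = w (phi k).

Definition associated_function (A : C -> Prop) (g : C -> C) : Prop :=
  (exists s : list C,
     enumerates s A /\
     forall z, g z = fold_right Cmult 1 (map (fun a => z - a) s))
  \/
  ((~ exists s : list C, enumerates s A) /\
   entire g /\ simple_zeros_exactly g A).

(* Analytic subsets of C^n carry the induced structure: a map defined on such a
   subset is holomorphic when it is locally the restriction of a map which is
   complex differentiable on an open subset of the ambient space.  Maps between
   subsets are represented by total functions, of which only the values on the
   subset matter. *)
Definition holomorphic_on {V W : NormedModule C_AbsRing}
    (X : V -> Prop) (F : V -> W) : Prop :=
  forall p, X p ->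
    exists (U : V -> Prop) (G : V -> W),
      open U /\ U p /\
      (forall q, U q -> ex_filterdiff G (locally q)) /\
      (forall q, U q -> X q -> G q = F q).

(* Continuity for the topology induced on [X]. *)
Definition continuous_on_subset {V W : NormedModule C_AbsRing}
    (X : V -> Prop) (F : V -> W) : Prop :=
  forall p, X p -> filterlim F (within X (locally p)) (locally (F p)).

Definition inverse_maps {T U : Type} (X : T -> Prop) (Y : U -> Prop)
    (F : T -> U) (G : U -> T) : Prop :=
  (forall p, X p -> Y (F p)) /\ (forall q, Y q -> X (G q)) /\
  (forall p, X p -> G (F p) = p) /\ (forall q, Y q -> F (G q) = q).

Definition homeomorphism {V W : NormedModule C_AbsRing}
    (X : V -> Prop) (Y : W -> Prop) (F : V -> W) : Prop :=
  exists G : W -> V,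
    inverse_maps X Y F G /\
    continuous_on_subset X F /\ continuous_on_subset Y G.

Definition holomorphic_equivalence {V W : NormedModule C_AbsRing}
    (X : V -> Prop) (Y : W -> Prop) (F : V -> W) : Prop :=
  exists G : W -> V,
    inverse_maps X Y F G /\ holomorphic_on X F /\ holomorphic_on Y G.

Definition V_model (n m : nat) : C2 -> Prop :=
  fun p => (Cmod (fst p) < 1)%R /\ (Cmod (snd p) < 1)%R /\
           Cpow (fst p) n = Cpow (snd p) m.

(* The chart takes the point to the origin of V_{n,m}, which is the only point
   where the model can fail to be locally irreducible. *)
Definition Sing (S : C3 -> Prop) : C3 -> Prop :=
  fun p => S p /\
    exists (n m : nat) (U : C3 -> Prop) (F : C3 -> C2),
      (1 <= n)%nat /\ (1 <= m)%nat /\ (2 <= Nat.gcd n m)%nat /\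
      open U /\ U p /\
      holomorphic_equivalence (fun q => S q /\ U q) (V_model n m) F /\
      F p = ((0 : C), (0 : C)).

Definition regular_part (S : C3 -> Prop) : C3 -> Prop :=
  fun p => S p /\ ~ Sing S p.

Definition isomorphic (S1 S2 : C3 -> Prop) : Prop :=
  exists F : C3 -> C3,
    homeomorphism S1 S2 F /\
    maps_onto F (Sing S1) (Sing S2) /\
    holomorphic_on (regular_part S1) F.

Definition surface (f g : C -> C) : C3 -> Prop :=
  fun p => let '(z1, z2, z3) := p in Cpow z2 2 = f z1 /\ Cpow z3 2 = g z1.

(* Main.v *)
From Stdlib Require Import Reals Lra Lia List FinFun Classical ClassicalEpsilon.
From Coquelicot Require Import Coquelicot.
Require Import Defs.
Open Scope R_scope.

(** Write [W] for the zero set of [f]. The surface [z2^2 = f(z1), z3^2 = g(z1)] has four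
    points over a general [z1], two over a point of [W] outside [A], and one over a point
    of [A], where two smooth branches cross; these crossings are the nodes.

    From a biholomorphism [t] to an isomorphism: [f] and [f(t)] have the same simple zeros,
    so [f(t) = f q] with [q] entire and without zeros, and [q = u^2] because an entire
    function without zeros has an entire square root; likewise [h(t) = g v^2]. Then
    [(z1, z2, z3) |-> (t z1, u z2, v z3)] is a biholomorphism of the ambient space that maps
    one surface onto the other, and such a map preserves singular points because their
    definition is invariant ([isomorphic_of_biholomorphism]).

    From an isomorphism [F] to [t]: the nodes are exactly the points that locally
    disconnect the surface, and every singular point has this property, so [F] matches the
    nodes and is holomorphic outside them ([nodes_match], [base_coord_hol]). Let [y] be the
    first coordinate of [F], a function on the first surface. Since [F] is a homeomorphism,
    [y] tends to infinity with [z1]. The product of [y] over the fibre of [z1] is therefore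
    an entire function of [z1] that tends to infinity; such a function has a pole at
    infinity, hence grows polynomially, and so does [y] ([base_coord_growth]). The parts of
    [y] that are odd in [z2] have squares that descend to entire functions of polynomial
    growth vanishing on the infinite set [W]; they are zero, so [y] does not depend on [z2]
    ([base_coord_neg2]). The two remaining values of [y] over [z1] are the roots [c] of a
    polynomial correspondence in [z1] and [c]. Over each node it is totally ramified in both
    directions, and a value [c] outside [W] is taken over at most two points [z1]. Two nodes
    already force such a correspondence to be the square of a line
    ([ramified_correspondence]), so [y] does not depend on [z3] either. Thus [y = t(z1)] with
    [t] entire of polynomial growth; counting points in fibres shows that [t] is injective and
    preserves [W] and its complement, and an injective entire function of polynomial growth
    is affine ([base_map_affine]).

    The function theory is derived from pointwise complex differentiability: Goursat's lemma
    gives primitives, even when one point of mere continuity is allowed; hence Cauchy's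
    formula, the differentiability of derivatives, removable singularities, and Liouville's
    theorem. *)

(** * Complex limits and derivatives *)

(** Limits are taken along an arbitrary filter, so that the same rules serve functions of a complex
    variable, of a real variable, and on the surface. *)
Definition Clim {T : Type} (F : (T -> Prop) -> Prop) (f : T -> C) (l : C) : Prop :=
  forall eps, 0 < eps -> F (fun x => Cmod (f x - l) < eps).

(** The neighbourhoods come from the product topology of the plane; discs give the same ones. *)
Lemma locally_Cmod (z : C) (P : C -> Prop) :
  locally z P <-> exists d, 0 < d /\ forall y, Cmod (y - z) < d -> P y.
Proof.
  split.
  - intros [d Hd]. exists d; split; [apply cond_pos|].
    intros y Hy. apply Hd. apply C_NormedModule_mixin_compat1. exact Hy.
  - intros [d [Hd H]].
    assert (Hs : 0 < sqrt 2) by (apply sqrt_lt_R0; lra).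
    assert (Hp : 0 < d / sqrt 2) by (apply Rdiv_lt_0_compat; lra).
    exists (mkposreal _ Hp). intros y Hy. apply H.
    pose proof (C_NormedModule_mixin_compat2 z y _ Hy) as K.
    simpl in K. replace (sqrt 2 * (d / sqrt 2)) with d in K by (field; lra).
    exact K.
Qed.

Lemma Clim_filterlim {T : Type} (F : (T -> Prop) -> Prop) {FF : Filter F} f l :
  Clim F f l <-> filterlim f F (locally l).
Proof.
  split.
  - intros H P HP. apply locally_Cmod in HP. destruct HP as [d [Hd HP]].
    unfold filtermap. generalize (H d Hd). apply filter_imp. intros x Hx. apply HP, Hx.
  - intros H eps He. apply (H (fun y => Cmod (y - l) < eps)).
    apply locally_Cmod. exists eps; split; auto.
Qed.

#[global] Instance locally_C_filter (z : C) :
  @ProperFilter C (@locally C_UniformSpace z) := locally_filter z.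

Section Limits.
Context {T : Type} (F : (T -> Prop) -> Prop) {FF : Filter F}.

Lemma Clim_ext (f g : T -> C) l : F (fun x => f x = g x) -> Clim F f l -> Clim F g l.
Proof.
  intros E H eps He. generalize (filter_and (F:=F) _ _ E (H eps He)).
  apply filter_imp. intros x [-> K]; exact K.
Qed.

Lemma Clim_const (c : C) : Clim F (fun _ => c) c.
Proof.
  intros eps He. apply filter_forall. intros _.
  replace (c - c)%C with (RtoC 0) by ring. rewrite Cmod_0. exact He.
Qed.

Lemma Clim_plus (f g : T -> C) l m :
  Clim F f l -> Clim F g m -> Clim F (fun x => f x + g x)%C (l + m)%C.
Proof.
  intros Hf Hg eps He.
  generalize (filter_and (F:=F) _ _ (Hf (eps/2) ltac:(lra)) (Hg (eps/2) ltac:(lra))).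
  apply filter_imp. intros x [A B].
  replace (f x + g x - (l + m))%C with ((f x - l) + (g x - m))%C by ring.
  eapply Rle_lt_trans; [apply Cmod_triangle|lra].
Qed.

Lemma Clim_opp (f : T -> C) l : Clim F f l -> Clim F (fun x => - f x)%C (- l)%C.
Proof.
  intros Hf eps He. generalize (Hf eps He). apply filter_imp. intros x A.
  replace (- f x - - l)%C with (- (f x - l))%C by ring. rewrite Cmod_opp. exact A.
Qed.

Lemma Clim_minus (f g : T -> C) l m :
  Clim F f l -> Clim F g m -> Clim F (fun x => f x - g x)%C (l - m)%C.
Proof. intros; apply Clim_plus; [|apply Clim_opp]; assumption. Qed.

Lemma Clim_bound (f : T -> C) l : Clim F f l -> F (fun x => Cmod (f x) < Cmod l + 1).
Proof.
  intros H. generalize (H 1 Rlt_0_1). apply filter_imp. intros x Hx.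
  replace (f x) with ((f x - l) + l)%C by ring.
  eapply Rle_lt_trans; [apply Cmod_triangle|lra].
Qed.

Lemma Clim_mult (f g : T -> C) l m :
  Clim F f l -> Clim F g m -> Clim F (fun x => f x * g x)%C (l * m)%C.
Proof.
  intros Hf Hg eps He.
  pose proof (Cmod_ge_0 l) as Pl. pose proof (Cmod_ge_0 m) as Pm.
  assert (E1 : 0 < eps / 2 / (Cmod m + 1)) by (apply Rdiv_lt_0_compat; lra).
  assert (E2 : 0 < eps / 2 / (Cmod l + 1)) by (apply Rdiv_lt_0_compat; lra).
  generalize (filter_and (F:=F) _ _ (Clim_bound g m Hg)
     (filter_and (F:=F) _ _ (Hf _ E1) (Hg _ E2))).
  apply filter_imp. intros x [A [B D]].
  replace (f x * g x - l * m)%C with ((f x - l) * g x + l * (g x - m))%C by ring.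
  eapply Rle_lt_trans; [apply Cmod_triangle|]. rewrite !Cmod_mult.
  assert (Cmod (f x - l) * Cmod (g x) <= eps / 2 / (Cmod m + 1) * (Cmod m + 1)).
  { apply Rmult_le_compat; try apply Cmod_ge_0; lra. }
  assert (Cmod l * Cmod (g x - m) < eps / 2).
  { apply Rle_lt_trans with (Cmod l * (eps / 2 / (Cmod l + 1))).
    - apply Rmult_le_compat_l; lra.
    - apply Rlt_le_trans with ((Cmod l + 1) * (eps / 2 / (Cmod l + 1))).
      + apply Rmult_lt_compat_r; lra.
      + right; field; lra. }
  replace (eps / 2 / (Cmod m + 1) * (Cmod m + 1)) with (eps/2) in * by (field; lra).
  lra.
Qed.

Lemma Clim_away (f : T -> C) (l : C) : l <> 0%C -> Clim F f l ->
  F (fun x => Cmod l / 2 < Cmod (f x)).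
Proof.
  intros Hl0 H. pose proof (proj1 (Cmod_gt_0 l) Hl0) as Hl.
  generalize (H (Cmod l / 2) ltac:(lra)). apply filter_imp. intros x Hx.
  assert (Cmod l <= Cmod (f x) + Cmod (f x - l)); [|lra].
  replace l with (f x + - (f x - l))%C at 1 by ring.
  eapply Rle_trans; [apply Cmod_triangle|]. rewrite Cmod_opp. lra.
Qed.

Lemma Clim_inv (f : T -> C) (l : C) : l <> 0%C -> Clim F f l ->
  Clim F (fun x => / f x)%C (/ l)%C.
Proof.
  intros Hl H eps He. assert (Pl := proj1 (Cmod_gt_0 l) Hl).
  assert (E : 0 < eps * (Cmod l * (Cmod l / 2))) by
    (repeat apply Rmult_lt_0_compat; lra).
  generalize (filter_and (F:=F) _ _ (Clim_away f l Hl H) (H _ E)).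
  apply filter_imp. intros x [A B].
  assert (Hx : f x <> 0%C) by (apply Cmod_gt_0; lra).
  replace (/ f x - / l)%C with (- (f x - l) / (l * f x))%C by (field; auto).
  rewrite Cmod_div, Cmod_opp, Cmod_mult by (apply Cmult_neq_0; auto).
  assert (0 < Cmod l * Cmod (f x)) by (apply Rmult_lt_0_compat; lra).
  apply Rlt_div_l; auto. eapply Rlt_le_trans; [exact B|].
  apply Rmult_le_compat_l; [lra|]. apply Rmult_le_compat_l; lra.
Qed.

Lemma Clim_div (f g : T -> C) (l m : C) : m <> 0%C ->
  Clim F f l -> Clim F g m -> Clim F (fun x => f x / g x)%C (l / m)%C.
Proof. intros; apply Clim_mult; [|apply Clim_inv]; assumption. Qed.

Lemma Clim_pow (f : T -> C) l n : Clim F f l -> Clim F (fun x => Cpow (f x) n) (Cpow l n).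
Proof.
  intros H; induction n; simpl; [apply Clim_const|apply Clim_mult; assumption].
Qed.

Lemma Clim_comp (f : T -> C) (g : C -> C) l :
  Clim F f l -> Clim (locally l) g (g l) -> Clim F (fun x => g (f x)) (g l).
Proof.
  intros Hf Hg eps He. specialize (Hg eps He).
  apply locally_Cmod in Hg. destruct Hg as [d [Hd Hg]].
  generalize (Hf d Hd). apply filter_imp. auto.
Qed.

End Limits.

(** [apply], with the filter side condition discharged. *)
Tactic Notation "cap" uconstr(l) := apply l; try exact _.

Lemma Clim_eq {T} (F : (T -> Prop) -> Prop) (f : T -> C) (l m : C) :
  l = m -> Clim F f l -> Clim F f m.
Proof. intros ->; auto. Qed.

Notation Ccont f z := (Clim (@locally C_UniformSpace z) f (f z)).

Lemma Clim_id (z : C) : Clim (locally z) (fun y => y) z.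
Proof. intros eps He. apply locally_Cmod. exists eps; auto. Qed.

Lemma Ccont_loc (f : C -> C) z d : 0 < d ->
  Ccont f z -> exists r, 0 < r /\ forall y, Cmod (y - z) < r -> Cmod (f y - f z) < d.
Proof. intros Hd H. apply locally_Cmod, H, Hd. Qed.

(** Caratheodory's form of the derivative: the slope extends continuously to [z]. The rules for
    products and compositions then reduce to limits. *)
Definition Cderiv (f : C -> C) (z d : C) : Prop :=
  exists phi, (forall y, f y = f z + (y - z) * phi y)%C /\ phi z = d /\
              Clim (locally z) phi d.

Definition Cdiff f z := exists d, Cderiv f z d.

Lemma Cderiv_eps f z d : Cderiv f z d <->
  forall eps, 0 < eps -> exists r, 0 < r /\ forall y, Cmod (y - z) < r ->
     Cmod (f y - f z - d * (y - z)) <= eps * Cmod (y - z).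
Proof.
  split.
  - intros [phi [E [P L]]] eps He. specialize (L eps He).
    apply locally_Cmod in L. destruct L as [r [Hr L]].
    exists r; split; auto. intros y Hy. rewrite (E y).
    replace (f z + (y - z) * phi y - f z - d * (y - z))%C with ((phi y - d) * (y - z))%C by ring.
    rewrite Cmod_mult. apply Rmult_le_compat_r; [apply Cmod_ge_0|]. left; auto.
  - intros H.
    exists (fun y => if excluded_middle_informative (y = z) then d else (f y - f z) / (y - z))%C.
    repeat split.
    + intros y. destruct excluded_middle_informative as [->|N]; [ring|].
      assert (y - z <> 0)%C.
      { intros E. apply N. replace y with ((y - z) + z)%C by ring. rewrite E; ring. }
      field; auto.
    + destruct excluded_middle_informative; congruence.
    + intros eps He. destruct (H (eps/2) ltac:(lra)) as [r [Hr K]].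
      apply locally_Cmod. exists r; split; auto. intros y Hy.
      destruct excluded_middle_informative as [->|N].
      * replace (d - d)%C with (RtoC 0) by ring. rewrite Cmod_0; auto.
      * assert (N' : (y - z <> 0)%C).
        { intros E. apply N. replace y with ((y - z) + z)%C by ring. rewrite E; ring. }
        replace ((f y - f z) / (y - z) - d)%C with ((f y - f z - d * (y - z)) / (y - z))%C
          by (field; auto).
        rewrite Cmod_div by auto. pose proof (proj1 (Cmod_gt_0 _) N') as N2.
        apply Rle_lt_trans with (eps/2); [|lra].
        apply Rle_div_l; auto.
Qed.

Lemma Cderiv_ext_loc f g z d :
  locally z (fun y => f y = g y) -> Cderiv f z d -> Cderiv g z d.
Proof.
  intros E H. apply Cderiv_eps. intros eps He.
  destruct (proj1 (Cderiv_eps _ _ _) H eps He) as [r [Hr K]].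
  pose proof (locally_singleton _ _ E) as Ez. simpl in Ez.
  apply locally_Cmod in E. destruct E as [r' [Hr' E]].
  exists (Rmin r r'); split; [apply Rmin_pos; auto|]. intros y Hy.
  pose proof (Rmin_l r r'). pose proof (Rmin_r r r').
  rewrite <- E, <- Ez by lra. apply K; lra.
Qed.

Lemma Cderiv_ext f g z d : (forall y, f y = g y) -> Cderiv f z d -> Cderiv g z d.
Proof.
  intros E. apply Cderiv_ext_loc. apply filter_forall. exact E.
Qed.

Lemma Cderiv_cont f z d : Cderiv f z d -> Ccont f z.
Proof.
  intros [phi [E [P L]]].
  cap (@Clim_ext _ (locally (z:C)) _ (fun y => f z + (y - z) * phi y)%C).
  { apply filter_forall. intros; symmetry; apply E. }
  apply (Clim_eq _ _ (f z + (z - z) * d)%C); [ring|].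
  cap Clim_plus; [cap Clim_const|].
  cap Clim_mult; [|exact L].
  cap Clim_minus; [apply Clim_id|cap Clim_const].
Qed.

Lemma Cdiff_cont f z : Cdiff f z -> Ccont f z.
Proof. intros [d H]; eapply Cderiv_cont, H. Qed.

Lemma Cderiv_eq f z a b : a = b -> Cderiv f z a -> Cderiv f z b.
Proof. intros ->; auto. Qed.

Lemma Cderiv_const c z : Cderiv (fun _ => c) z 0.
Proof.
  exists (fun _ => RtoC 0); repeat split; [intros; ring|cap Clim_const].
Qed.

Lemma Cderiv_id z : Cderiv (fun y => y) z 1.
Proof.
  exists (fun _ => RtoC 1); repeat split; [intros; ring|cap Clim_const].
Qed.

Lemma Cderiv_plus f g z a b :
  Cderiv f z a -> Cderiv g z b -> Cderiv (fun y => f y + g y)%C z (a + b)%C.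
Proof.
  intros [p [Ep [Pp Lp]]] [q [Eq [Pq Lq]]].
  exists (fun y => p y + q y)%C; repeat split.
  - intros y. rewrite (Ep y), (Eq y). ring.
  - congruence.
  - cap Clim_plus; auto.
Qed.

Lemma Cderiv_opp f z a : Cderiv f z a -> Cderiv (fun y => - f y)%C z (- a)%C.
Proof.
  intros [p [Ep [Pp Lp]]]. exists (fun y => - p y)%C; repeat split.
  - intros y. rewrite (Ep y). ring.
  - congruence.
  - cap Clim_opp; auto.
Qed.

Lemma Cderiv_minus f g z a b :
  Cderiv f z a -> Cderiv g z b -> Cderiv (fun y => f y - g y)%C z (a - b)%C.
Proof. intros; apply Cderiv_plus; [|apply Cderiv_opp]; assumption. Qed.

Lemma Cderiv_mult f g z a b :
  Cderiv f z a -> Cderiv g z b ->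
  Cderiv (fun y => f y * g y)%C z (a * g z + f z * b)%C.
Proof.
  intros Hf Hg. pose proof (Cderiv_cont _ _ _ Hg) as Cg.
  destruct Hf as [p [Ep [Pp Lp]]]. destruct Hg as [q [Eq [Pq Lq]]].
  exists (fun y => p y * g y + f z * q y)%C; repeat split.
  - intros y. rewrite (Ep y), (Eq y). ring.
  - congruence.
  - cap Clim_plus; [|]; cap Clim_mult; auto.
    cap Clim_const.
Qed.

Lemma Cderiv_comp f g z a b :
  Cderiv f z a -> Cderiv g (f z) b -> Cderiv (fun y => g (f y)) z (b * a)%C.
Proof.
  intros Hf [q [Eq [Pq Lq]]]. pose proof (Cderiv_cont _ _ _ Hf) as Cf.
  destruct Hf as [p [Ep [Pp Lp]]].
  exists (fun y => q (f y) * p y)%C; repeat split.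
  - intros y. rewrite (Eq (f y)). rewrite (Ep y) at 1. ring.
  - congruence.
  - cap Clim_mult; [|exact Lp].
    rewrite <- Pq in *. apply (Clim_comp _ f q (f z)); auto.
Qed.

Lemma Cderiv_inv (z : C) : z <> 0%C -> Cderiv (fun y : C => / y)%C z (- / (z * z))%C.
Proof.
  intros Hz.
  exists (fun y : C => if excluded_middle_informative (y = RtoC 0) then (- (/ y - / z) / z)%C
                   else (- / (y * z))%C). repeat split.
  - intros y. destruct excluded_middle_informative as [->|N].
    + generalize (/ RtoC 0)%C as u. intros u. field; auto.
    + field; auto.
  - destruct excluded_middle_informative; congruence.
  - cap (@Clim_ext _ (locally (z:C)) _ (fun y : C => - / (y * z))%C).
    + apply locally_Cmod. exists (Cmod z). split; [apply Cmod_gt_0; auto|].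
      intros y Hy. destruct excluded_middle_informative as [->|N]; auto.
      exfalso. replace (0 - z)%C with (- z)%C in Hy by ring. rewrite Cmod_opp in Hy. lra.
    + cap Clim_opp; []. cap Clim_inv; [apply Cmult_neq_0; auto|].
      cap Clim_mult; [apply Clim_id|cap Clim_const].
Qed.

Lemma Cderiv_unique f z a b : Cderiv f z a -> Cderiv f z b -> a = b.
Proof.
  intros [p [Ep [Pp Lp]]] [q [Eq [Pq Lq]]].
  assert (K : forall y, y <> z -> p y = q y).
  { intros y N. assert (N' : (y - z <> 0)%C).
    { intros E. apply N. replace y with ((y - z) + z)%C by ring. rewrite E; ring. }
    assert (E : ((y - z) * p y = (y - z) * q y)%C).
    { replace ((y - z) * p y)%C with (f y - f z)%C by (rewrite (Ep y); ring).
      rewrite (Eq y); ring. }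
    replace (p y) with (((y - z) * p y) / (y - z))%C by (field; auto).
    rewrite E. field; auto. }
  apply NNPP; intros N.
  assert (P : 0 < Cmod (a - b)).
  { apply Cmod_gt_0. intros E. apply N. replace a with ((a - b) + b)%C by ring.
    rewrite E; ring. }
  pose proof (filter_and (F:=locally z) _ _ (Lp (Cmod (a-b)/2) ltac:(lra)) (Lq (Cmod (a-b)/2) ltac:(lra))) as H.
  apply locally_Cmod in H. destruct H as [d [Hd H]].
  assert (Hy : Cmod ((z + RtoC (d/2)) - z) < d).
  { replace (z + RtoC (d/2) - z)%C with (RtoC (d/2)) by ring.
    rewrite Cmod_R, Rabs_pos_eq; lra. }
  destruct (H _ Hy) as [X Y].
  rewrite <- K in Y.
  2:{ intros E. assert (RtoC (d/2) = 0).
      { replace (RtoC (d/2)) with ((z + RtoC (d/2)) - z)%C by ring. rewrite E; ring. }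
      apply RtoC_inj in H0. lra. }
  set (u := p (z + RtoC (d/2))%C) in *.
  assert (Cmod (a - b) <= Cmod (u - a) + Cmod (u - b)); [|lra].
  replace (a - b)%C with (- (u - a) + (u - b))%C by ring.
  eapply Rle_trans; [apply Cmod_triangle|]. rewrite Cmod_opp. lra.
Qed.

Lemma Cdiff_plus f g z : Cdiff f z -> Cdiff g z -> Cdiff (fun y => f y + g y)%C z.
Proof. intros [a A] [b B]. eexists. apply Cderiv_plus; eassumption. Qed.
Lemma Cdiff_minus f g z : Cdiff f z -> Cdiff g z -> Cdiff (fun y => f y - g y)%C z.
Proof. intros [a A] [b B]. eexists. apply Cderiv_minus; eassumption. Qed.
Lemma Cdiff_mult f g z : Cdiff f z -> Cdiff g z -> Cdiff (fun y => f y * g y)%C z.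
Proof. intros [a A] [b B]. eexists. apply Cderiv_mult; eassumption. Qed.
Lemma Cdiff_comp f g z : Cdiff f z -> Cdiff g (f z) -> Cdiff (fun y => g (f y)) z.
Proof. intros [a A] [b B]. eexists. apply (Cderiv_comp f g); eassumption. Qed.
Lemma Cdiff_const c z : Cdiff (fun _ => c) z.
Proof. eexists; apply Cderiv_const. Qed.
Lemma Cdiff_id z : Cdiff (fun y => y) z.
Proof. eexists; apply Cderiv_id. Qed.
Lemma Cdiff_inv (f : C -> C) z : f z <> 0%C -> Cdiff f z -> Cdiff (fun y => / f y)%C z.
Proof.
  intros N H. apply (Cdiff_comp f (fun y : C => / y)%C); auto.
  eexists. apply Cderiv_inv; auto.
Qed.
Lemma Cdiff_div (f g : C -> C) z : g z <> 0%C -> Cdiff f z -> Cdiff g z -> Cdiff (fun y => f y / g y)%C z.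
Proof. intros. apply Cdiff_mult; auto. apply Cdiff_inv; auto. Qed.
Lemma Cdiff_ext_loc f g z : locally z (fun y => f y = g y) -> Cdiff f z -> Cdiff g z.
Proof. intros E [d H]. exists d. eapply Cderiv_ext_loc; eauto. Qed.
Lemma Cdiff_ext f g z : (forall y, f y = g y) -> Cdiff f z -> Cdiff g z.
Proof. intros E [d H]. exists d. eapply Cderiv_ext; eauto. Qed.
Lemma Cdiff_pow f n z : Cdiff f z -> Cdiff (fun y => Cpow (f y) n) z.
Proof.
  intros H; induction n; simpl; [apply Cdiff_const|apply Cdiff_mult; assumption].
Qed.

Lemma is_derive_Cderiv (f : C -> C) (z d : C) :
  @is_derive C_AbsRing C_NormedModule f z d <-> Cderiv f z d.
Proof.
  split.
  - intros [_ H]. apply Cderiv_eps. intros eps He.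
    specialize (H z (fun P HP => HP) (mkposreal eps He)). simpl in H.
    destruct H as [r H]. exists r; split; [apply cond_pos|].
    intros y Hy. specialize (H y Hy).
    change (Cmod (minus (minus (f y) (f z)) (scal (minus y z) d))
       <= eps * Cmod (minus y z)) in H.
    replace (f y - f z - d * (y - z))%C
      with (minus (minus (f y) (f z)) (scal (minus y z) d)); [exact H|].
    unfold minus, plus, opp, scal; simpl. unfold mult; simpl. ring.
  - intros H. split; [apply is_linear_scal_l|].
    intros x Hx. 
    assert (E : x = z) by (symmetry; apply is_filter_lim_locally_unique; exact Hx).
    subst x. intros eps.
    destruct (proj1 (Cderiv_eps _ _ _) H eps (cond_pos eps)) as [r [Hr K]].
    exists (mkposreal r Hr). intros y Hy. specialize (K y Hy).
    change (Cmod (minus (minus (f y) (f z)) (scal (minus y z) d))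
       <= eps * Cmod (minus y z)).
    replace (minus (minus (f y) (f z)) (scal (minus y z) d)) 
      with (f y - f z - d * (y - z))%C; [exact K|].
    unfold minus, plus, opp, scal; simpl. unfold mult; simpl. ring.
Qed.

Lemma entire_Cdiff f : entire f <-> forall z, Cdiff f z.
Proof.
  split; intros H z; destruct (H z) as [d K]; exists d; apply is_derive_Cderiv; exact K.
Qed.

(** * Integrals of complex-valued functions along segments *)

Definition Rcont (phi : R -> C) (t : R) : Prop :=
  Clim (@locally R_UniformSpace t) phi (phi t).

Notation is_Cint := (@is_RInt C_R_NormedModule).

Definition Cint (phi : R -> C) (a b : R) : C :=
  @RInt C_R_CompleteNormedModule phi a b.

Lemma Rcont_continuous phi t : Rcont phi t <-> @continuous R_UniformSpace C_R_NormedModule phi t.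
Proof. apply (Clim_filterlim (@locally R_UniformSpace t)). Qed.

Lemma is_Cint_Cint phi a b : a <= b -> (forall t, a <= t <= b -> Rcont phi t) ->
  is_Cint phi a b (Cint phi a b).
Proof.
  intros Hab H. apply (@RInt_correct C_R_CompleteNormedModule).
  apply (@ex_RInt_continuous C_R_CompleteNormedModule).
  intros z Hz. rewrite Rmin_left, Rmax_right in Hz by auto.
  apply Rcont_continuous. auto.
Qed.

Lemma is_Cint_unique phi a b l : is_Cint phi a b l -> Cint phi a b = l.
Proof. apply (@is_RInt_unique C_R_CompleteNormedModule). Qed.

Lemma is_Cint_inj phi a b l m : is_Cint phi a b l -> is_Cint phi a b m -> l = m.
Proof. intros A B. apply is_Cint_unique in A, B. congruence. Qed.

Lemma is_Cint_ext phi psi a b l : (forall t, phi t = psi t) -> is_Cint phi a b l -> is_Cint psi a b l.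
Proof. intros E. apply is_RInt_ext. intros; apply E. Qed.

Lemma is_Cint_plus phi psi a b l m :
  is_Cint phi a b l -> is_Cint psi a b m -> is_Cint (fun t => phi t + psi t)%C a b (l + m)%C.
Proof. apply (@is_RInt_plus C_R_NormedModule). Qed.

(** Integration is real linear componentwise; complex scalars mix the two components. *)
Lemma is_Cint_scal (c : C) phi a b l : is_Cint phi a b l -> is_Cint (fun t => c * phi t)%C a b (c * l)%C.
Proof.
  intros H. pose proof (is_RInt_fct_extend_fst _ _ _ _ H) as H1.
  pose proof (is_RInt_fct_extend_snd _ _ _ _ H) as H2.
  apply (@is_RInt_fct_extend_pair R_NormedModule R_NormedModule).
  - apply (is_RInt_ext (fun t => minus (scal (fst c) (fst (phi t))) (scal (snd c) (snd (phi t))))).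
    { intros; reflexivity. }
    apply (@is_RInt_minus R_NormedModule); apply (@is_RInt_scal R_NormedModule); assumption.
  - apply (is_RInt_ext (fun t => plus (scal (fst c) (snd (phi t))) (scal (snd c) (fst (phi t))))).
    { intros; reflexivity. }
    apply (@is_RInt_plus R_NormedModule); apply (@is_RInt_scal R_NormedModule); assumption.
Qed.

Lemma is_Cint_minus phi psi a b l m :
  is_Cint phi a b l -> is_Cint psi a b m -> is_Cint (fun t => phi t - psi t)%C a b (l - m)%C.
Proof. apply (@is_RInt_minus C_R_NormedModule). Qed.

Lemma is_Cint_const (c : C) a b : is_Cint (fun _ => c) a b (RtoC (b - a) * c)%C.
Proof.
  rewrite <- scal_R_Cmult. apply (@is_RInt_const C_R_NormedModule).
Qed.

Lemma norm_C_R (z : C) : @norm R_AbsRing C_R_NormedModule z = Cmod z.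
Proof.
  unfold norm; simpl. unfold prod_norm, Cmod. f_equal.
  unfold norm; simpl. unfold abs; simpl.
  change (Rabs (fst z) ^ 2 + Rabs (snd z) ^ 2 = fst z ^ 2 + snd z ^ 2).
  rewrite !pow2_abs. reflexivity.
Qed.

Lemma is_Cint_bound phi a b l M : a <= b -> is_Cint phi a b l ->
  (forall t, a <= t <= b -> Cmod (phi t) <= M) -> Cmod l <= (b - a) * M.
Proof.
  intros Hab H B.
  rewrite <- norm_C_R.
  apply (@norm_RInt_le_const C_R_NormedModule phi a b l M Hab); [|exact H].
  intros t Ht. rewrite norm_C_R. auto.
Qed.

Lemma is_Cint_Chasles phi a b c l m : is_Cint phi a b l -> is_Cint phi b c m -> is_Cint phi a c (l + m)%C.
Proof. apply (@is_RInt_Chasles C_R_NormedModule). Qed.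

Lemma is_Cint_comp_lin phi u v a b l : is_Cint phi (u * a + v) (u * b + v) l ->
  is_Cint (fun t => RtoC u * phi (u * t + v)%R)%C a b l.
Proof.
  intros H. apply (is_RInt_comp_lin (V:=C_R_NormedModule)) in H.
  eapply is_Cint_ext; [|exact H]. intros t. apply scal_R_Cmult.
Qed.

Lemma is_Cint_swap phi a b l : is_Cint phi a b l -> is_Cint phi b a (- l)%C.
Proof. apply (@is_RInt_swap C_R_NormedModule). Qed.

(** The analogue of [Cderiv] for a curve in the plane. *)
Definition RCderiv (phi : R -> C) (t : R) (l : C) : Prop :=
  exists psi : R -> C, (forall s, phi s = phi t + RtoC (s - t) * psi s)%C /\ psi t = l /\
    Clim (@locally R_UniformSpace t) psi l.

Lemma RCderiv_is_derive phi t l : RCderiv phi t l ->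
  @is_derive R_AbsRing C_R_NormedModule phi t l.
Proof.
  intros [psi [E [P L]]]. split; [apply is_linear_scal_l|].
  intros x Hx.
  assert (E0 : x = t) by (symmetry; apply is_filter_lim_locally_unique; exact Hx).
  subst x. intros eps. generalize (L eps (cond_pos eps)). apply filter_imp.
  intros s Hs.
  rewrite norm_C_R. change (norm (minus s t)) with (Rabs (s - t)).
  match goal with |- Cmod ?x <= _ => replace x with ((psi s - l) * RtoC (s - t))%C end.
  - rewrite Cmod_mult, Cmod_R. apply Rmult_le_compat_r; [apply Rabs_pos|lra].
  - rewrite scal_R_Cmult, (E s). unfold minus, plus, opp; simpl.
    change (@opp R_AbelianGroup t) with (-t)%R. unfold Rminus.
    change prod_plus with Cplus. change prod_opp with Copp. ring.
Qed.

Lemma is_Cint_FTC Phi phi a b : a <= b ->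
  (forall t, a <= t <= b -> RCderiv Phi t (phi t)) ->
  (forall t, a <= t <= b -> Rcont phi t) ->
  is_Cint phi a b (Phi b - Phi a)%C.
Proof.
  intros Hab D H.
  apply (@is_RInt_derive C_R_CompleteNormedModule);
    rewrite Rmin_left, Rmax_right by auto; intros t Ht.
  - apply RCderiv_is_derive; auto.
  - apply Rcont_continuous; auto.
Qed.

Lemma Clim_RtoC (t : R) : Clim (@locally R_UniformSpace t) RtoC (RtoC t).
Proof.
  intros eps He. exists (mkposreal eps He). intros y Hy.
  rewrite <- RtoC_minus, Cmod_R. exact Hy.
Qed.

Lemma RCderiv_cont phi t l : RCderiv phi t l -> Rcont phi t.
Proof.
  intros [psi [E [P L]]]. unfold Rcont.
  apply (Clim_ext _ (fun s => phi t + RtoC (s - t) * psi s)%C).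
  { apply filter_forall. intros; symmetry; apply E. }
  apply (Clim_eq _ _ (phi t + (t - t) * l)%C); [ring|].
  cap Clim_plus; [cap Clim_const|]. cap Clim_mult; [|exact L].
  apply (Clim_ext _ (fun s => RtoC s - RtoC t)%C).
  { apply filter_forall. intros; symmetry; apply RtoC_minus. }
  cap Clim_minus; [apply Clim_RtoC|cap Clim_const].
Qed.

Lemma RCderiv_comp phi P t l d : RCderiv phi t l -> Cderiv P (phi t) d ->
  RCderiv (fun s => P (phi s)) t (d * l)%C.
Proof.
  intros H [p [Ep [Pp Lp]]]. pose proof (RCderiv_cont _ _ _ H) as Hc.
  destruct H as [psi [E [Pt L]]].
  exists (fun s => p (phi s) * psi s)%C. repeat split.
  - intros s. rewrite (Ep (phi s)). rewrite (E s) at 1. ring.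
  - congruence.
  - cap Clim_mult; [|exact L]. rewrite <- Pp in *.
    cap (Clim_comp _ phi p (phi t)); assumption.
Qed.

Lemma RCderiv_RtoC t : RCderiv RtoC t 1.
Proof.
  exists (fun _ => RtoC 1). repeat split; [|cap Clim_const].
  intros s. rewrite RtoC_minus. ring.
Qed.

Lemma Rcont_comp phi (f : C -> C) t : Rcont phi t -> Ccont f (phi t) -> Rcont (fun s => f (phi s)) t.
Proof. intros A B. cap (Clim_comp _ phi f (phi t)); assumption. Qed.

Definition seg (a b : C) (t : R) : C := (a + RtoC t * (b - a))%C.
Definition seg_int (f : C -> C) (a b : C) : C := ((b - a) * Cint (fun t => f (seg a b t)) 0 1)%C.
Definition onseg (P : C -> Prop) a b := forall t, 0 <= t <= 1 -> P (seg a b t).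

Lemma seg_deriv a b t : RCderiv (seg a b) t (b - a)%C.
Proof.
  exists (fun _ => (b - a)%C). repeat split; [|cap Clim_const].
  intros s. unfold seg. rewrite RtoC_minus. ring.
Qed.

Lemma seg_cont a b t : Rcont (seg a b) t.
Proof. eapply RCderiv_cont, seg_deriv. Qed.

Lemma seg_int_isI f a b : onseg (fun z => Ccont f z) a b ->
  is_Cint (fun t => f (seg a b t)) 0 1 (Cint (fun t => f (seg a b t)) 0 1).
Proof.
  intros H. apply is_Cint_Cint; [lra|]. intros t Ht. apply Rcont_comp; [apply seg_cont|auto].
Qed.

Lemma seg_int_bound f a b M : onseg (fun z => Ccont f z) a b ->
  onseg (fun z => Cmod (f z) <= M) a b -> Cmod (seg_int f a b) <= M * Cmod (b - a).
Proof.
  intros H B. unfold seg_int. rewrite Cmod_mult, Rmult_comm. 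
  apply Rmult_le_compat_r; [apply Cmod_ge_0|].
  replace M with ((1 - 0) * M) by ring. 
  eapply is_Cint_bound; [lra|apply seg_int_isI, H|]. exact B.
Qed.

(** Used both for integrals of explicit functions and to deduce that a function with zero
    derivative is constant. *)
Lemma seg_int_FTC f P a b : onseg (fun z => Ccont f z) a b ->
  onseg (fun z => Cderiv P z (f z)) a b -> seg_int f a b = (P b - P a)%C.
Proof.
  intros H D. unfold seg_int.
  assert (K : is_Cint (fun t => (b - a) * f (seg a b t))%C 0 1 (P (seg a b 1) - P (seg a b 0))%C).
  { apply (is_Cint_FTC (fun t => P (seg a b t))); [lra| |].
    - intros t Ht. rewrite Cmult_comm. apply RCderiv_comp; [apply seg_deriv|auto].
    - intros t Ht. unfold Rcont. cap Clim_mult; [cap Clim_const|].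
      apply (Rcont_comp (seg a b)); [apply seg_cont|auto]. }
  replace (P b - P a)%C with (P (seg a b 1) - P (seg a b 0))%C.
  - eapply is_Cint_inj; [|exact K]. apply is_Cint_scal, seg_int_isI, H.
  - unfold seg. do 2 f_equal; [|f_equal]; ring.
Qed.

Lemma seg_int_minus f g a b : onseg (fun z => Ccont f z) a b -> onseg (fun z => Ccont g z) a b ->
  seg_int (fun z => f z - g z)%C a b = (seg_int f a b - seg_int g a b)%C.
Proof.
  intros Hf Hg. unfold seg_int.
  rewrite (is_Cint_unique _ _ _ _ (is_Cint_minus _ _ _ _ _ _ (seg_int_isI f a b Hf) (seg_int_isI g a b Hg))).
  ring.
Qed.

(** Equations in the plane seen as a module over the reals are restated in the plane as a ring. *)
Ltac toC := match goal with |- @eq _ ?x ?y => change (@eq C x y) end.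

Lemma RtoC_m1 : RtoC (-1) = (- RtoC 1)%C.
Proof. rewrite <- RtoC_opp. f_equal. Qed.

Lemma seg_int_swap f a b : onseg (fun z => Ccont f z) a b -> seg_int f b a = (- seg_int f a b)%C.
Proof.
  intros H. unfold seg_int.
  pose proof (seg_int_isI f a b H) as K.
  apply is_Cint_swap in K.
  assert (K2 : is_Cint (fun t => RtoC (-1) * f (seg a b (-1 * t + 1)))%C 0 1 (- Cint (fun t => f (seg a b t)) 0 1)%C).
  { apply (is_Cint_comp_lin (fun t => f (seg a b t))). 
    replace (-1 * 0 + 1) with 1 by ring. replace (-1 * 1 + 1) with 0 by ring. exact K. }
  apply (is_Cint_scal (RtoC (-1))) in K2.
  rewrite (is_Cint_unique (fun t => f (seg b a t)) 0 1 (RtoC (-1) * - Cint (fun t => f (seg a b t)) 0 1)%C).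
  - rewrite RtoC_m1. toC. ring.
  - eapply is_Cint_ext; [|exact K2]. intros t. cbv beta.
    replace (seg a b (-1 * t + 1)) with (seg b a t).
    + rewrite RtoC_m1. toC. ring.
    + unfold seg. rewrite RtoC_plus, RtoC_mult. rewrite RtoC_m1. toC. ring.
Qed.

(** Reparametrize the two halves of the segment affinely. *)
Lemma seg_int_split f a b s : 0 <= s <= 1 -> onseg (fun z => Ccont f z) a b ->
  seg_int f a b = (seg_int f a (seg a b s) + seg_int f (seg a b s) b)%C.
Proof.
  intros Hs H. set (m := seg a b s).
  assert (H1 : onseg (fun z => Ccont f z) a m).
  { intros t Ht. replace (seg a m t) with (seg a b (s * t)).
    - apply H. nra.
    - unfold m, seg. rewrite RtoC_mult. ring. }
  assert (H2 : onseg (fun z => Ccont f z) m b).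
  { intros t Ht. replace (seg m b t) with (seg a b ((1 - s) * t + s)).
    - apply H. nra.
    - unfold m, seg. rewrite RtoC_plus, RtoC_mult, RtoC_minus. ring. }
  assert (C0 : forall u v, 0 <= u -> u <= v -> v <= 1 -> is_Cint (fun t => f (seg a b t)) u v (Cint (fun t => f (seg a b t)) u v)).
  { intros. apply is_Cint_Cint; auto. intros t Ht. apply Rcont_comp; [apply seg_cont|]. apply H; lra. }
  pose proof (C0 0 s ltac:(lra) ltac:(lra) ltac:(lra)) as I1.
  pose proof (C0 s 1 ltac:(lra) ltac:(lra) ltac:(lra)) as I2.
  pose proof (is_Cint_unique _ _ _ _ (is_Cint_Chasles _ _ _ _ _ _ I1 I2)) as I3.
  assert (J1 : is_Cint (fun t => RtoC s * f (seg a m t))%C 0 1 (Cint (fun t => f (seg a b t)) 0 s)).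
  { eapply is_Cint_ext.
    2:{ apply (is_Cint_comp_lin (fun t => f (seg a b t)) s 0).
        replace (s * 0 + 0) with 0 by ring. replace (s * 1 + 0) with s by ring. exact I1. }
    intros t. cbv beta. replace (seg a b (s * t + 0)) with (seg a m t); [reflexivity|].
    unfold m, seg. rewrite RtoC_plus, RtoC_mult. ring. }
  assert (J2 : is_Cint (fun t => RtoC (1 - s) * f (seg m b t))%C 0 1 (Cint (fun t => f (seg a b t)) s 1)).
  { eapply is_Cint_ext.
    2:{ apply (is_Cint_comp_lin (fun t => f (seg a b t)) (1 - s) s).
        replace ((1 - s) * 0 + s) with s by ring. replace ((1 - s) * 1 + s) with 1 by ring. exact I2. }
    intros t. cbv beta. replace (seg a b ((1 - s) * t + s)) with (seg m b t); [reflexivity|].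
    unfold m, seg. rewrite RtoC_plus, RtoC_mult, RtoC_minus. ring. }
  unfold seg_int. rewrite I3.
  rewrite <- (is_Cint_inj _ _ _ _ _ (is_Cint_scal (RtoC s) _ _ _ _ (seg_int_isI f a m H1)) J1).
  rewrite <- (is_Cint_inj _ _ _ _ _ (is_Cint_scal (RtoC (1 - s)) _ _ _ _ (seg_int_isI f m b H2)) J2).
  replace (m - a)%C with (RtoC s * (b - a))%C by (unfold m, seg; ring).
  replace (b - m)%C with (RtoC (1 - s) * (b - a))%C by (unfold m, seg; rewrite RtoC_minus; ring).
  ring.
Qed.

(** * Goursat's lemma *)

(** Completeness of the plane in the form needed for nested triangles, with the rate of
    convergence kept. *)
Lemma Cauchy_bound_lim (u : nat -> C) (e : nat -> R) :
  (forall n m, (n <= m)%nat -> Cmod (u m - u n) <= e n) -> is_lim_seq e 0 ->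
  exists l, forall n, Cmod (l - u n) <= e n.
Proof.
  intros H He.
  assert (K : forall p : C -> R, (forall x y, Rabs (p x - p y) <= Cmod (x - y)) ->
            exists l : R, is_lim_seq (fun n => p (u n)) l).
  { intros p Hp. apply ex_lim_seq_cauchy_corr. intros eps.
    apply is_lim_seq_spec in He. destruct (He (pos_div_2 eps)) as [N HN].
    exists N. intros n m Hn Hm. specialize (HN N (Nat.le_refl _)). simpl in HN.
    pose proof (H N n Hn) as A. pose proof (H N m Hm) as B.
    rewrite Rminus_0_r in HN. apply Rabs_def2 in HN.
    eapply Rle_lt_trans; [apply Hp|].
    replace (u n - u m)%C with ((u n - u N) + - (u m - u N))%C by ring.
    eapply Rle_lt_trans; [apply Cmod_triangle|]. rewrite Cmod_opp. lra. }
  destruct (K fst) as [l1 L1].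
  { intros x y. eapply Rle_trans; [|apply Rmax_Cmod]. apply Rmax_l. }
  destruct (K snd) as [l2 L2].
  { intros x y. eapply Rle_trans; [|apply Rmax_Cmod]. apply Rmax_r. }
  exists (l1, l2). intros n. apply le_epsilon. intros eps Heps.
  apply is_lim_seq_spec in L1. apply is_lim_seq_spec in L2.
  assert (E2 : 0 < eps / 2) by lra.
  destruct (L1 (mkposreal _ E2)) as [N1 H1]. destruct (L2 (mkposreal _ E2)) as [N2 H2].
  set (m := (n + N1 + N2)%nat).
  specialize (H1 m ltac:(unfold m; lia)). specialize (H2 m ltac:(unfold m; lia)). simpl in H1, H2.
  replace ((l1, l2) - u n)%C with ((u m - u n) + - (u m - (l1, l2)))%C by ring.
  eapply Rle_trans; [apply Cmod_triangle|]. rewrite Cmod_opp.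
  apply Rplus_le_compat; [apply H; unfold m; lia|].
  replace (u m - (l1, l2))%C with (RtoC (fst (u m) - l1) + Ci * RtoC (snd (u m) - l2))%C.
  - eapply Rle_trans; [apply Cmod_triangle|].
    rewrite Cmod_mult, !Cmod_R, Cmod_Ci. lra.
  - apply injective_projections; simpl; ring.
Qed.

Definition convex (K : C -> Prop) := forall a b, K a -> K b -> onseg K a b.
Definition seq_closed (K : C -> Prop) :=
  forall z, (forall eps, 0 < eps -> exists y, K y /\ Cmod (y - z) < eps) -> K z.

Definition triangle_int (f : C -> C) (a b c : C) : C := (seg_int f a b + seg_int f b c + seg_int f c a)%C.
Definition perim (a b c : C) : R := Cmod (b - a) + Cmod (c - b) + Cmod (a - c).

Ltac cfield := field; repeat split;
  try (let E := fresh in intros E; apply RtoC_inj in E; lra).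

Definition mid a b := seg a b (1/2).

Lemma mid_eq a b : mid a b = ((a + b) / 2)%C.
Proof. unfold mid, seg. rewrite RtoC_div by lra. cfield. Qed.

Lemma Cmod_half z : Cmod (z / 2) = Cmod z / 2.
Proof. rewrite Cmod_div by (intros E; apply RtoC_inj in E; lra). rewrite Cmod_R, Rabs_pos_eq; lra. Qed.

Section Goursat.
Variables (K : C -> Prop) (f : C -> C).
Hypothesis Kc : convex K.
Hypothesis Kf : forall z, K z -> Ccont f z.

Lemma continuous_on_segment a b : K a -> K b -> onseg (fun z => Ccont f z) a b.
Proof. intros Ha Hb t Ht. apply Kf. apply (Kc a b); auto. Qed.

Lemma convex_mid a b : K a -> K b -> K (mid a b).
Proof. intros Ha Hb. apply Kc; auto; lra. Qed.

Lemma seg_int_swap_convex a b : K a -> K b -> seg_int f b a = (- seg_int f a b)%C.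
Proof. intros; apply seg_int_swap, continuous_on_segment; auto. Qed.

Lemma seg_int_mid a b : K a -> K b -> seg_int f a b = (seg_int f a (mid a b) + seg_int f (mid a b) b)%C.
Proof. intros; apply seg_int_split; [lra|apply continuous_on_segment; auto]. Qed.

Lemma triangle_int_subdiv a b c : K a -> K b -> K c ->
  let p := mid a b in let r := mid b c in let q := mid c a in
  triangle_int f a b c = (triangle_int f a p q + triangle_int f p b r + triangle_int f q r c + triangle_int f p r q)%C.
Proof.
  intros Ha Hb Hc p r q. unfold triangle_int.
  assert (Hp : K p) by (apply convex_mid; auto). assert (Hr : K r) by (apply convex_mid; auto).
  assert (Hq : K q) by (apply convex_mid; auto).
  rewrite (seg_int_mid a b), (seg_int_mid b c), (seg_int_mid c a) by auto. fold p r q.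
  rewrite (seg_int_swap_convex p q), (seg_int_swap_convex r p), (seg_int_swap_convex q r) by auto. ring.
Qed.

(** One of the four triangles cut out by the midpoints carries at least a quarter of the integral. *)
Lemma triangle_step a b c : K a -> K b -> K c ->
  exists a' b' c', K a' /\ K b' /\ K c' /\ Cmod (triangle_int f a b c) <= 4 * Cmod (triangle_int f a' b' c') /\
    perim a' b' c' = perim a b c / 2 /\ Cmod (a' - a) <= perim a b c.
Proof.
  intros Ha Hb Hc. pose proof (triangle_int_subdiv a b c Ha Hb Hc) as E. simpl in E.
  set (p := mid a b) in *. set (r := mid b c) in *. set (q := mid c a) in *.
  assert (Hp : K p) by (apply convex_mid; auto). assert (Hr : K r) by (apply convex_mid; auto).
  assert (Hq : K q) by (apply convex_mid; auto).
  assert (B : Cmod (triangle_int f a b c) <= Cmod (triangle_int f a p q) + Cmod (triangle_int f p b r) + Cmod (triangle_int f q r c) + Cmod (triangle_int f p r q)).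
  { rewrite E. eapply Rle_trans; [apply Cmod_triangle|]. apply Rplus_le_compat_r.
    eapply Rle_trans; [apply Cmod_triangle|]. apply Rplus_le_compat_r. apply Cmod_triangle. }
  assert (X1 : Cmod (p - a) = Cmod (b - a) / 2).
  { rewrite <- Cmod_half. f_equal. unfold p. rewrite mid_eq. cfield. }
  assert (X2 : Cmod (b - p) = Cmod (b - a) / 2).
  { rewrite <- Cmod_half. f_equal. unfold p. rewrite mid_eq. cfield. }
  assert (X3 : Cmod (r - b) = Cmod (c - b) / 2).
  { rewrite <- Cmod_half. f_equal. unfold r. rewrite mid_eq. cfield. }
  assert (X4 : Cmod (c - r) = Cmod (c - b) / 2).
  { rewrite <- Cmod_half. f_equal. unfold r. rewrite mid_eq. cfield. }
  assert (X5 : Cmod (q - c) = Cmod (a - c) / 2).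
  { rewrite <- Cmod_half. f_equal. unfold q. rewrite mid_eq. cfield. }
  assert (X6 : Cmod (a - q) = Cmod (a - c) / 2).
  { rewrite <- Cmod_half. f_equal. unfold q. rewrite mid_eq. cfield. }
  assert (X7 : Cmod (q - p) = Cmod (c - b) / 2).
  { rewrite <- Cmod_half. f_equal. unfold q, p. rewrite !mid_eq. cfield. }
  assert (X8 : Cmod (p - r) = Cmod (a - c) / 2).
  { rewrite <- Cmod_half. f_equal. unfold r, p. rewrite !mid_eq. cfield. }
  assert (X9 : Cmod (r - q) = Cmod (b - a) / 2).
  { rewrite <- Cmod_half. f_equal. unfold r, q. rewrite !mid_eq. cfield. }
  assert (S : forall x y, Cmod (x - y) = Cmod (y - x)).
  { intros. rewrite <- Cmod_opp. f_equal. ring. }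
  pose proof (Cmod_ge_0 (b - a)). pose proof (Cmod_ge_0 (c - b)). pose proof (Cmod_ge_0 (a - c)).
  destruct (Rle_dec (Cmod (triangle_int f a b c)) (4 * Cmod (triangle_int f a p q))).
  { exists a, p, q. repeat split; auto; unfold perim; [lra|].
    replace (a - a)%C with (RtoC 0) by ring. rewrite Cmod_0; lra. }
  destruct (Rle_dec (Cmod (triangle_int f a b c)) (4 * Cmod (triangle_int f p b r))).
  { exists p, b, r. repeat split; auto; unfold perim; lra. }
  destruct (Rle_dec (Cmod (triangle_int f a b c)) (4 * Cmod (triangle_int f q r c))).
  { exists q, r, c. repeat split; auto; unfold perim; try lra. rewrite S; lra. }
  exists p, r, q. repeat split; auto; unfold perim; try lra.
  rewrite (S r p), (S q r), (S p q). lra.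
Qed.

(** Triangles are bundled with the proof that their vertices lie in [K], so that the choice of a
    smaller triangle can be iterated. *)
Definition triangle := {T : C * C * C | K (fst (fst T)) /\ K (snd (fst T)) /\ K (snd T)}.
Definition triangle_value (T : triangle) := Cmod (triangle_int f (fst (fst (proj1_sig T))) (snd (fst (proj1_sig T))) (snd (proj1_sig T))).
Definition triangle_perim (T : triangle) := perim (fst (fst (proj1_sig T))) (snd (fst (proj1_sig T))) (snd (proj1_sig T)).
Definition triangle_apex (T : triangle) := fst (fst (proj1_sig T)).

Lemma next_triangle (T : triangle) : {T' : triangle | triangle_value T <= 4 * triangle_value T' /\ triangle_perim T' = triangle_perim T / 2 /\ Cmod (triangle_apex T' - triangle_apex T) <= triangle_perim T}.
Proof.
  apply constructive_indefinite_description. destruct T as [[[a b] c] [Ha [Hb Hc]]]. simpl in *.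
  destruct (triangle_step a b c Ha Hb Hc) as [a' [b' [c' [Ha' [Hb' [Hc' H]]]]]].
  exists (exist _ (a', b', c') (conj Ha' (conj Hb' Hc'))). exact H.
Qed.

Fixpoint triangle_seq (T : triangle) n : triangle := match n with O => T | S n => proj1_sig (next_triangle (triangle_seq T n)) end.

Lemma half_pow_lim (c : R) : is_lim_seq (fun n => c * (1/2)^n) 0.
Proof.
  replace (Finite 0) with (Rbar_mult c 0) by (simpl; f_equal; ring).
  apply is_lim_seq_scal_l. apply is_lim_seq_geom. rewrite Rabs_pos_eq; lra.
Qed.

(** Bisect. The triangles shrink to a point where [f] is differentiable, and near that point [f] is
    an affine function, whose integral is zero, up to an error that is small compared with the
    diameter. The integral of the error is small compared with the square of the diameter, while
    bisection loses only a factor four. *)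
Lemma Goursat_triangle a b c : seq_closed K -> (forall z, K z -> Cdiff f z) ->
  K a -> K b -> K c -> triangle_int f a b c = 0%C.
Proof.
  intros Kcl Kd Ha Hb Hc.
  set (T0 := exist (fun T => K (fst (fst T)) /\ K (snd (fst T)) /\ K (snd T)) (a, b, c) (conj Ha (conj Hb Hc)) : triangle).
  set (L := perim a b c). set (eta := Cmod (triangle_int f a b c)).
  assert (HL : 0 <= L).
  { unfold L, perim. pose proof (Cmod_ge_0 (b - a)). pose proof (Cmod_ge_0 (c - b)). pose proof (Cmod_ge_0 (a - c)). lra. }
  assert (SL : forall n, triangle_perim (triangle_seq T0 n) = L * (1/2)^n).
  { induction n; simpl.
    - unfold triangle_perim; simpl. fold L. ring.
    - destruct (next_triangle (triangle_seq T0 n)) as [T' [H1 [H2 H3]]]. simpl. rewrite H2, IHn. field. }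
  assert (SJ : forall n, eta * ((1/2)^n * (1/2)^n) <= triangle_value (triangle_seq T0 n)).
  { induction n; simpl.
    - unfold triangle_value; simpl. fold eta. lra.
    - destruct (next_triangle (triangle_seq T0 n)) as [T' [H1 [H2 H3]]]. simpl. lra. }
  assert (SA : forall n, Cmod (triangle_apex (triangle_seq T0 (S n)) - triangle_apex (triangle_seq T0 n)) <= L * (1/2)^n).
  { intros n. rewrite <- SL. simpl. destruct (next_triangle (triangle_seq T0 n)) as [T' [H1 [H2 H3]]]. simpl. auto. }
  assert (P0 : forall n, 0 < (1/2)^n) by (intros; apply pow_lt; lra).
  assert (SC : forall n m, (n <= m)%nat -> Cmod (triangle_apex (triangle_seq T0 m) - triangle_apex (triangle_seq T0 n)) <= 2 * L * (1/2)^n).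
  { intros n m Hnm. 
    assert (Q : Cmod (triangle_apex (triangle_seq T0 m) - triangle_apex (triangle_seq T0 n)) <= 2 * L * (1/2)^n - 2 * L * (1/2)^m).
    { induction Hnm.
      - replace (triangle_apex (triangle_seq T0 n) - triangle_apex (triangle_seq T0 n))%C with (RtoC 0) by ring. rewrite Cmod_0; lra.
      - replace (triangle_apex (triangle_seq T0 (S m)) - triangle_apex (triangle_seq T0 n))%C with
          ((triangle_apex (triangle_seq T0 (S m)) - triangle_apex (triangle_seq T0 m)) + (triangle_apex (triangle_seq T0 m) - triangle_apex (triangle_seq T0 n)))%C by ring.
        eapply Rle_trans; [apply Cmod_triangle|]. specialize (SA m). simpl pow. lra. }
    specialize (P0 m). nra. }
  destruct (Cauchy_bound_lim (fun n => triangle_apex (triangle_seq T0 n)) (fun n => 2 * L * (1/2)^n) SC (half_pow_lim _)) as [z0 Hz0].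
  assert (Kz : K z0).
  { apply Kcl. intros eps He. pose proof (half_pow_lim (2 * L)) as H.
    apply is_lim_seq_spec in H. destruct (H (mkposreal eps He)) as [N HN].
    specialize (HN N (Nat.le_refl _)). simpl in HN. rewrite Rminus_0_r in HN. apply Rabs_def2 in HN.
    exists (triangle_apex (triangle_seq T0 N)). split.
    - destruct (triangle_seq T0 N) as [T [H1 H2]]. exact H1.
    - rewrite <- Cmod_opp. replace (- (triangle_apex (triangle_seq T0 N) - z0))%C with (z0 - triangle_apex (triangle_seq T0 N))%C by ring.
      eapply Rle_lt_trans; [apply Hz0|lra]. }
  destruct (Kd z0 Kz) as [d Hd].
  apply Cmod_eq_0. fold eta. apply Rle_antisym; [|apply Cmod_ge_0].
  apply le_epsilon. intros e0 He0. rewrite Rplus_0_l.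
  (* the error integral is at most 3 eps L^2 / 4^N *)
  set (eps := e0 / (3 * L * L + 1)).
  assert (HL2 : 0 < 3 * L * L + 1) by nra.
  assert (He : 0 < eps) by (apply Rdiv_lt_0_compat; lra).
  destruct (proj1 (Cderiv_eps _ _ _) Hd eps He) as [r [Hr Hf]].
  pose proof (half_pow_lim (3 * L)) as H.
  apply is_lim_seq_spec in H. destruct (H (mkposreal r Hr)) as [N HN].
  specialize (HN N (Nat.le_refl _)). simpl in HN. rewrite Rminus_0_r in HN. apply Rabs_def2 in HN.
  specialize (SJ N). specialize (SL N). specialize (Hz0 N). unfold triangle_value, triangle_perim, triangle_apex in *. specialize (P0 N).
  destruct (triangle_seq T0 N) as [[[x y] z] [Hx [Hy Hz]]]. simpl in *.
  set (h := (1/2)^N) in *.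
  set (g := fun u => (f z0 + d * (u - z0))%C).
  assert (Dg : forall u, Cderiv (fun u => f z0 * u + d * ((u - z0) * (u - z0)) / 2)%C u (g u)).
  { intros u. unfold g. eapply Cderiv_eq.
    2:{ apply Cderiv_plus.
      - apply (Cderiv_mult (fun _ => f z0) (fun u => u)); [apply Cderiv_const|apply Cderiv_id].
      - apply (Cderiv_mult (fun u => d * ((u - z0) * (u - z0)))%C (fun _ => / 2)%C); [|apply Cderiv_const].
        apply (Cderiv_mult (fun _ => d) (fun u => (u - z0) * (u - z0))%C); [apply Cderiv_const|].
        apply (Cderiv_mult (fun u => u - z0)%C (fun u => u - z0)%C);
          apply (Cderiv_minus (fun u => u) (fun _ => z0)); (apply Cderiv_id || apply Cderiv_const). }
    cfield. }
  assert (Cg : forall u, Ccont g u).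
  { intros u. unfold g. cap Clim_plus; [cap Clim_const|]. cap Clim_mult; [cap Clim_const|].
    cap Clim_minus; [apply Clim_id|cap Clim_const]. }
  assert (Jg : triangle_int g x y z = 0%C).
  { unfold triangle_int. rewrite !(seg_int_FTC g _ _ _ (fun t _ => Cg _) (fun t _ => Dg _)). cfield. }
  assert (E : forall u v, K u -> K v ->
     (forall t, 0 <= t <= 1 -> Cmod (seg u v t - x) <= perim x y z) ->
     Cmod (seg_int f u v - seg_int g u v) <= eps * (3 * (L * h)) * Cmod (v - u)).
  { intros u v Hu Hv D. 
    rewrite <- (seg_int_minus f g u v); [|apply continuous_on_segment; auto|intros t Ht; apply Cg].
    apply seg_int_bound.
    - intros t Ht. cap Clim_minus; [apply (continuous_on_segment u v); auto|apply Cg].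
    - intros t Ht. unfold g.
      assert (D1 : Cmod (seg u v t - z0) <= 3 * (L * h)).
      { replace (seg u v t - z0)%C with ((seg u v t - x) + - (z0 - x))%C by ring.
        eapply Rle_trans; [apply Cmod_triangle|]. rewrite Cmod_opp. specialize (D t Ht). lra. }
      replace (f (seg u v t) - (f z0 + d * (seg u v t - z0)))%C with
        (f (seg u v t) - f z0 - d * (seg u v t - z0))%C by ring.
      eapply Rle_trans; [apply Hf; lra|]. apply Rmult_le_compat_l; lra. }
  assert (A1 : forall t, 0 <= t <= 1 -> forall w, Cmod (RtoC t * w) <= Cmod w).
  { intros t Ht w. rewrite Cmod_mult, Cmod_R, Rabs_pos_eq by lra. pose proof (Cmod_ge_0 w). nra. }
  pose proof (Cmod_ge_0 (y - x)). pose proof (Cmod_ge_0 (z - y)). pose proof (Cmod_ge_0 (x - z)).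
  assert (E1 := E x y Hx Hy). assert (E2 := E y z Hy Hz). assert (E3 := E z x Hz Hx).
  assert (F1 : Cmod (seg_int f x y - seg_int g x y) <= eps * (3 * (L * h)) * Cmod (y - x)).
  { apply E1. intros t Ht. unfold seg. replace (x + t * (y - x) - x)%C with (t * (y - x))%C by ring.
    eapply Rle_trans; [apply A1; auto|]. unfold perim; lra. }
  assert (F2 : Cmod (seg_int f y z - seg_int g y z) <= eps * (3 * (L * h)) * Cmod (z - y)).
  { apply E2. intros t Ht. unfold seg. replace (y + t * (z - y) - x)%C with ((y - x) + t * (z - y))%C by ring.
    eapply Rle_trans; [apply Cmod_triangle|]. specialize (A1 t Ht (z - y)%C). unfold perim; lra. }
  assert (F3 : Cmod (seg_int f z x - seg_int g z x) <= eps * (3 * (L * h)) * Cmod (x - z)).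
  { apply E3. intros t Ht. unfold seg. replace (z + t * (x - z) - x)%C with (RtoC (1 - t) * - (x - z))%C by (rewrite RtoC_minus; ring).
    eapply Rle_trans; [apply A1; lra|]. rewrite Cmod_opp. unfold perim; lra. }
  assert (G : Cmod (triangle_int f x y z) <= eps * (3 * (L * h)) * (L * h)).
  { replace (triangle_int f x y z) with (triangle_int f x y z - triangle_int g x y z)%C by (rewrite Jg; ring).
    unfold triangle_int.
    replace (seg_int f x y + seg_int f y z + seg_int f z x - (seg_int g x y + seg_int g y z + seg_int g z x))%C with
      ((seg_int f x y - seg_int g x y) + (seg_int f y z - seg_int g y z) + (seg_int f z x - seg_int g z x))%C by ring.
    eapply Rle_trans; [apply Cmod_triangle|].
    eapply Rle_trans; [apply Rplus_le_compat_r, Cmod_triangle|].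
    rewrite <- SL at 2. unfold perim. lra. }
  assert (G2 : eta * (h * h) <= (eps * (3 * L * L)) * (h * h)) by lra.
  apply Rmult_le_reg_r in G2; [|nra].
  eapply Rle_trans; [exact G2|]. unfold eps.
  apply Rle_trans with (e0 / (3 * L * L + 1) * (3 * L * L + 1)).
  - apply Rmult_le_compat_l; [left; exact He|lra].
  - right; field; lra.
Qed.
End Goursat.

(** * Primitives in a disc *)

Definition Disc (c : C) (R : R) : C -> Prop := fun z => Cmod (z - c) < R.

Lemma Cmod_sub_sym x y : Cmod (x - y) = Cmod (y - x).
Proof. rewrite <- Cmod_opp. f_equal. ring. Qed.

Lemma Cmod_self x : Cmod (x - x) = 0.
Proof. replace (x - x)%C with (RtoC 0) by ring. apply Cmod_0. Qed.

Lemma Cmod_tri3 x y z : Cmod (x - z) <= Cmod (x - y) + Cmod (y - z).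
Proof. replace (x - z)%C with ((x - y) + (y - z))%C by ring. apply Cmod_triangle. Qed.

Lemma Cminus_neq (x y : C) : x <> y -> (x - y)%C <> 0%C.
Proof. intros N E. apply N. replace x with ((x - y) + y)%C by ring. rewrite E; ring. Qed.

Lemma Cmod_minus_pos x y : x <> y -> 0 < Cmod (x - y).
Proof. intros N. apply Cmod_gt_0, Cminus_neq, N. Qed.

Lemma Cmod_seg_le a b t c r : 0 <= t <= 1 -> Cmod (a - c) <= r -> Cmod (b - c) <= r ->
  Cmod (seg a b t - c) <= r.
Proof.
  intros Ht Ha Hb. unfold seg.
  replace (a + t * (b - a) - c)%C with (RtoC (1 - t) * (a - c) + RtoC t * (b - c))%C
    by (rewrite RtoC_minus; ring).
  eapply Rle_trans; [apply Cmod_triangle|]. rewrite !Cmod_mult, !Cmod_R, !Rabs_pos_eq by lra. nra.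
Qed.

Lemma Disc_convex c r : convex (Disc c r).
Proof.
  intros a b Ha Hb t Ht. unfold Disc in *.
  apply Rle_lt_trans with (Rmax (Cmod (a - c)) (Cmod (b - c))).
  - apply Cmod_seg_le; auto; [apply Rmax_l|apply Rmax_r].
  - apply Rmax_lub_lt; auto.
Qed.

Lemma Disc_open c r z : Disc c r z -> exists d, 0 < d /\ forall y, Cmod (y - z) < d -> Disc c r y.
Proof.
  unfold Disc; intros H. exists (r - Cmod (z - c)). split; [lra|]. intros y Hy.
  eapply Rle_lt_trans; [apply (Cmod_tri3 y z c)|]. lra.
Qed.

Lemma seg_int_near f z eps : 0 < eps -> Ccont f z ->
  forall d, 0 < d -> (forall y, Cmod (y - z) < d -> Ccont f y) ->
  exists r, 0 < r /\ forall y, Cmod (y - z) < r ->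
    Cmod (seg_int f z y - f z * (y - z)) <= eps * Cmod (y - z).
Proof.
  intros He Hz d Hd Hc. destruct (Ccont_loc f z eps He Hz) as [r [Hr H]].
  exists (Rmin r d). split; [apply Rmin_pos; auto|]. intros y Hy.
  pose proof (Rmin_l r d). pose proof (Rmin_r r d).
  assert (N : forall t, 0 <= t <= 1 -> Cmod (seg z y t - z) < Rmin r d).
  { intros t Ht. eapply Rle_lt_trans; [apply (Cmod_seg_le z y t z (Cmod (y - z))); auto|exact Hy].
    - rewrite Cmod_self. apply Cmod_ge_0.
    - lra. }
  assert (Hf : onseg (fun z => Ccont f z) z y).
  { intros t Ht. apply Hc. specialize (N t Ht). lra. }
  replace (f z * (y - z))%C with (seg_int (fun _ => f z) z y).
  - rewrite <- seg_int_minus; auto.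
    + apply seg_int_bound.
      * intros t Ht. cap Clim_minus; [apply Hf; auto|cap Clim_const].
      * intros t Ht. left. apply H. specialize (N t Ht); lra.
    + intros t Ht. cap Clim_const.
  - unfold seg_int. rewrite (is_Cint_unique _ _ _ _ (is_Cint_const (f z) 0 1)).
    replace (1 - 0) with 1 by ring. ring.
Qed.

(** The real part of [(w - e) / v] is the coordinate of [w] in the direction [v] from [e]; it serves
    to keep triangles away from [e]. *)
Lemma Re_ratio_lip (e v w w' : C) : v <> 0%C ->
  Rabs (Re ((w - e) / v) - Re ((w' - e) / v)) <= Cmod (w - w') / Cmod v.
Proof.
  intros Hv. rewrite <- Cmod_div by auto.
  replace (Re ((w - e) / v) - Re ((w' - e) / v)) with (Re ((w - w') / v)).
  - apply re_le_Cmod.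
  - rewrite <- (Ropp_involutive (Re ((w' - e) / v))), <- re_opp.
    unfold Rminus. rewrite Ropp_involutive. rewrite <- re_plus. f_equal. field; auto.
Qed.

Section Primitive.
Variables (f : C -> C) (c e : C) (R0 : R).
Hypothesis fc : forall z, Disc c R0 z -> Ccont f z.
Hypothesis fd : forall z, Disc c R0 z -> z <> e -> Cdiff f z.
Hypothesis He : Disc c R0 e.

(** Both corners [z] and [z'] are pulled towards [e] by the factor [t]. The quadrilateral between the
    two triangles is the union of two triangles that lie in a half plane missing [e], so the integral
    does not change; and it tends to zero with [t] because [f] is bounded near [e]. *)
Lemma triangle_int_exceptional z z' : Disc c R0 z -> Disc c R0 z' -> z <> e ->
  Cmod (z' - z) < Cmod (z - e) / 2 -> triangle_int f e z z' = 0%C.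
Proof.
  intros Hz Hz' Ne Hn.
  pose proof (Cminus_neq _ _ Ne) as Nv. pose proof (Cmod_minus_pos _ _ Ne) as Pv.
  set (v := (z - e)%C) in *. set (l := fun w => Re ((w - e) / v)).
  pose proof (Disc_convex c R0) as DC.
  assert (sw := seg_int_swap_convex (Disc c R0) f DC fc).
  assert (lz : l z = 1).
  { unfold l. fold v. replace (v / v)%C with (RtoC 1) by (field; auto). reflexivity. }
  assert (lz' : 1 / 2 <= l z').
  { pose proof (Re_ratio_lip e v z' z Nv) as H. fold (l z) (l z') in H.
    assert (Cmod (z' - z) / Cmod v <= 1/2) by (apply Rle_div_l; lra).
    rewrite lz in H. apply Rabs_le_between in H. lra. }
  assert (Main : forall t, 0 < t <= 1 -> triangle_int f e z z' = triangle_int f e (seg e z t) (seg e z' t)).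
  { intros t Ht. set (u := seg e z t). set (u' := seg e z' t).
    assert (Hu : Disc c R0 u) by (apply DC; auto; lra).
    assert (Hu' : Disc c R0 u') by (apply DC; auto; lra).
    set (rho := Rmax (Cmod (z - c)) (Rmax (Cmod (z' - c)) (Cmod (e - c)))).
    assert (Hrho : rho < R0) by (repeat apply Rmax_lub_lt; auto).
    assert (B1 : Cmod (z - c) <= rho) by apply Rmax_l.
    assert (B2 : Cmod (z' - c) <= rho) by (eapply Rle_trans; [apply Rmax_l|apply Rmax_r]).
    assert (B3 : Cmod (e - c) <= rho) by (eapply Rle_trans; [apply Rmax_r|apply Rmax_r]).
    (* a closed convex set that contains the corners but not e, where l = 0 *)
    set (K := fun w => Cmod (w - c) <= rho /\ t / 2 <= l w).
    assert (lseg : forall a b s, l (seg a b s) = (1 - s) * l a + s * l b).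
    { intros a b s. unfold l, seg. rewrite <- !re_scal_l, <- re_plus. f_equal.
      rewrite RtoC_minus. field; auto. }
    assert (le : l e = 0).
    { unfold l. replace ((e - e) / v)%C with (RtoC 0) by (field; auto). reflexivity. }
    assert (KD : forall w, K w -> Disc c R0 w) by (intros w [A B]; unfold Disc; lra).
    assert (Kconv : convex K).
    { intros a b [A1 A2] [B4 B5] s Hs. split; [apply Cmod_seg_le; auto|]. rewrite lseg. nra. }
    assert (Kcl : seq_closed K).
    { intros w H. split.
      - apply le_epsilon. intros eps Heps. destruct (H eps Heps) as [y [[Hy _] Hd]].
        pose proof (Cmod_tri3 w y c). rewrite Cmod_sub_sym in Hd. lra.
      - apply le_epsilon. intros eps Heps.
        destruct (H (eps * Cmod v)) as [y [[_ Hy] Hd]]; [apply Rmult_lt_0_compat; auto|].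
        pose proof (Re_ratio_lip e v y w Nv) as L. fold (l y) (l w) in L.
        assert (Cmod (y - w) / Cmod v <= eps) by (apply Rle_div_l; lra).
        apply Rabs_le_between in L. lra. }
    assert (Kd : forall w, K w -> Cdiff f w).
    { intros w [A B]. apply fd; [unfold Disc; lra|]. intros ->. lra. }
    assert (Kz : K z) by (split; lra).
    assert (Kz' : K z') by (split; lra).
    assert (Ku : K u).
    { split; [apply Cmod_seg_le; auto; lra|]. unfold u. rewrite lseg, le, lz. lra. }
    assert (Ku' : K u').
    { split; [apply Cmod_seg_le; auto; lra|]. unfold u'. rewrite lseg, le. nra. }
    assert (Kcont : forall w, K w -> Ccont f w) by (intros; apply Cdiff_cont; auto).
    pose proof (Goursat_triangle K f Kconv Kcont u z z' Kcl Kd Ku Kz Kz') as G1.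
    pose proof (Goursat_triangle K f Kconv Kcont u z' u' Kcl Kd Ku Kz' Ku') as G2.
    unfold triangle_int in *.
    rewrite (seg_int_split f e z t) by (try lra; apply (continuous_on_segment (Disc c R0)); auto). fold u.
    rewrite (sw e z') by auto.
    rewrite (seg_int_split f e z' t) by (try lra; apply (continuous_on_segment (Disc c R0)); auto). fold u'.
    rewrite (sw u z') in G1 by auto. rewrite (sw u' z') in G2 by auto.
    rewrite (sw e u') by auto. rewrite (sw u u') in G2 by auto.
    replace (seg_int f e u + seg_int f u z + seg_int f z z' + - (seg_int f e u' + seg_int f u' z'))%C with
      (seg_int f e u + - seg_int f e u' + (seg_int f u z + seg_int f z z' + - seg_int f u z') + (seg_int f u z' + - seg_int f u' z' + - seg_int f u u') + seg_int f u u')%C by ring.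
    rewrite G1, G2. ring. }
  destruct (Ccont_loc f e 1 Rlt_0_1 (fc e He)) as [d [Hd Fb]].
  set (M := Cmod (f e) + 1).
  assert (HM : forall y, Cmod (y - e) < d -> Cmod (f y) <= M).
  { intros y Hy. specialize (Fb y Hy). unfold M.
    replace (f y) with ((f y - f e) + f e)%C by ring.
    eapply Rle_trans; [apply Cmod_triangle|]. lra. }
  set (P := Cmod (z - e) + Cmod (z' - z) + Cmod (z' - e)).
  pose proof (Cmod_ge_0 (z' - e)) as Q1. pose proof (Cmod_ge_0 (z' - z)) as Q2.
  assert (HP : 0 < P) by (unfold P; fold v; lra).
  assert (HM0 : 0 < M) by (unfold M; pose proof (Cmod_ge_0 (f e)); lra).
  apply Cmod_eq_0. apply Rle_antisym; [|apply Cmod_ge_0].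
  apply le_epsilon. intros eps Heps. rewrite Rplus_0_l.
  set (t := Rmin 1 (Rmin (d / (2 * P)) (eps / (M * P)))).
  assert (T1 : 0 < t).
  { unfold t. repeat apply Rmin_pos; try lra; apply Rdiv_lt_0_compat; nra. }
  assert (T2 : t <= 1) by apply Rmin_l.
  assert (T3 : t * P < d).
  { assert (t <= d / (2 * P)) by (eapply Rle_trans; [apply Rmin_r|apply Rmin_l]).
    apply Rle_lt_trans with (d / (2 * P) * P); [apply Rmult_le_compat_r; lra|].
    replace (d / (2 * P) * P) with (d/2) by (field; lra). lra. }
  assert (T4 : t * (M * P) <= eps).
  { assert (t <= eps / (M * P)) by (eapply Rle_trans; [apply Rmin_r|apply Rmin_r]).
    apply Rle_div_r in H; nra. }
  rewrite (Main t) by lra. unfold triangle_int.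
  assert (Hu : Disc c R0 (seg e z t)) by (apply DC; auto; lra).
  assert (Hu' : Disc c R0 (seg e z' t)) by (apply DC; auto; lra).
  assert (U1 : Cmod (seg e z t - e) = t * Cmod (z - e)).
  { unfold seg. replace (e + t * (z - e) - e)%C with (t * (z - e))%C by ring.
    rewrite Cmod_mult, Cmod_R, Rabs_pos_eq; lra. }
  assert (U2 : Cmod (seg e z' t - e) = t * Cmod (z' - e)).
  { unfold seg. replace (e + t * (z' - e) - e)%C with (t * (z' - e))%C by ring.
    rewrite Cmod_mult, Cmod_R, Rabs_pos_eq; lra. }
  assert (U3 : Cmod (seg e z' t - seg e z t) = t * Cmod (z' - z)).
  { unfold seg. replace (e + t * (z' - e) - (e + t * (z - e)))%C with (t * (z' - z))%C by ring.
    rewrite Cmod_mult, Cmod_R, Rabs_pos_eq; lra. }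
  fold v in P, U1.
  assert (Bd : forall a b, Disc c R0 a -> Disc c R0 b -> Cmod (a - e) <= t * P -> Cmod (b - e) <= t * P ->
     Cmod (seg_int f a b) <= M * Cmod (b - a)).
  { intros a b Ha Hb Ea Eb. apply seg_int_bound; [apply (continuous_on_segment (Disc c R0)); auto|].
    intros s Hs. apply HM. eapply Rle_lt_trans; [apply Cmod_seg_le; eauto|]. lra. }
  assert (X0 : Cmod (e - e) <= t * P) by (rewrite Cmod_self; nra).
  assert (X1 : Cmod (seg e z t - e) <= t * P) by (rewrite U1; unfold P; fold v; nra).
  assert (X2 : Cmod (seg e z' t - e) <= t * P) by (rewrite U2; unfold P; fold v; nra).
  pose proof (Bd _ _ He Hu X0 X1) as Y1. pose proof (Bd _ _ Hu Hu' X1 X2) as Y2.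
  pose proof (Bd _ _ Hu' He X2 X0) as Y3.
  rewrite U1 in Y1. rewrite U3 in Y2. rewrite (Cmod_sub_sym e), U2 in Y3.
  eapply Rle_trans; [apply Cmod_triangle|].
  eapply Rle_trans; [apply Rplus_le_compat_r, Cmod_triangle|].
  apply Rle_trans with (t * (M * P)); [|exact T4]. unfold P; fold v. lra.
Qed.

(** Integrate from the exceptional point [e] itself: then all triangles that occur have [e] as a
    corner. *)
Lemma primitive_disc z : Disc c R0 z -> Cderiv (fun w => seg_int f e w) z (f z).
Proof.
  intros Hz. apply Cderiv_eps. intros eps Heps.
  destruct (Disc_open c R0 z Hz) as [d [Hd Dd]].
  destruct (seg_int_near f z eps Heps (fc z Hz) d Hd (fun y Hy => fc y (Dd y Hy))) as [r [Hr Hs]].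
  destruct (classic (z = e)) as [->|Ne].
  - exists r; split; auto. intros y Hy.
    replace (seg_int f e y - seg_int f e e - f e * (y - e))%C with (seg_int f e y - f e * (y - e))%C; [auto|].
    replace (seg_int f e e) with (RtoC 0) by (unfold seg_int; ring). ring.
  - pose proof (Cmod_minus_pos _ _ Ne) as Pv.
    exists (Rmin (Rmin r d) (Cmod (z - e) / 2)). split; [repeat apply Rmin_pos; lra|].
    intros y Hy. pose proof (Rmin_l (Rmin r d) (Cmod (z - e) / 2)).
    pose proof (Rmin_r (Rmin r d) (Cmod (z - e) / 2)). pose proof (Rmin_l r d). pose proof (Rmin_r r d).
    assert (Hy' : Disc c R0 y) by (apply Dd; lra).
    pose proof (triangle_int_exceptional z y Hz Hy' Ne ltac:(lra)) as HJ. unfold triangle_int in HJ.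
    rewrite (seg_int_swap_convex (Disc c R0) f (Disc_convex c R0) fc e y) in HJ by auto.
    replace (seg_int f e y - seg_int f e z)%C with (seg_int f z y - (seg_int f e z + seg_int f z y + - seg_int f e y))%C by ring.
    rewrite HJ. replace (seg_int f z y - 0 - f z * (y - z))%C with (seg_int f z y - f z * (y - z))%C by ring.
    apply Hs; lra.
Qed.
End Primitive.

(** * The complex exponential *)

Definition Cexp (z : C) : C := (exp (Re z) * cos (Im z), exp (Re z) * sin (Im z)).

Lemma Cexp_plus x y : Cexp (x + y) = (Cexp x * Cexp y)%C.
Proof.
  unfold Cexp. rewrite re_plus, im_plus, exp_plus, cos_plus, sin_plus.
  apply injective_projections; simpl; ring.
Qed.

Lemma Cexp_0 : Cexp 0 = 1%C.
Proof. unfold Cexp; simpl. rewrite exp_0, cos_0, sin_0. apply injective_projections; simpl; ring. Qed.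

Lemma Cexp_neq_0 z : Cexp z <> 0%C.
Proof.
  intros E. assert (H : (Cexp z * Cexp (- z) = 1)%C).
  { rewrite <- Cexp_plus, <- Cexp_0. f_equal. ring. }
  rewrite E, Cmult_0_l in H. apply RtoC_inj in H. lra.
Qed.

Lemma Cexp_pow z n : Cpow (Cexp z) n = Cexp (RtoC (INR n) * z)%C.
Proof.
  induction n.
  - simpl. rewrite Cmult_0_l, Cexp_0. reflexivity.
  - rewrite S_INR, Cpow_S, IHn, <- Cexp_plus, RtoC_plus. f_equal. ring.
Qed.

Lemma Cexp_i (t : R) : Cexp (Ci * t) = (cos t, sin t).
Proof.
  unfold Cexp. replace (Re (Ci * t)) with 0 by (simpl; ring).
  replace (Im (Ci * t)) with t by (simpl; ring). rewrite exp_0. f_equal; ring.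
Qed.

Lemma Cmod_Cexp_i (t : R) : Cmod (Cexp (Ci * t)) = 1.
Proof.
  rewrite Cexp_i. unfold Cmod; simpl. transitivity (sqrt 1); [f_equal|apply sqrt_1].
  pose proof (sin2_cos2 t). unfold Rsqr in *. lra.
Qed.

Lemma Cexp_2PI : Cexp (Ci * RtoC (2 * PI)) = 1%C.
Proof. rewrite Cexp_i, cos_2PI, sin_2PI. reflexivity. Qed.

Lemma real_deriv_0 (F : R -> R) l : derivable_pt_lim F 0 l -> F 0 = 0 -> l = 0 ->
  forall eps, 0 < eps -> exists d, 0 < d /\ forall x, Rabs x < d -> Rabs (F x) <= eps * Rabs x.
Proof.
  intros D F0 -> eps He. destruct (D eps He) as [d H]. exists d; split; [apply cond_pos|].
  intros x Hx. destruct (Req_dec x 0) as [->|N].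
  - rewrite F0, Rabs_R0. lra.
  - specialize (H x N Hx). rewrite Rplus_0_l, F0, !Rminus_0_r in H.
    rewrite Rabs_div in H by auto. apply Rabs_pos_lt in N as P.
    left. apply Rlt_div_l in H; auto.
Qed.

(** The real and imaginary part of [exp z - 1 - z] are products and sums of first order remainders
    of the real exponential, cosine and sine. *)
Lemma Cderiv_Cexp_0 : Cderiv Cexp 0 1.
Proof.
  apply Cderiv_eps. intros eps He.
  (* the remainders below add up to at most 9 e |z| *)
  set (e := Rmin 1 (eps / 9)). 
  assert (E0 : 0 < e) by (apply Rmin_pos; lra).
  assert (E1 : e <= 1) by apply Rmin_l. assert (E2 : e <= eps/9) by apply Rmin_r.
  destruct (real_deriv_0 (fun x => exp x - 1 - x) (exp 0 - 0 - 1)) with (eps := e) as [d1 [D1 H1]]; auto.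
  { apply derivable_pt_lim_minus; [|apply derivable_pt_lim_id].
    apply derivable_pt_lim_minus; [apply derivable_pt_lim_exp|apply derivable_pt_lim_const]. }
  { rewrite exp_0; ring. } { rewrite exp_0; ring. }
  destruct (real_deriv_0 (fun x => cos x - 1) (- sin 0 - 0)) with (eps := e) as [d2 [D2 H2]]; auto.
  { apply derivable_pt_lim_minus; [apply derivable_pt_lim_cos|apply derivable_pt_lim_const]. }
  { rewrite cos_0; ring. } { rewrite sin_0; ring. }
  destruct (real_deriv_0 (fun x => sin x - x) (cos 0 - 1)) with (eps := e) as [d3 [D3 H3]]; auto.
  { apply derivable_pt_lim_minus; [apply derivable_pt_lim_sin|apply derivable_pt_lim_id]. }
  { rewrite sin_0; ring. } { rewrite cos_0; ring. }
  set (d := Rmin (Rmin e 1) (Rmin d1 (Rmin d2 d3))).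
  assert (Hd : 0 < d) by (repeat apply Rmin_pos; lra).
  exists d. split; auto. intros z Hz.
  rewrite Cexp_0. replace (z - 0)%C with z in * by ring.
  assert (d <= e /\ d <= 1 /\ d <= d1 /\ d <= d2 /\ d <= d3) as [L0 [L1 [L2 [L3 L4]]]].
  { unfold d. repeat split; unfold Rmin; repeat destruct Rle_dec; lra. }
  pose proof (Rmax_Cmod z) as RM.
  set (x := fst z) in *. set (y := snd z) in *.
  pose proof (Rmax_l (Rabs x) (Rabs y)) as Q1. pose proof (Rmax_r (Rabs x) (Rabs y)) as Q2.
  specialize (H1 x ltac:(lra)). specialize (H2 y ltac:(lra)). specialize (H3 y ltac:(lra)).
  replace (Cexp z - 1 - 1 * z)%C with
    (RtoC (exp x * (cos y - 1) + (exp x - 1 - x)) + Ci * RtoC (exp x * (sin y - y) + (exp x - 1) * y))%C.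
  2:{ apply injective_projections; unfold Cexp, Re, Im; simpl; fold x y; ring. }
  eapply Rle_trans; [apply Cmod_triangle|]. rewrite Cmod_mult, Cmod_Ci, !Cmod_R, Rmult_1_l.
  set (m := Cmod z) in *.
  assert (M0 : 0 <= m) by apply Cmod_ge_0.
  pose proof (Rabs_pos x). pose proof (Rabs_pos y).
  assert (X1 : Rabs (exp x - 1) <= 2 * m).
  { replace (exp x - 1) with ((exp x - 1 - x) + x) by ring.
    eapply Rle_trans; [apply Rabs_triang|]. nra. }
  assert (X2 : Rabs (exp x) <= 3).
  { replace (exp x) with ((exp x - 1) + 1) by ring.
    eapply Rle_trans; [apply Rabs_triang|]. rewrite Rabs_R1. lra. }
  assert (Y1 : Rabs (exp x * (cos y - 1) + (exp x - 1 - x)) <= 3 * (e * m) + e * m).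
  { eapply Rle_trans; [apply Rabs_triang|]. rewrite Rabs_mult. apply Rplus_le_compat.
    - apply Rmult_le_compat; try apply Rabs_pos; auto. nra.
    - nra. }
  assert (Y2 : Rabs (exp x * (sin y - y) + (exp x - 1) * y) <= 3 * (e * m) + 2 * m * e).
  { eapply Rle_trans; [apply Rabs_triang|]. rewrite !Rabs_mult. apply Rplus_le_compat.
    - apply Rmult_le_compat; try apply Rabs_pos; auto. nra.
    - apply Rmult_le_compat; try apply Rabs_pos; auto. lra. }
  nra.
Qed.

(** * Integrals over circles *)

Lemma Cderiv_Cexp z : Cderiv Cexp z (Cexp z).
Proof.
  apply (Cderiv_ext (fun y => Cexp z * Cexp (y - z))%C).
  { intros y. rewrite <- Cexp_plus. f_equal. ring. }
  eapply Cderiv_eq.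
  2:{ apply (Cderiv_mult (fun _ => Cexp z) (fun y => Cexp (y - z))); [apply Cderiv_const|].
      apply (Cderiv_comp (fun y => y - z)%C Cexp).
      - apply (Cderiv_minus (fun y => y) (fun _ => z)); [apply Cderiv_id|apply Cderiv_const].
      - replace (z - z)%C with (RtoC 0) by ring. apply Cderiv_Cexp_0. }
  ring.
Qed.

Definition circle_path (c : C) (r t : R) : C := (c + RtoC r * Cexp (Ci * RtoC t))%C.

Lemma circle_path_deriv c r t : RCderiv (circle_path c r) t (Ci * (circle_path c r t - c))%C.
Proof.
  assert (H : RCderiv (fun t => c + RtoC r * Cexp (Ci * RtoC t))%C t
     ((0 + (0 * Cexp (Ci * RtoC t) + RtoC r * (Cexp (Ci * RtoC t) * (0 * RtoC t + Ci * 1)))) * 1)%C).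
  { apply (RCderiv_comp RtoC (fun z => c + RtoC r * Cexp (Ci * z))%C); [apply RCderiv_RtoC|].
    apply (Cderiv_plus (fun _ => c)); [apply Cderiv_const|].
    apply (Cderiv_mult (fun _ => RtoC r) (fun z => Cexp (Ci * z))); [apply Cderiv_const|].
    apply (Cderiv_comp (fun z => Ci * z)%C Cexp); [|apply Cderiv_Cexp].
    apply (Cderiv_mult (fun _ => Ci) (fun z => z)); [apply Cderiv_const|apply Cderiv_id]. }
  unfold circle_path at 2. 
  match type of H with RCderiv _ _ ?a => replace (Ci * _)%C with a by ring end.
  exact H.
Qed.

Lemma circle_path_cont c r t : Rcont (circle_path c r) t.
Proof. eapply RCderiv_cont, circle_path_deriv. Qed.

Lemma circle_path_mod c r t : 0 <= r -> Cmod (circle_path c r t - c) = r.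
Proof.
  intros H. unfold circle_path. replace (c + r * Cexp (Ci * t) - c)%C with (r * Cexp (Ci * t))%C by ring.
  rewrite Cmod_mult, Cmod_Cexp_i, Cmod_R, Rabs_pos_eq; lra.
Qed.

Lemma circle_path_closed c r : circle_path c r (2 * PI) = circle_path c r 0.
Proof. unfold circle_path. rewrite Cexp_2PI, Cmult_0_r, Cexp_0. reflexivity. Qed.

Lemma PI2_pos : 0 <= 2 * PI.
Proof. pose proof PI_RGT_0. lra. Qed.

(** The integrand is, up to the factor [Ci], the derivative of [F] along the closed curve. *)
Lemma circle_closed_integral F f c r :
  (forall t, Cderiv F (circle_path c r t) (f (circle_path c r t))) ->
  (forall t, Ccont f (circle_path c r t)) ->
  is_Cint (fun t => f (circle_path c r t) * (circle_path c r t - c))%C 0 (2 * PI) (RtoC 0).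
Proof.
  intros D H.
  assert (K : is_Cint (fun t => f (circle_path c r t) * (Ci * (circle_path c r t - c)))%C 0 (2 * PI)
     (F (circle_path c r (2 * PI)) - F (circle_path c r 0))%C).
  { apply (is_Cint_FTC (fun t => F (circle_path c r t))); [apply PI2_pos| |].
    - intros t _. apply RCderiv_comp; [apply circle_path_deriv|auto].
    - intros t _. unfold Rcont. cap Clim_mult.
      + apply Rcont_comp; [apply circle_path_cont|auto].
      + cap Clim_mult; [cap Clim_const|]. cap Clim_minus; [apply circle_path_cont|cap Clim_const]. }
  rewrite circle_path_closed in K.
  replace (RtoC 0) with (- Ci * (F (circle_path c r 0) - F (circle_path c r 0)))%C by ring.
  eapply is_Cint_ext; [|apply is_Cint_scal; exact K].
  intros t. cbv beta. toC.
  replace (- Ci * (f (circle_path c r t) * (Ci * (circle_path c r t - c))))%C with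
    ((- (Ci * Ci)) * (f (circle_path c r t) * (circle_path c r t - c)))%C by ring.
  replace (- (Ci * Ci))%C with (RtoC 1) by (apply injective_projections; simpl; ring). ring.
Qed.

Lemma Rcont_bounded phi a b : a <= b -> (forall t, a <= t <= b -> Rcont phi t) ->
  exists M, 0 < M /\ forall t, a <= t <= b -> Cmod (phi t) <= M.
Proof.
  intros Hab H.
  destruct (continuity_ab_maj (fun t => Cmod (phi t)) a b Hab) as [m [Hm _]].
  { intros t Ht. apply continuity_pt_filterlim. 
    intros P [eps HP]. unfold filtermap. generalize (H t Ht eps (cond_pos eps)). apply filter_imp.
    intros s Hs. apply HP. change (Rabs (Cmod (phi s) - Cmod (phi t)) < eps).
    eapply Rle_lt_trans; [|exact Hs].
    apply Rabs_le. pose proof (Cmod_tri3 (phi s) (phi t) 0) as A.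
    pose proof (Cmod_tri3 (phi t) (phi s) 0) as B. rewrite (Cmod_sub_sym (phi t) (phi s)) in B.
    replace (phi s - 0)%C with (phi s) in * by ring. replace (phi t - 0)%C with (phi t) in * by ring.
    lra. }
  exists (Cmod (phi m) + 1). pose proof (Cmod_ge_0 (phi m)). split; [lra|].
  intros t Ht. specialize (Hm t Ht). lra.
Qed.

(** A bound on the second order remainder that is uniform in [t] survives integration. *)
Lemma Cderiv_param (K : C -> R -> C) (K1 : R -> C) s B d :
  0 < d -> 0 <= B ->
  (forall s', Cmod (s' - s) < d -> forall t, 0 <= t <= 2 * PI -> Rcont (K s') t) ->
  (forall t, 0 <= t <= 2 * PI -> Rcont K1 t) ->
  (forall s', Cmod (s' - s) < d -> forall t, 0 <= t <= 2 * PI ->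
     Cmod (K s' t - K s t - (s' - s) * K1 t) <= B * (Cmod (s' - s) * Cmod (s' - s))) ->
  Cderiv (fun s => Cint (K s) 0 (2 * PI)) s (Cint K1 0 (2 * PI)).
Proof.
  intros Hd HB Hc Hc1 E. apply Cderiv_eps. intros eps He.
  pose proof PI_RGT_0 as PP.
  assert (Q : 0 < 2 * PI * B + 1) by nra.
  exists (Rmin d (eps / (2 * PI * B + 1))).
  split; [apply Rmin_pos; auto; apply Rdiv_lt_0_compat; lra|].
  intros y Hy. pose proof (Rmin_l d (eps / (2 * PI * B + 1))). pose proof (Rmin_r d (eps / (2 * PI * B + 1))).
  assert (Hs : Cmod (s - s) < d) by (rewrite Cmod_self; auto).
  assert (I1 := is_Cint_Cint _ _ _ PI2_pos (Hc y ltac:(lra))).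
  assert (I2 := is_Cint_Cint _ _ _ PI2_pos (Hc s Hs)).
  assert (I3 := is_Cint_Cint _ _ _ PI2_pos Hc1).
  assert (I4 := is_Cint_minus _ _ _ _ _ _ (is_Cint_minus _ _ _ _ _ _ I1 I2) (is_Cint_scal (y - s)%C _ _ _ _ I3)).
  rewrite (Cmult_comm (Cint K1 _ _)).
  eapply Rle_trans.
  { eapply is_Cint_bound; [apply PI2_pos|exact I4|]. intros t Ht. apply E; [lra|exact Ht]. }
  rewrite Rminus_0_r. set (h := Cmod (y - s)) in *.
  assert (0 <= h) by apply Cmod_ge_0.
  replace (2 * PI * (B * (h * h))) with ((2 * PI * B * h) * h) by ring.
  apply Rmult_le_compat_r; auto.
  apply Rle_trans with ((2 * PI * B + 1) * (eps / (2 * PI * B + 1))).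
  - apply Rmult_le_compat; nra.
  - right; field; lra.
Qed.

Ltac rpos := repeat (first [assumption | lra | apply Rmult_lt_0_compat]).

Section Kernel.
Variables (phi : R -> C) (c s : C) (r : R).
Hypothesis phic : forall t, Rcont phi t.
Hypothesis Hs : Cmod (s - c) < r.

Lemma circle_path_away s' t : Cmod (s' - s) < (r - Cmod (s - c)) / 2 ->
  (r - Cmod (s - c)) / 2 < Cmod (circle_path c r t - s').
Proof.
  intros H. pose proof (Cmod_ge_0 (s - c)).
  pose proof (circle_path_mod c r t ltac:(lra)) as E.
  pose proof (Cmod_tri3 (circle_path c r t) s' c). pose proof (Cmod_tri3 s' s c). lra.
Qed.

Lemma circle_path_neq s' t : Cmod (s' - s) < (r - Cmod (s - c)) / 2 -> (circle_path c r t - s')%C <> 0%C.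
Proof.
  intros H. apply Cmod_gt_0. pose proof (circle_path_away s' t H). lra.
Qed.

Lemma kernel_cont n s' t : Cmod (s' - s) < (r - Cmod (s - c)) / 2 ->
  Rcont (fun t => phi t / Cpow (circle_path c r t - s') n)%C t.
Proof.
  intros H. unfold Rcont.
  apply (Clim_div _ phi (fun t => Cpow (circle_path c r t - s') n)).
  - apply Cpow_nz, circle_path_neq, H.
  - apply phic.
  - apply (Clim_pow _ (fun t => circle_path c r t - s')%C). cap Clim_minus; [apply circle_path_cont|cap Clim_const].
Qed.

Lemma delta_pos : 0 < (r - Cmod (s - c)) / 2.
Proof. lra. Qed.

Lemma Cauchy_kernel_deriv1 :
  Cderiv (fun s => Cint (fun t => phi t / Cpow (circle_path c r t - s) 1)%C 0 (2 * PI)) s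
    (Cint (fun t => phi t / Cpow (circle_path c r t - s) 2)%C 0 (2 * PI)).
Proof.
  set (d := (r - Cmod (s - c)) / 2). pose proof delta_pos as Hd. fold d in Hd.
  destruct (Rcont_bounded phi 0 (2 * PI) PI2_pos (fun t _ => phic t)) as [M [M0 HM]].
  apply (Cderiv_param (fun s t => phi t / Cpow (circle_path c r t - s) 1)%C _ s (M * / (d * (d * d))) d Hd).
  - left. apply Rmult_lt_0_compat; auto. apply Rinv_0_lt_compat. rpos.
  - intros s' Hs' t _. apply kernel_cont; auto.
  - intros t _. apply kernel_cont; auto. rewrite Cmod_self; auto.
  - intros s' Hs' t Ht. specialize (HM t Ht).
    pose proof (circle_path_neq s' t Hs') as N1. 
    assert (Z : Cmod (s - s) < d) by (rewrite Cmod_self; auto).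
    pose proof (circle_path_neq s t Z) as N2.
    pose proof (circle_path_away s' t Hs') as A1. pose proof (circle_path_away s t Z) as A2. fold d in A1, A2.
    set (z := circle_path c r t) in *.
    replace (phi t / (z - s') ^ 1 - phi t / (z - s) ^ 1 - (s' - s) * (phi t / (z - s) ^ 2))%C with
      (phi t * / ((z - s') * ((z - s) * (z - s))) * ((s' - s) * (s' - s)))%C
      by (simpl; field; auto).
    rewrite !Cmod_mult. apply Rmult_le_compat_r; [apply Rmult_le_pos; apply Cmod_ge_0|].
    rewrite Cmod_inv by (repeat apply Cmult_neq_0; auto). rewrite !Cmod_mult.
    apply Rmult_le_compat; auto; [apply Cmod_ge_0| |].
    { left. apply Rinv_0_lt_compat. rpos. }
    apply Rinv_le_contravar; [rpos|].
    apply Rmult_le_compat; try nra.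
Qed.

Lemma Cauchy_kernel_deriv2 :
  Cdiff (fun s => Cint (fun t => phi t / Cpow (circle_path c r t - s) 2)%C 0 (2 * PI)) s.
Proof.
  set (d := (r - Cmod (s - c)) / 2). pose proof delta_pos as Hd. fold d in Hd.
  destruct (Rcont_bounded phi 0 (2 * PI) PI2_pos (fun t _ => phic t)) as [M [M0 HM]].
  pose proof (Cmod_ge_0 (s - c)) as Pc.
  exists (Cint (fun t => 2 * (phi t / Cpow (circle_path c r t - s) 3))%C 0 (2 * PI)).
  assert (Pd : 0 < d * d * ((d * d) * d)) by (rpos).
  apply (Cderiv_param (fun s t => phi t / Cpow (circle_path c r t - s) 2)%C _ s (M * (10 * r) * / (d * d * ((d * d) * d))) d Hd).
  - apply Rmult_le_pos; [nra|]. left; apply Rinv_0_lt_compat; auto.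
  - intros s' Hs' t _. apply kernel_cont; auto.
  - intros t _. unfold Rcont. cap Clim_mult; [cap Clim_const|]. apply kernel_cont; auto. rewrite Cmod_self; auto.
  - intros s' Hs' t Ht. specialize (HM t Ht).
    pose proof (circle_path_neq s' t Hs') as N1. 
    assert (Z : Cmod (s - s) < d) by (rewrite Cmod_self; auto).
    pose proof (circle_path_neq s t Z) as N2.
    pose proof (circle_path_away s' t Hs') as A1. pose proof (circle_path_away s t Z) as A2. fold d in A1, A2.
    pose proof (circle_path_mod c r t ltac:(lra)) as E.
    set (z := circle_path c r t) in *.
    replace (phi t / (z - s') ^ 2 - phi t / (z - s) ^ 2 - (s' - s) * (2 * (phi t / (z - s) ^ 3)))%C with
      (phi t * (3 * (z - s) - 2 * (s' - s)) * / (((z - s') * (z - s')) * (((z - s) * (z - s)) * (z - s))) * ((s' - s) * (s' - s)))%C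
      by (simpl; field; auto).
    rewrite !Cmod_mult. apply Rmult_le_compat_r; [apply Rmult_le_pos; apply Cmod_ge_0|].
    rewrite Cmod_inv by (repeat apply Cmult_neq_0; auto). rewrite !Cmod_mult.
    apply Rmult_le_compat.
    { apply Rmult_le_pos; apply Cmod_ge_0. }
    { left. apply Rinv_0_lt_compat. rpos. }
    { apply Rmult_le_compat; auto; try apply Cmod_ge_0.
      eapply Rle_trans; [apply Cmod_triangle|]. rewrite Cmod_opp, !Cmod_mult, !Cmod_R, !Rabs_pos_eq by lra.
      pose proof (Cmod_tri3 z c s). rewrite (Cmod_sub_sym c s) in H.
      assert (d <= r) by (unfold d; lra). lra. }
    apply Rinv_le_contravar; auto.
    assert (d * d <= Cmod (z - s') * Cmod (z - s')) by nra.
    assert (d * d <= Cmod (z - s) * Cmod (z - s)) by nra.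
    assert (d * d * d <= Cmod (z - s) * Cmod (z - s) * Cmod (z - s)) by (apply Rmult_le_compat; nra).
    apply Rmult_le_compat; nra.
Qed.
End Kernel.

(** * Cauchy's formula and removable singularities *)

Lemma Disc_center c r : 0 < r -> Disc c r c.
Proof. intros H. red. rewrite Cmod_self. exact H. Qed.

Lemma circle_path_in c r t s : Cmod (s - c) < r -> (circle_path c r t - s)%C <> 0%C.
Proof. intros H. apply (circle_path_neq c s r H s t). rewrite Cmod_self. lra. Qed.

Lemma const_of_deriv_0 F c r : (forall z, Disc c r z -> Cderiv F z 0) ->
  forall z, Disc c r z -> 0 < r -> F z = F c.
Proof.
  intros H z Hz Hr.
  assert (Hc : Disc c r c) by (apply Disc_center; auto).
  assert (E : seg_int (fun _ => 0%C) c z = (F z - F c)%C).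
  { apply seg_int_FTC; intros t Ht; [cap Clim_const|]. apply H. apply (Disc_convex c r); auto. }
  unfold seg_int in E. rewrite (is_Cint_unique _ _ _ _ (is_Cint_const 0 0 1)) in E.
  replace (F z) with ((F z - F c) + F c)%C by ring. rewrite <- E. ring.
Qed.

(** As a function of [s] the integral has derivative zero, since [1 / (u - s)^2] has a primitive on
    the circle; at the centre the integrand is constant. *)
Lemma winding_integral c r s : Cmod (s - c) < r ->
  Cint (fun t => (circle_path c r t - c) / Cpow (circle_path c r t - s) 1)%C 0 (2 * PI) = RtoC (2 * PI).
Proof.
  intros Hs. assert (Hr : 0 < r) by (pose proof (Cmod_ge_0 (s - c)); lra).
  assert (Hphi : forall t, Rcont (fun t => circle_path c r t - c)%C t).
  { intros t. unfold Rcont. cap Clim_minus; [apply circle_path_cont|cap Clim_const]. }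
  transitivity (Cint (fun t => (circle_path c r t - c) / Cpow (circle_path c r t - c) 1)%C 0 (2 * PI)).
  - apply (const_of_deriv_0 (fun s => Cint (fun t => (circle_path c r t - c) / Cpow (circle_path c r t - s) 1)%C 0 (2 * PI)) c r); auto.
    intros z Hz. eapply Cderiv_eq; [|apply (Cauchy_kernel_deriv1 _ c z r Hphi Hz)].
    apply is_Cint_unique.
    eapply is_Cint_ext.
    2:{ apply (circle_closed_integral (fun u => - / (u - z))%C (fun u => / ((u - z) * (u - z)))%C).
      - intros t. pose proof (circle_path_in c r t z Hz) as N. eapply Cderiv_eq.
        2:{ apply Cderiv_opp. apply (Cderiv_comp (fun u => u - z)%C (fun u : C => / u)%C).
            - apply Cderiv_minus; [apply Cderiv_id|apply Cderiv_const].
            - apply Cderiv_inv, N. }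
        field; auto.
      - intros t. pose proof (circle_path_in c r t z Hz) as N.
        cap Clim_inv; [apply Cmult_neq_0; auto|].
        cap Clim_mult; cap Clim_minus; (apply Clim_id || cap Clim_const). }
    intros t. pose proof (circle_path_in c r t z Hz) as N. toC. simpl. field; auto.
  - apply is_Cint_unique. replace (RtoC (2 * PI)) with (RtoC (2 * PI - 0) * 1)%C by (rewrite Rminus_0_r; ring).
    eapply is_Cint_ext; [|apply is_Cint_const]. intros t. cbv beta.
    assert (N : (circle_path c r t - c)%C <> 0%C) by (apply circle_path_in; rewrite Cmod_self; auto).
    toC. simpl. field; auto.
Qed.

(** The slope [(f z - f s) / (z - s)] is continuous at [s] and differentiable elsewhere, so it has a
    primitive and integrates to zero around the circle. *)
Theorem Cauchy_formula f c R0 r s : (forall z, Disc c R0 z -> Cdiff f z) -> r < R0 ->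
  Cmod (s - c) < r ->
  is_Cint (fun t => f (circle_path c r t) * (circle_path c r t - c) / (circle_path c r t - s))%C 0 (2 * PI) (RtoC (2 * PI) * f s)%C.
Proof.
  intros Hf Hr Hs. assert (Hr0 : 0 <= r) by (pose proof (Cmod_ge_0 (s - c)); lra).
  assert (Ds : Disc c R0 s) by (unfold Disc; lra).
  destruct (Hf s Ds) as [d [phi [E [P L]]]].
  assert (pd : forall z, Disc c R0 z -> z <> s -> Cdiff phi z).
  { intros z Hz N. apply (Cdiff_ext_loc (fun y => (f y - f s) / (y - s))%C).
    - apply locally_Cmod. exists (Cmod (z - s)). split; [apply Cmod_minus_pos; auto|].
      intros y Hy. assert (Ny : y <> s).
      { intros ->. rewrite Cmod_sub_sym in Hy. lra. }
      rewrite (E y). field. apply Cminus_neq; auto.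
    - apply Cdiff_div; [apply Cminus_neq; auto| |].
      + apply Cdiff_minus; [auto|apply Cdiff_const].
      + apply Cdiff_minus; [apply Cdiff_id|apply Cdiff_const]. }
  assert (pc : forall z, Disc c R0 z -> Ccont phi z).
  { intros z Hz. destruct (classic (z = s)) as [->|N]; [rewrite P; auto|]. apply Cdiff_cont; auto. }
  pose proof (primitive_disc phi c s R0 pc pd Ds) as D.
  assert (Hc : forall t, Disc c R0 (circle_path c r t)).
  { intros t. red. rewrite circle_path_mod; auto. }
  assert (K := circle_closed_integral _ phi c r (fun t => D _ (Hc t)) (fun t => pc _ (Hc t))).
  assert (W : is_Cint (fun t => (circle_path c r t - c) / Cpow (circle_path c r t - s) 1)%C 0 (2 * PI) (RtoC (2 * PI))).
  { rewrite <- (winding_integral c r s Hs). apply is_Cint_Cint; [apply PI2_pos|]. intros t _.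
    apply (kernel_cont _ c s r); auto.
    - intros u. unfold Rcont. cap Clim_minus; [apply circle_path_cont|cap Clim_const].
    - rewrite Cmod_self. lra. }
  pose proof (is_Cint_plus _ _ _ _ _ _ K (is_Cint_scal (f s) _ _ _ _ W)) as Q.
  replace (RtoC (2 * PI) * f s)%C with (0 + f s * RtoC (2 * PI))%C by ring.
  eapply is_Cint_ext; [|exact Q]. intros t. cbv beta. toC.
  rewrite (E (circle_path c r t)). simpl. field. apply circle_path_in; auto.
Qed.

(** A weak maximum principle, sufficient for Liouville's theorem and for the order of a zero. *)
Lemma Cauchy_bound f c R0 r s M : (forall z, Disc c R0 z -> Cdiff f z) -> r < R0 ->
  Cmod (s - c) < r -> (forall z, Cmod (z - c) = r -> Cmod (f z) <= M) ->
  Cmod (f s) <= M * (r / (r - Cmod (s - c))).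
Proof.
  intros Hf Hr Hs HM. assert (Hr0 : 0 <= r) by (pose proof (Cmod_ge_0 (s - c)); lra).
  pose proof PI_RGT_0 as PP.
  assert (K := Cauchy_formula f c R0 r s Hf Hr Hs).
  apply (is_Cint_bound _ _ _ _ (M * (r / (r - Cmod (s - c)))) PI2_pos) in K.
  - rewrite Cmod_mult, Cmod_R, Rabs_pos_eq in K by lra. rewrite Rminus_0_r in K.
    apply Rmult_le_reg_l in K; lra.
  - intros t _. pose proof (circle_path_in c r t s Hs) as N.
    pose proof (circle_path_mod c r t Hr0) as E. specialize (HM _ E).
    rewrite Cmod_div, Cmod_mult, E by auto. unfold Rdiv. rewrite Rmult_assoc.
    apply Rmult_le_compat; auto; [apply Cmod_ge_0| |].
    + apply Rmult_le_pos; auto. left; apply Rinv_0_lt_compat, Cmod_gt_0, N.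
    + apply Rmult_le_compat_l; auto. apply Rinv_le_contravar; [lra|].
      pose proof (Cmod_tri3 (circle_path c r t) s c). lra.
Qed.

(** Cauchy's formula may be differentiated twice under the integral sign. *)
Lemma derivative_diff F f c R0 : (forall z, Disc c R0 z -> Cderiv F z (f z)) ->
  forall z, Disc c R0 z -> Cdiff f z.
Proof.
  intros D z Hz. unfold Disc in Hz.
  (* the circle around c with this radius encloses z and stays in the disc *)
  set (r := (Cmod (z - c) + R0) / 2).
  assert (H1 : Cmod (z - c) < r) by (unfold r; lra). assert (H2 : r < R0) by (unfold r; lra).
  assert (Hr0 : 0 <= r) by (pose proof (Cmod_ge_0 (z - c)); lra).
  assert (HF : forall z, Disc c R0 z -> Cdiff F z) by (intros u Hu; exists (f u); auto).
  set (phi := fun t => (F (circle_path c r t) * (circle_path c r t - c))%C).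
  assert (phic : forall t, Rcont phi t).
  { intros t. unfold Rcont, phi. cap Clim_mult.
    - apply (Rcont_comp (circle_path c r) F); [apply circle_path_cont|]. apply Cdiff_cont, HF.
      red. rewrite circle_path_mod; auto.
    - cap Clim_minus; [apply circle_path_cont|cap Clim_const]. }
  pose proof PI_RGT_0 as PP.
  assert (N2 : RtoC (2 * PI) <> 0%C) by (intros E; apply RtoC_inj in E; lra).
  assert (E : forall s, Disc c r s -> F s = (/ RtoC (2 * PI) * Cint (fun t => phi t / Cpow (circle_path c r t - s) 1)%C 0 (2 * PI))%C).
  { intros s Hs. rewrite (is_Cint_unique _ _ _ (RtoC (2 * PI) * F s)%C); [field; auto|].
    eapply is_Cint_ext; [|apply (Cauchy_formula F c R0 r s HF H2 Hs)].
    intros t. cbv beta. unfold phi. toC. simpl. field. apply circle_path_in, Hs. }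
  assert (Ef : forall s, Disc c r s -> f s = (/ RtoC (2 * PI) * Cint (fun t => phi t / Cpow (circle_path c r t - s) 2)%C 0 (2 * PI))%C).
  { intros s Hs. apply (Cderiv_unique F s); [apply D; unfold Disc in *; lra|].
    apply (Cderiv_ext_loc (fun s => / RtoC (2 * PI) * Cint (fun t => phi t / Cpow (circle_path c r t - s) 1) 0 (2 * PI))%C).
    - destruct (Disc_open c r s Hs) as [d [Hd Hd']]. apply locally_Cmod. exists d; split; auto.
      intros y Hy. symmetry. apply E; auto.
    - eapply Cderiv_eq.
      2:{ apply (Cderiv_mult (fun _ => / RtoC (2 * PI))%C (fun s => Cint (fun t => phi t / Cpow (circle_path c r t - s) 1)%C 0 (2 * PI)));
          [apply Cderiv_const|]. apply Cauchy_kernel_deriv1; auto. }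
      ring. }
  apply (Cdiff_ext_loc (fun s => / RtoC (2 * PI) * Cint (fun t => phi t / Cpow (circle_path c r t - s) 2) 0 (2 * PI))%C).
  - destruct (Disc_open c r z H1) as [d [Hd Hd']]. apply locally_Cmod. exists d; split; auto.
    intros y Hy. symmetry. apply Ef; auto.
  - apply Cdiff_mult; [apply Cdiff_const|]. apply Cauchy_kernel_deriv2; auto.
Qed.

(** The function is the derivative of its primitive. *)
Lemma removable_singularity f e R0 : 0 < R0 -> Ccont f e ->
  (forall z, Disc e R0 z -> z <> e -> Cdiff f z) -> Cdiff f e.
Proof.
  intros HR Hc Hd. assert (De : Disc e R0 e) by (apply Disc_center; auto).
  apply (derivative_diff (fun w => seg_int f e w) f e R0); auto.
  apply primitive_disc; auto. intros z Hz. destruct (classic (z = e)) as [->|N]; auto.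
  apply Cdiff_cont; auto.
Qed.

(** The slope at a zero is continuous there, so the singularity of the quotient is removable. *)
Lemma divide_zero f a R0 : 0 < R0 -> (forall z, Disc a R0 z -> Cdiff f z) -> f a = 0%C ->
  exists g, (forall z, f z = (z - a) * g z)%C /\ (forall z, Cdiff f z -> Cdiff g z).
Proof.
  intros HR Hf Fa. assert (Da : Disc a R0 a) by (apply Disc_center; auto).
  destruct (Hf a Da) as [d [g [E [P L]]]].
  assert (E' : (forall z, f z = (z - a) * g z)%C).
  { intros z. rewrite (E z), Fa. ring. }
  exists g; split; auto.
  assert (Gn : forall z, z <> a -> Cdiff f z -> Cdiff g z).
  { intros z N Hz. apply (Cdiff_ext_loc (fun y => f y / (y - a))%C).
    - apply locally_Cmod. exists (Cmod (z - a)). split; [apply Cmod_minus_pos; auto|].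
      intros y Hy. assert (Ny : y <> a).
      { intros ->. rewrite Cmod_sub_sym in Hy. lra. }
      rewrite (E' y). field. apply Cminus_neq; auto.
    - apply Cdiff_div; [apply Cminus_neq; auto|auto|].
      apply Cdiff_minus; [apply Cdiff_id|apply Cdiff_const]. }
  intros z Hz. destruct (classic (z = a)) as [->|N]; auto.
  apply (removable_singularity g a R0); auto. rewrite P; exact L.
Qed.

Definition Entire (f : C -> C) := forall z, Cdiff f z.

Lemma divide_entire f a : Entire f -> f a = 0%C ->
  exists g, Entire g /\ (forall z, f z = (z - a) * g z)%C.
Proof.
  intros Hf Fa. destruct (divide_zero f a 1 Rlt_0_1 (fun z _ => Hf z) Fa) as [g [E G]].
  exists g; split; auto. intros z; auto.
Qed.

(** * Entire functions of polynomial growth *)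

Lemma Entire_const c : Entire (fun _ => c).
Proof. intros z; apply Cdiff_const. Qed.
Lemma Entire_id : Entire (fun z => z).
Proof. intros z; apply Cdiff_id. Qed.
Lemma Entire_plus f g : Entire f -> Entire g -> Entire (fun z => f z + g z)%C.
Proof. intros F G z; apply Cdiff_plus; auto. Qed.
Lemma Entire_minus f g : Entire f -> Entire g -> Entire (fun z => f z - g z)%C.
Proof. intros F G z; apply Cdiff_minus; auto. Qed.
Lemma Entire_mult f g : Entire f -> Entire g -> Entire (fun z => f z * g z)%C.
Proof. intros F G z; apply Cdiff_mult; auto. Qed.
Lemma Entire_ext f g : (forall z, f z = g z) -> Entire f -> Entire g.
Proof. intros E F z; apply (Cdiff_ext f); auto. Qed.
Lemma Entire_comp f g : Entire f -> Entire g -> Entire (fun z => g (f z)).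
Proof. intros F G z; apply (Cdiff_comp f g); auto. Qed.
Lemma Entire_pow f n : Entire f -> Entire (fun z => Cpow (f z) n).
Proof. intros F z; apply (Cdiff_pow f); auto. Qed.

(** Only the behaviour at infinity is bounded: this is what properness provides and what Liouville's
    theorem uses. *)
Definition poly_growth (n : nat) (f : C -> C) : Prop :=
  exists K R, 0 < R /\ 0 <= K /\ forall z, R <= Cmod z -> Cmod (f z) <= K * Cmod z ^ n.

Definition at_infinity (P : C -> Prop) : Prop := exists R, forall z, R <= Cmod z -> P z.

Lemma at_infinity_and P Q : at_infinity P -> at_infinity Q -> at_infinity (fun z => P z /\ Q z).
Proof.
  intros [R1 H1] [R2 H2]. exists (Rmax R1 R2). intros z Hz.
  pose proof (Rmax_l R1 R2). pose proof (Rmax_r R1 R2). split; [apply H1|apply H2]; lra.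
Qed.

Lemma at_infinity_imp (P Q : C -> Prop) : (forall z, P z -> Q z) -> at_infinity P -> at_infinity Q.
Proof. intros H [R K]. exists R; auto. Qed.

Lemma at_infinity_ge M : at_infinity (fun z => M <= Cmod z).
Proof. exists M; auto. Qed.

Lemma at_infinity_ex P : at_infinity P -> exists z, P z.
Proof.
  intros [R H]. exists (RtoC (Rabs R)). apply H. rewrite Cmod_R, Rabs_Rabsolu. apply Rle_abs.
Qed.

#[global] Instance at_infinity_filter : ProperFilter at_infinity.
Proof.
  constructor; [apply at_infinity_ex|]. constructor.
  - exists 0; auto.
  - intros; apply at_infinity_and; auto.
  - intros; eapply at_infinity_imp; eauto.
Qed.

Lemma poly_growth_intro n f K : 0 <= K -> at_infinity (fun z => Cmod (f z) <= K * Cmod z ^ n) -> poly_growth n f.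
Proof.
  intros HK [R H]. exists K, (Rmax R 1). pose proof (Rmax_l R 1). pose proof (Rmax_r R 1).
  repeat split; auto; [lra|]. intros z Hz. apply H. lra.
Qed.

Lemma poly_growth_plus n f g : poly_growth n f -> poly_growth n g -> poly_growth n (fun z => f z + g z)%C.
Proof.
  intros [K1 [R1 [P1 [Q1 H1]]]] [K2 [R2 [P2 [Q2 H2]]]].
  apply (poly_growth_intro _ _ (K1 + K2)); [lra|].
  generalize (at_infinity_and _ _ (at_infinity_ge R1) (at_infinity_ge R2)).
  apply at_infinity_imp. intros z [A B]. specialize (H1 z A). specialize (H2 z B).
  eapply Rle_trans; [apply Cmod_triangle|]. lra.
Qed.

Lemma poly_growth_mult n m f g : poly_growth n f -> poly_growth m g -> poly_growth (n + m) (fun z => f z * g z)%C.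
Proof.
  intros [K1 [R1 [P1 [Q1 H1]]]] [K2 [R2 [P2 [Q2 H2]]]].
  apply (poly_growth_intro _ _ (K1 * K2)); [nra|].
  generalize (at_infinity_and _ _ (at_infinity_ge R1) (at_infinity_ge R2)).
  apply at_infinity_imp. intros z [A B]. specialize (H1 z A). specialize (H2 z B).
  rewrite Cmod_mult, pow_add.
  replace (K1 * K2 * (Cmod z ^ n * Cmod z ^ m)) with ((K1 * Cmod z ^ n) * (K2 * Cmod z ^ m)) by ring.
  apply Rmult_le_compat; auto; apply Cmod_ge_0.
Qed.

Lemma poly_growth_le n m f : (n <= m)%nat -> poly_growth n f -> poly_growth m f.
Proof.
  intros Hnm [K [R [P [Q H]]]]. apply (poly_growth_intro _ _ K); auto.
  generalize (at_infinity_and _ _ (at_infinity_ge R) (at_infinity_ge 1)).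
  apply at_infinity_imp. intros z [A B]. eapply Rle_trans; [apply H; auto|].
  apply Rmult_le_compat_l; auto. apply Rle_pow; auto.
Qed.

Lemma poly_growth_const c : poly_growth 0 (fun _ => c).
Proof.
  apply (poly_growth_intro _ _ (Cmod c)); [apply Cmod_ge_0|]. exists 0. intros. simpl. lra.
Qed.

Lemma poly_growth_ext n f g : (forall z, f z = g z) -> poly_growth n f -> poly_growth n g.
Proof. intros E [K [R [P [Q H]]]]. exists K, R. repeat split; auto. intros; rewrite <- E; auto. Qed.

(** Apply the bound on large circles to the quotient [(f z - f 0) / z]. *)
Lemma Liouville f : Entire f -> poly_growth 0 f -> forall s, f s = f 0%C.
Proof.
  intros Hf [K [R [HR [HK H]]]] s.
  destruct (divide_entire (fun z => f z - f 0%C)%C 0%C) as [g [Hg E]].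
  { apply Entire_minus; auto. apply Entire_const. } { ring. }
  assert (G : Cmod (g s) = 0).
  { apply Rle_antisym; [|apply Cmod_ge_0]. apply le_epsilon. intros eps He. rewrite Rplus_0_l.
    set (B := K + Cmod (f 0%C)).
    assert (HB : 0 <= B) by (unfold B; pose proof (Cmod_ge_0 (f 0%C)); lra).
    pose proof (Cmod_ge_0 s) as Ps.
    assert (HBe : 0 <= B / eps) by (apply Rle_div_r; lra).
    set (r := R + Cmod s + B / eps).
    eapply Rle_trans.
    - apply (Cauchy_bound g 0 (r + 1) r s (B / r)); [intros; apply Hg|lra| |].
      + replace (s - 0)%C with s by ring. unfold r; lra.
      + intros z Hz. specialize (E z). replace (z - 0)%C with z in * by ring.
        assert (Hz' : z <> 0%C) by (apply Cmod_gt_0; unfold r in Hz; lra).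
        replace (g z) with ((f z - f 0%C) / z)%C by (rewrite E; field; auto).
        rewrite Cmod_div, Hz by auto. unfold Rdiv. apply Rmult_le_compat_r.
        { left. apply Rinv_0_lt_compat. unfold r; lra. }
        eapply Rle_trans; [apply Cmod_triangle|]. rewrite Cmod_opp.
        assert (Hb : Cmod (f z) <= K * Cmod z ^ 0) by (apply H; unfold r in Hz; lra).
        simpl in Hb. unfold B. lra.
    - replace (s - 0)%C with s by ring.
      replace (B / r * (r / (r - Cmod s))) with (B / (r - Cmod s)) by (field; unfold r; lra).
      apply Rle_div_l; [unfold r; lra|]. 
      apply Rle_trans with (eps * (B / eps)); [right; field; lra|].
      apply Rmult_le_compat_l; [lra|unfold r; lra]. }
  apply Cmod_eq_0 in G. specialize (E s). rewrite G in E.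
  replace (f s) with ((f s - f 0%C) + f 0%C)%C by ring. rewrite E. ring.
Qed.

Lemma pow_half_bound a z : 2 * Cmod a <= Cmod z -> Cmod z / 2 <= Cmod (z - a).
Proof.
  intros H. pose proof (Cmod_tri3 z a 0). 
  replace (z - 0)%C with z in * by ring. replace (a - 0)%C with a in * by ring. lra.
Qed.

Lemma poly_growth_div n f g a : (forall z, f z = (z - a) * g z)%C -> poly_growth (S n) f -> poly_growth n g.
Proof.
  intros E [K [R [HR [HK H]]]]. apply (poly_growth_intro _ _ (2 * K)); [lra|].
  generalize (at_infinity_and _ _ (at_infinity_ge R) (at_infinity_ge (2 * Cmod a))).
  apply at_infinity_imp. intros z [A B].
  specialize (H z A). apply pow_half_bound in B. rewrite E, Cmod_mult in H. simpl in H.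
  pose proof (Cmod_ge_0 (g z)).
  apply Rmult_le_reg_l with (Cmod z / 2); [lra|].
  apply Rle_trans with (Cmod (z - a) * Cmod (g z)); [apply Rmult_le_compat_r; auto|]. lra.
Qed.

(** Dividing by a linear factor lowers the exponent of growth. *)
Lemma many_zeros n : forall f l, Entire f -> poly_growth n f -> NoDup l -> length l = S n ->
  (forall a, In a l -> f a = 0%C) -> forall z, f z = 0%C.
Proof.
  induction n; intros f l Hf Hg Nd Hl Hz z.
  - destruct l as [|a l]; [discriminate|].
    rewrite (Liouville f Hf Hg z), <- (Liouville f Hf Hg a). apply Hz; left; auto.
  - destruct l as [|a l]; [discriminate|]. inversion Nd; subst.
    destruct (divide_entire f a Hf (Hz a (or_introl eq_refl))) as [g [Gg E]].
    rewrite E, (IHn g l); auto; [ring|eapply poly_growth_div; eauto|].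
    intros b Hb. specialize (Hz b (or_intror Hb)). rewrite E in Hz.
    assert (N : (b - a)%C <> 0%C) by (apply Cminus_neq; intros ->; contradiction).
    replace (g b) with (((b - a) * g b) / (b - a))%C by (field; auto).
    rewrite Hz. field; auto.
Qed.

(** [f] behaves like [k z^m] at infinity. For entire functions of polynomial growth this plays the role
    of being a polynomial of degree [m]. *)
Definition leading_term (f : C -> C) (m : nat) (k : C) : Prop :=
  k <> 0%C /\ forall eps, 0 < eps -> at_infinity (fun z => Cmod (f z - k * Cpow z m) <= eps * Cmod z ^ m).

Lemma leading_term_exists n : forall f, Entire f -> poly_growth n f ->
  (forall z, f z = 0%C) \/ exists m k, leading_term f m k.
Proof.
  induction n; intros f Hf Hg.
  - destruct (classic (f 0%C = 0%C)) as [E|N].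
    + left. intros z. rewrite Liouville; auto.
    + right. exists O, (f 0%C). split; auto. intros eps He. exists 0. intros z _.
      simpl. rewrite (Liouville f Hf Hg z). replace (f 0%C - f 0%C * 1)%C with (RtoC 0) by ring. rewrite Cmod_0. lra.
  - destruct (divide_entire (fun z => f z - f 0%C)%C 0%C) as [g [Gg E]].
    { apply Entire_minus; auto. apply Entire_const. } { ring. }
    assert (Gr : poly_growth n g).
    { eapply (poly_growth_div n (fun z => f z - f 0%C)%C g 0%C E). apply poly_growth_plus; auto.
      apply (poly_growth_le 0); [lia|]. apply poly_growth_const. }
    destruct (IHn g Gg Gr) as [Z|[m [k [Nk L]]]].
    + assert (Ef : forall z, f z = f 0%C).
      { intros z. specialize (E z). cbv beta in E. rewrite Z in E.
        replace (f z) with ((f z - f 0%C) + f 0%C)%C by ring. rewrite E; ring. }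
      destruct (classic (f 0%C = 0%C)) as [E0|N]; [left; intros z; congruence|].
      right. exists O, (f 0%C). split; auto. intros eps He. exists 0. intros z _.
      simpl. rewrite (Ef z). replace (f 0%C - f 0%C * 1)%C with (RtoC 0) by ring. rewrite Cmod_0. lra.
    + right. exists (S m), k. split; auto. intros eps He.
      generalize (at_infinity_and _ _ (L (eps/2) ltac:(lra))
        (at_infinity_and _ _ (at_infinity_ge 1) (at_infinity_ge (2 * Cmod (f 0%C) / eps)))).
      apply at_infinity_imp. intros z [A [B D]].
      replace (f z - k * z ^ S m)%C with (f 0%C + z * (g z - k * z ^ m))%C.
      2:{ specialize (E z). cbv beta in E. rewrite Cpow_S.
          replace (f z) with ((f z - f 0%C) + f 0%C)%C by ring. rewrite E. ring. }
      eapply Rle_trans; [apply Cmod_triangle|]. rewrite Cmod_mult. simpl.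
      assert (P1 : 1 <= Cmod z ^ m) by (apply pow_R1_Rle; auto).
      assert (Cmod (f 0%C) <= eps / 2 * Cmod z).
      { apply Rle_div_l in D; lra. }
      assert (Cmod z * Cmod (g z - k * z ^ m) <= Cmod z * (eps / 2 * Cmod z ^ m)) by (apply Rmult_le_compat_l; lra).
      assert (eps / 2 * Cmod z <= eps / 2 * (Cmod z * Cmod z ^ m)); [|nra].
      apply Rmult_le_compat_l; [lra|]. rewrite <- (Rmult_1_r (Cmod z)) at 1. apply Rmult_le_compat_l; lra.
Qed.

Lemma leading_term_lower f m k : leading_term f m k -> at_infinity (fun z => Cmod k / 2 * Cmod z ^ m <= Cmod (f z)).
Proof.
  intros [Nk L]. pose proof (proj1 (Cmod_gt_0 k) Nk) as Pk.
  generalize (L (Cmod k / 2) ltac:(lra)). apply at_infinity_imp. intros z Hz.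
  pose proof (Cmod_tri3 (k * z ^ m) (f z) 0) as T.
  rewrite (Cmod_sub_sym (k * z ^ m)%C (f z)) in T.
  replace (k * z ^ m - 0)%C with (k * z ^ m)%C in T by ring. replace (f z - 0)%C with (f z) in T by ring.
  rewrite Cmod_mult, Cmod_pow in T. lra.
Qed.

Lemma leading_term_nonzero f m k : leading_term f m k -> at_infinity (fun z => f z <> 0%C).
Proof.
  intros H. generalize (at_infinity_and _ _ (leading_term_lower f m k H) (at_infinity_ge 1)).
  apply at_infinity_imp. intros z [A B]. apply Cmod_gt_0.
  destruct H as [Nk _]. apply Cmod_gt_0 in Nk.
  assert (0 < Cmod z ^ m) by (apply pow_lt; lra). nra.
Qed.

(** Otherwise [1/f] is entire and tends to zero, against Liouville's theorem. *)
Lemma leading_term_root f m k : Entire f -> leading_term f (S m) k -> exists z, f z = 0%C.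
Proof.
  intros Hf L. apply NNPP. intros N.
  assert (Nz : forall z, f z <> 0%C) by (intros z E; apply N; exists z; auto).
  assert (Hi : Entire (fun z => / f z)%C) by (intros z; apply Cdiff_inv; auto).
  assert (Small : forall eps, 0 < eps -> at_infinity (fun z => Cmod (/ f z) <= eps)).
  { intros eps He. destruct L as [Nk L]. pose proof (proj1 (Cmod_gt_0 k) Nk) as Pk.
    generalize (at_infinity_and _ _ (leading_term_lower f _ k (conj Nk L))
       (at_infinity_and _ _ (at_infinity_ge 1) (at_infinity_ge (2 / (Cmod k * eps))))).
    apply at_infinity_imp. intros z [A [B D]].
    rewrite Cmod_inv by auto. apply Rle_trans with (/ (/ eps)); [|rewrite Rinv_inv; lra].
    apply Rinv_le_contravar; [apply Rinv_0_lt_compat; auto|].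
    eapply Rle_trans; [|exact A]. simpl.
    assert (1 <= Cmod z ^ m) by (apply pow_R1_Rle; auto).
    apply Rle_trans with (Cmod k / 2 * (2 / (Cmod k * eps))); [right; field; lra|].
    apply Rmult_le_compat_l; [lra|]. nra. }
  assert (G : poly_growth 0 (fun z => / f z)%C).
  { apply (poly_growth_intro _ _ 1); [lra|]. generalize (Small 1 Rlt_0_1).
    apply at_infinity_imp. intros z Hz. simpl. lra. }
  assert (P : 0 < Cmod (/ f 0%C)).
  { rewrite Cmod_inv by auto. apply Rinv_0_lt_compat, Cmod_gt_0; auto. }
  destruct (at_infinity_ex _ (Small (Cmod (/ f 0%C) / 2) ltac:(lra))) as [z Hz].
  rewrite (Liouville _ Hi G z) in Hz. lra.
Qed.

Lemma leading_term_div f g a m k : (forall z, f z = (z - a) * g z)%C -> leading_term f (S m) k -> leading_term g m k.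
Proof.
  intros E [Nk L]. split; auto. intros eps He.
  pose proof (Cmod_ge_0 k) as Pk. pose proof (Cmod_ge_0 a) as Pa.
  generalize (at_infinity_and _ _ (L (eps/4) ltac:(lra))
    (at_infinity_and _ _ (at_infinity_ge (2 * Cmod a))
    (at_infinity_and _ _ (at_infinity_ge 1) (at_infinity_ge (4 * Cmod k * Cmod a / eps))))).
  apply at_infinity_imp. intros z [A [B [B1 D]]]. apply pow_half_bound in B.
  set (Z := Cmod z) in *. set (q := Z ^ m).
  assert (Q : 1 <= q) by (apply pow_R1_Rle; auto).
  assert (N : (z - a)%C <> 0%C) by (apply Cmod_gt_0; lra).
  replace (g z - k * z ^ m)%C with (((f z - k * z ^ S m) + k * a * z ^ m) / (z - a))%C
    by (rewrite E, Cpow_S; field; auto).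
  rewrite Cmod_div by auto. apply Rle_div_l; [lra|].
  eapply Rle_trans; [apply Cmod_triangle|]. rewrite !Cmod_mult, Cmod_pow. fold Z. fold q.
  rewrite <- tech_pow_Rmult in A. fold q in A.
  assert (H2 : Cmod k * Cmod a * q <= eps / 4 * Z * q).
  { apply Rmult_le_compat_r; [lra|]. apply Rle_div_l in D; lra. }
  apply Rle_trans with (eps * q * (Z / 2)); [|apply Rmult_le_compat_l; [nra|auto]].
  lra.
Qed.

Lemma leading_term_poly_growth0 f k : leading_term f 0 k -> poly_growth 0 f.
Proof.
  intros [Nk L]. apply (poly_growth_intro _ _ (Cmod k + 1)); [pose proof (Cmod_ge_0 k); lra|].
  generalize (L 1 Rlt_0_1). apply at_infinity_imp. intros z Hz. simpl in *.
  replace (f z) with ((f z - k * 1) + k)%C by ring.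
  eapply Rle_trans; [apply Cmod_triangle|]. lra.
Qed.

Lemma leading_term0_const f k : Entire f -> leading_term f 0 k -> forall z, f z = k.
Proof.
  intros Hf L. pose proof (Liouville f Hf (leading_term_poly_growth0 f k L)) as E.
  intros z. rewrite E. apply NNPP; intros N. apply Cmod_minus_pos in N.
  destruct L as [Nk L]. destruct (at_infinity_ex _ (L (Cmod (f 0%C - k) / 2) ltac:(lra))) as [y Hy].
  rewrite E in Hy. simpl in Hy. replace (f 0%C - k * 1)%C with (f 0%C - k)%C in Hy by ring. lra.
Qed.

(** Split off roots until the degree is zero. *)
Lemma single_root m : forall f a k, Entire f -> leading_term f m k -> (forall z, f z = 0%C -> z = a) ->
  forall z, f z = (k * Cpow (z - a) m)%C.
Proof.
  induction m; intros f a k Hf L R z.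
  - simpl. rewrite (leading_term0_const f k Hf L). ring.
  - destruct (leading_term_root f m k Hf L) as [b Hb]. pose proof (R b Hb); subst b.
    destruct (divide_entire f a Hf Hb) as [g [Gg E]].
    rewrite E, (IHm g a k Gg (leading_term_div _ _ _ _ _ E L)).
    + rewrite Cpow_S. ring.
    + intros y Hy. apply R. rewrite E, Hy. ring.
Qed.

(** A third linear factor would produce a third root: simplicity makes each quotient nonzero at the
    roots already split off. *)
Lemma two_simple_roots f m k : Entire f -> leading_term f m k ->
  (forall z, f z = 0%C -> ~ Cderiv f z 0) ->
  (forall x y z, f x = 0%C -> f y = 0%C -> f z = 0%C -> x = y \/ y = z \/ x = z) ->
  (m <= 2)%nat.
Proof.
  intros Hf L S T. destruct m as [|[|[|m]]]; try lia. exfalso.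
  assert (Dz : forall f g a, Entire g -> (forall z, f z = (z - a) * g z)%C -> Cderiv f a (g a)).
  { intros f' g a Hg E. destruct (Hg a) as [d D].
    apply (Cderiv_ext (fun z => (z - a) * g z)%C); [intros; symmetry; auto|].
    eapply Cderiv_eq.
    2:{ apply (Cderiv_mult (fun z => z - a)%C g); [|exact D].
        apply (Cderiv_minus (fun z => z) (fun _ => a)); [apply Cderiv_id|apply Cderiv_const]. }
    ring. }
  destruct (leading_term_root _ _ _ Hf L) as [x1 H1].
  destruct (divide_entire _ _ Hf H1) as [f1 [F1 E1]]. pose proof (leading_term_div _ _ _ _ _ E1 L) as L1.
  assert (N1 : f1 x1 <> 0%C).
  { intros E. apply (S x1 H1). rewrite <- E. apply Dz; auto. }
  destruct (leading_term_root _ _ _ F1 L1) as [x2 H2].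
  destruct (divide_entire _ _ F1 H2) as [f2 [F2 E2]]. pose proof (leading_term_div _ _ _ _ _ E2 L1) as L2.
  assert (N12 : x1 <> x2) by congruence.
  assert (H2' : f x2 = 0%C) by (rewrite E1, H2; ring).
  assert (N2 : f2 x2 <> 0%C).
  { intros E. apply (S x2 H2'). apply (Cderiv_ext (fun z => (z - x2) * ((z - x1) * f2 z))%C).
    { intros z. rewrite E1, E2. ring. }
    eapply Cderiv_eq; [|apply Dz with (g := fun z => ((z - x1) * f2 z)%C); [|reflexivity]].
    - cbv beta. rewrite E. ring.
    - apply Entire_mult; auto. apply Entire_minus; [apply Entire_id|apply Entire_const]. }
  destruct (leading_term_root _ _ _ F2 L2) as [x3 H3].
  assert (H3' : f x3 = 0%C) by (rewrite E1, E2, H3; ring).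
  destruct (T x1 x2 x3 H1 H2' H3') as [E|[E|E]]; [auto|congruence|].
  subst x3. apply N1. rewrite E2, H3. ring.
Qed.

(** * Proper entire functions and square roots *)

(** If [u] could be divided by every power of [z], the weak maximum principle would bound [u s1] by
    [K (|s1| / r)^N] for every [N]. *)
Lemma finite_order (u : C -> C) (rho : R) (s1 : C) : (forall z, Disc 0 rho z -> Cdiff u z) ->
  (forall z, Disc 0 rho z -> Cmod (u z) <= 1) -> Disc 0 rho s1 -> s1 <> 0%C -> u s1 <> 0%C ->
  exists N v, (forall z, u z = Cpow z N * v z)%C /\ (forall z, Disc 0 rho z -> Cdiff v z) /\ v 0%C <> 0%C.
Proof.
  intros Hu Hb D1 Ns N1. apply NNPP. intros No.
  assert (Hrho : 0 < rho) by (unfold Disc in D1; pose proof (Cmod_ge_0 (s1 - 0)); lra).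
  assert (V : forall N, exists v, (forall z, u z = Cpow z N * v z)%C /\ (forall z, Disc 0 rho z -> Cdiff v z)).
  { induction N.
    - exists u. split; auto. intros; simpl; ring.
    - destruct IHN as [v [E D]].
      assert (V0 : v 0%C = 0%C).
      { apply NNPP. intros NV. apply No. exists N, v. auto. }
      destruct (divide_zero v 0%C rho Hrho D V0) as [g [Eg G]].
      exists g. split; auto. intros z. rewrite E, Eg, Cpow_S. ring. }
  set (a := Cmod s1). assert (Ha : 0 < a) by (apply Cmod_gt_0; auto).
  assert (Ds : a < rho).
  { unfold Disc in D1. replace (s1 - 0)%C with s1 in D1 by ring. exact D1. }
  (* |s1| < r < rho *)
  set (r := (a + rho) / 2). assert (R1 : a < r) by (unfold r; lra). assert (R2 : r < rho) by (unfold r; lra).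
  set (K := r / (r - a)). assert (HK : 0 < K) by (apply Rdiv_lt_0_compat; lra).
  assert (B : forall N, Cmod (u s1) <= K * (a / r) ^ N).
  { intros N. destruct (V N) as [v [E D]].
    assert (Bv : Cmod (v s1) <= / r ^ N * (r / (r - Cmod (s1 - 0)))).
    { apply (Cauchy_bound v 0 rho r s1); auto.
      - replace (s1 - 0)%C with s1 by ring. exact R1.
      - intros z Hz. assert (Dz : Disc 0 rho z) by (unfold Disc; lra).
        specialize (Hb z Dz). rewrite E, Cmod_mult, Cmod_pow in Hb.
        replace (z - 0)%C with z in Hz by ring. rewrite Hz in Hb.
        assert (P : 0 < r ^ N) by (apply pow_lt; lra).
        apply Rmult_le_reg_l with (r ^ N); auto. rewrite Rinv_r by lra. exact Hb. }
    replace (s1 - 0)%C with s1 in Bv by ring. fold a in Bv. fold K in Bv.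
    rewrite E, Cmod_mult, Cmod_pow. fold a. unfold Rdiv. rewrite Rpow_mult_distr, pow_inv.
    apply Rle_trans with (a ^ N * (/ r ^ N * K)); [|right; ring].
    apply Rmult_le_compat_l; auto. apply pow_le; lra. }
  assert (P1 : 0 < Cmod (u s1)) by (apply Cmod_gt_0; auto).
  assert (Q : Rabs (a / r) < 1).
  { rewrite Rabs_pos_eq; [apply Rlt_div_l; lra|]. left; apply Rdiv_lt_0_compat; lra. }
  destruct (pow_lt_1_zero _ Q (Cmod (u s1) / K)) as [N HN]; [apply Rdiv_lt_0_compat; auto|].
  specialize (HN N (Nat.le_refl _)). specialize (B N).
  pose proof (Rle_abs ((a / r) ^ N)). 
  assert (K * (a / r) ^ N < Cmod (u s1)); [|lra].
  apply Rle_lt_trans with (K * Rabs ((a / r) ^ N)); [apply Rmult_le_compat_l; lra|].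
  apply Rlt_le_trans with (K * (Cmod (u s1) / K)); [apply Rmult_lt_compat_l; auto|right; field; lra].
Qed.

Lemma at_infinity_inv P : at_infinity P -> exists d, 0 < d /\ forall s : C, s <> 0%C -> Cmod s < d -> P (/ s)%C.
Proof.
  intros [R H]. exists (/ (Rmax R 1)). pose proof (Rmax_l R 1). pose proof (Rmax_r R 1).
  split; [apply Rinv_0_lt_compat; lra|]. intros s Ns Hs. apply H.
  rewrite Cmod_inv by auto. apply Cmod_gt_0 in Ns.
  apply Rle_trans with (Rmax R 1); auto. rewrite <- (Rinv_inv (Rmax R 1)).
  left. apply Rinv_lt_contravar; auto. apply Rmult_lt_0_compat; auto. apply Rinv_0_lt_compat; lra.
Qed.

(** The function [1 / e(1/s)] has a removable singularity at zero and vanishes there to finite order. *)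
Lemma proper_poly_growth e : Entire e -> (forall M, at_infinity (fun z => M <= Cmod (e z))) ->
  exists n, poly_growth n e.
Proof.
  intros He Hp.
  (* the coordinate s = 1/z at infinity *)
  set (u := fun s : C => if excluded_middle_informative (s = 0%C) then RtoC 0 else (/ e (/ s))%C).
  assert (u0 : u 0%C = 0%C) by (unfold u; destruct excluded_middle_informative; congruence).
  assert (un : forall s : C, s <> 0%C -> u s = (/ e (/ s))%C).
  { intros s N; unfold u; destruct excluded_middle_informative; congruence. }
  destruct (at_infinity_inv _ (Hp 1)) as [rho [Hrho H1]].
  assert (Z0 : forall z, (z - 0)%C = z) by (intros; ring).
  assert (D1 : forall z, Disc 0 rho z -> z <> 0%C -> e (/ z)%C <> 0%C /\ 1 <= Cmod (e (/ z)%C)).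
  { intros z Dz N. unfold Disc in Dz. rewrite Z0 in Dz. specialize (H1 z N Dz). split; auto.
    apply Cmod_gt_0. lra. }
  assert (Du : forall z, Disc 0 rho z -> z <> 0%C -> Cdiff u z).
  { intros z Dz N. destruct (D1 z Dz N) as [A _].
    apply (Cdiff_ext_loc (fun s => / e (/ s))%C).
    - apply locally_Cmod. exists (Cmod z). split; [apply Cmod_gt_0; auto|].
      intros y Hy. symmetry. apply un. intros ->. rewrite Cmod_sub_sym, Z0 in Hy. lra.
    - apply (Cdiff_inv (fun s => e (/ s)%C)); auto.
      apply (Cdiff_comp (fun s : C => / s)%C e); [|apply He].
      apply (Cdiff_inv (fun s => s)); auto. apply Cdiff_id. }
  assert (Cu : Ccont u (RtoC 0)).
  { rewrite u0. intros eps Heps. destruct (at_infinity_inv _ (Hp (2 / eps))) as [d [Hd H]].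
    apply locally_Cmod. exists d. split; auto. intros y Hy. rewrite Z0 in *.
    destruct (classic (y = 0%C)) as [->|N]; [rewrite u0, Cmod_0; auto|].
    rewrite un by auto. specialize (H y N Hy).
    assert (0 < 2 / eps) by (apply Rdiv_lt_0_compat; lra).
    rewrite Cmod_inv by (apply Cmod_gt_0; lra).
    apply Rle_lt_trans with (/ (2 / eps)); [apply Rinv_le_contravar; auto|].
    replace (/ (2 / eps)) with (eps / 2) by (field; lra). lra. }
  assert (Du' : forall z, Disc 0 rho z -> Cdiff u z).
  { intros z Dz. destruct (classic (z = 0%C)) as [->|N]; auto.
    apply (removable_singularity u (RtoC 0) rho); auto. }
  assert (Bu : forall z, Disc 0 rho z -> Cmod (u z) <= 1).
  { intros z Dz. destruct (classic (z = 0%C)) as [->|N].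
    - rewrite u0, Cmod_0. lra.
    - destruct (D1 z Dz N) as [A B]. rewrite un, Cmod_inv by auto.
      rewrite <- Rinv_1. apply Rinv_le_contravar; lra. }
  assert (S1 : RtoC (rho / 2) <> 0%C) by (intros E; apply RtoC_inj in E; lra).
  assert (S2 : Disc 0 rho (RtoC (rho / 2))).
  { unfold Disc. rewrite Z0, Cmod_R, Rabs_pos_eq; lra. }
  assert (S3 : u (RtoC (rho / 2)) <> 0%C).
  { rewrite un by auto. destruct (D1 _ S2 S1) as [A B]. apply Cmod_gt_0.
    rewrite Cmod_inv by auto. apply Rinv_0_lt_compat. lra. }
  destruct (finite_order u rho _ Du' Bu S2 S1 S3) as [N [v [E [Dv V0]]]].
  exists N. pose proof (proj1 (Cmod_gt_0 _) V0) as PV.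
  destruct (Ccont_loc v (RtoC 0) (Cmod (v 0%C) / 2) ltac:(lra)) as [d [Hd Hv]].
  { apply Cdiff_cont, Dv. apply Disc_center; auto. }
  apply (poly_growth_intro _ _ (2 / Cmod (v 0%C))).
  { left. apply Rdiv_lt_0_compat; lra. }
  exists (Rmax 1 (Rmax (2 / d) (2 / rho))). intros z Hz.
  assert (L1 : 1 <= Cmod z) by (eapply Rle_trans; [apply Rmax_l|exact Hz]).
  assert (L2 : 2 / d <= Cmod z) by (eapply Rle_trans; [|exact Hz]; eapply Rle_trans; [apply Rmax_l|apply Rmax_r]).
  assert (L3 : 2 / rho <= Cmod z) by (eapply Rle_trans; [|exact Hz]; eapply Rle_trans; [apply Rmax_r|apply Rmax_r]).
  assert (Nz : z <> 0%C) by (apply Cmod_gt_0; lra).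
  assert (Ni : (/ z)%C <> 0%C) by (apply Cmod_gt_0; rewrite Cmod_inv by auto; apply Rinv_0_lt_compat; lra).
  assert (Inv : forall x, 0 < x -> 2 / x <= Cmod z -> Cmod (/ z) < x).
  { intros x Hx Hxz. rewrite Cmod_inv by auto. 
    apply Rle_lt_trans with (/ (2 / x)); [apply Rinv_le_contravar; auto; apply Rdiv_lt_0_compat; lra|].
    replace (/ (2 / x)) with (x / 2) by (field; lra). lra. }
  assert (I1 : Disc 0 rho (/ z)%C) by (unfold Disc; rewrite Z0; auto).
  destruct (D1 _ I1 Ni) as [A B].
  specialize (Hv (/ z)%C ltac:(rewrite Z0; auto)).
  assert (Vz : Cmod (v 0%C) / 2 <= Cmod (v (/ z)%C)).
  { pose proof (Cmod_tri3 (v 0%C) (v (/ z)%C) 0) as T. rewrite !Z0 in T. rewrite (Cmod_sub_sym (v 0%C)) in T. lra. }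
  specialize (E (/ z)%C). rewrite un in E by auto.
  assert (Iz : (/ / z = z)%C) by (field; auto).
  rewrite Iz in *. rewrite Cpow_inv in E by auto.
  assert (Ev : (e z * v (/ z) = Cpow z N)%C).
  { pose proof (Cpow_nz z N Nz). replace (v (/ z))%C with ((z ^ N * (/ z ^ N * v (/ z))))%C by (field; auto).
    rewrite <- E. field; auto. }
  apply (f_equal Cmod) in Ev. rewrite Cmod_mult, Cmod_pow in Ev.
  rewrite <- Ev. 
  apply Rle_trans with (2 / Cmod (v 0%C) * (Cmod (e z) * (Cmod (v 0%C) / 2))); [right; field; lra|].
  apply Rmult_le_compat_l; [left; apply Rdiv_lt_0_compat; lra|].
  apply Rmult_le_compat_l; [apply Cmod_ge_0|auto].
Qed.

Lemma Csqrt_exists (v : C) : exists z, (z * z = v)%C.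
Proof.
  destruct v as [x y]. set (m := Cmod (x, y)).
  assert (Hm : m * m = x * x + y * y).
  { unfold m, Cmod; simpl. rewrite !Rmult_1_r. apply sqrt_sqrt. nra. }
  assert (M0 : 0 <= m) by apply Cmod_ge_0.
  pose proof (re_le_Cmod (x, y)) as B. fold m in B. simpl in B. apply Rabs_le_between in B.
  set (a := sqrt ((m + x) / 2)). set (b := sqrt ((m - x) / 2)).
  assert (Ha : a * a = (m + x) / 2) by (apply sqrt_sqrt; lra).
  assert (Hb : b * b = (m - x) / 2) by (apply sqrt_sqrt; lra).
  assert (Pa : 0 <= a) by apply sqrt_pos. assert (Pb : 0 <= b) by apply sqrt_pos.
  assert (Hab : (2 * (a * b)) * (2 * (a * b)) = y * y) by nra.
  destruct (Rle_dec 0 y).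
  - exists (a, b). apply injective_projections; simpl; [lra|].
    assert (2 * (a * b) = y); [|lra]. apply Rsqr_inj; unfold Rsqr; try nra.
  - exists (a, - b). apply injective_projections; simpl; [lra|].
    assert (2 * (a * b) = - y); [|lra]. apply Rsqr_inj; unfold Rsqr; try nra.
Qed.

(** Take the exponential of half a primitive of [q' / q]. *)
Lemma entire_sqrt q : Entire q -> (forall z, q z <> 0%C) ->
  exists u, Entire u /\ forall z, (u z * u z = q z)%C.
Proof.
  intros Hq Nq.
  destruct (choice (fun z d => Cderiv q z d) Hq) as [d Hd].
  assert (Dd : Entire d).
  { intros z. apply (derivative_diff q d z 1); auto. apply Disc_center; lra. }
  set (l := fun z => (d z / q z)%C).
  assert (Dl : Entire l) by (intros z; apply Cdiff_div; auto).
  set (L := fun z => seg_int l 0 z).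
  assert (HL : forall z, Cderiv L z (l z)).
  { intros z. apply (primitive_disc l 0 0 (Cmod z + 1)).
    - intros; apply Cdiff_cont, Dl.
    - intros; apply Dl.
    - apply Disc_center. pose proof (Cmod_ge_0 z); lra.
    - unfold Disc. replace (z - 0)%C with z by ring. lra. }
  (* q exp(-L) is constant because L' = q'/q *)
  set (k := fun z => (q z * Cexp (- L z))%C).
  assert (Hk : forall z, Cderiv k z 0).
  { intros z. eapply Cderiv_eq.
    2:{ apply Cderiv_mult; [apply Hd|]. apply (Cderiv_comp (fun z => - L z)%C Cexp).
        - apply Cderiv_opp, HL.
        - apply Cderiv_Cexp. }
    unfold l. field; auto. }
  destruct (Csqrt_exists (k 0%C)) as [u0 Hu0].
  exists (fun z => u0 * Cexp (L z * / 2))%C. split.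
  - apply Entire_mult; [apply Entire_const|]. 
    apply (Entire_comp (fun z => L z * / 2)%C Cexp).
    + apply Entire_mult; [|apply Entire_const]. intros z; eexists; apply HL.
    + intros z; eexists; apply Cderiv_Cexp.
  - intros z. assert (E : k z = k 0%C).
    { apply (const_of_deriv_0 k 0 (Cmod z + 1)); auto.
      - unfold Disc. replace (z - 0)%C with z by ring. lra.
      - pose proof (Cmod_ge_0 z); lra. }
    replace (u0 * Cexp (L z * / 2) * (u0 * Cexp (L z * / 2)))%C with
      ((u0 * u0) * (Cexp (L z * / 2) * Cexp (L z * / 2)))%C by ring.
    rewrite Hu0, <- E, <- Cexp_plus.
    replace (L z * / 2 + L z * / 2)%C with (L z) by cfield.
    unfold k. rewrite <- Cmult_assoc, <- Cexp_plus. replace (- L z + L z)%C with (RtoC 0) by ring.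
    rewrite Cexp_0. ring.
Qed.

(** Since [(z - s) (z + s) = v - s^2], the smaller of the two factors is at most the square root of
    the right hand side. *)
Lemma near_root (s v : C) : exists z, (z * z = v)%C /\ Cmod (z - s) * Cmod (z - s) <= Cmod (v - s * s).
Proof.
  destruct (Csqrt_exists v) as [z Hz].
  assert (E : Cmod (z - s) * Cmod (z + s) = Cmod (v - s * s)).
  { rewrite <- Cmod_mult, <- Hz. f_equal. ring. }
  pose proof (Cmod_ge_0 (z - s)). pose proof (Cmod_ge_0 (z + s)).
  destruct (Rle_dec (Cmod (z - s)) (Cmod (z + s))).
  - exists z. split; auto. rewrite <- E. apply Rmult_le_compat_l; auto.
  - exists (- z)%C. split; [rewrite <- Hz; ring|].
    replace (- z - s)%C with (- (z + s))%C by ring. rewrite Cmod_opp, <- E.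
    apply Rmult_le_compat_r; lra.
Qed.

Lemma sq_eq (a b : C) : (a * a = b * b)%C -> a = b \/ a = (- b)%C.
Proof.
  intros E. assert (F : ((a - b) * (a + b) = 0)%C).
  { replace ((a - b) * (a + b))%C with (a * a - b * b)%C by ring. rewrite E. ring. }
  destruct (classic (a = b)) as [|N]; auto. right.
  assert (a + b = 0)%C.
  { apply NNPP. intros N2. apply (Cmult_neq_0 _ _ (Cminus_neq _ _ N) N2 F). }
  replace a with ((a + b) - b)%C by ring. rewrite H. ring.
Qed.

(** * Differentiability in three complex variables *)

Definition pt (x s t : C) : C3 := ((x, s), t).
Definition c1 (p : C3) : C := fst (fst p).
Definition c2 (p : C3) : C := snd (fst p).
Definition c3 (p : C3) : C := snd p.

Lemma pt_eta (p : C3) : p = pt (c1 p) (c2 p) (c3 p).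
Proof. destruct p as [[x s] t]; reflexivity. Qed.

Lemma C3_ext (p q : C3) : c1 p = c1 q -> c2 p = c2 q -> c3 p = c3 q -> p = q.
Proof. destruct p as [[x s] t], q as [[x' s'] t']; unfold c1, c2, c3; simpl; congruence. Qed.

Lemma locally_C3 (p : C3) (P : C3 -> Prop) :
  locally p P <-> exists d, 0 < d /\ forall q : C3,
    Cmod (c1 q - c1 p) < d -> Cmod (c2 q - c2 p) < d -> Cmod (c3 q - c3 p) < d -> P q.
Proof.
  split.
  - intros [d Hd]. exists d; split; [apply cond_pos|].
    intros q H1 H2 H3. apply Hd. 
    split; [split|]; apply C_NormedModule_mixin_compat1; assumption.
  - intros [d [Hd H]].
    assert (Hs : 0 < sqrt 2) by (apply sqrt_lt_R0; lra).
    assert (Hp : 0 < d / sqrt 2) by (apply Rdiv_lt_0_compat; lra).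
    exists (mkposreal _ Hp). intros q [[B1 B2] B3].
    assert (K : forall x y : C, ball x (d / sqrt 2) y -> Cmod (y - x) < d).
    { intros x y B. pose proof (C_NormedModule_mixin_compat2 x y (mkposreal _ Hp) B) as K.
      simpl in K. replace (sqrt 2 * (d / sqrt 2)) with d in K by (field; lra). exact K. }
    apply H; apply K; assumption.
Qed.

#[global] Instance C3_filter (p : C3) : @ProperFilter C3 (@locally C3 p) := locally_filter p.

Lemma Clim_c1 (p : C3) : Clim (@locally C3 p) c1 (c1 p).
Proof. intros eps He. apply locally_C3. exists eps. auto. Qed.
Lemma Clim_c2 (p : C3) : Clim (@locally C3 p) c2 (c2 p).
Proof. intros eps He. apply locally_C3. exists eps. auto. Qed.
Lemma Clim_c3 (p : C3) : Clim (@locally C3 p) c3 (c3 p).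
Proof. intros eps He. apply locally_C3. exists eps. auto. Qed.

Lemma filterlim_C3 {T} (F : (T -> Prop) -> Prop) {FF : Filter F} (f : T -> C3) (q : C3) :
  filterlim f F (locally q) <->
  Clim F (fun x => c1 (f x)) (c1 q) /\ Clim F (fun x => c2 (f x)) (c2 q) /\
  Clim F (fun x => c3 (f x)) (c3 q).
Proof.
  split.
  - intros H. repeat split; intros eps He; apply (H (fun y => Cmod (_ y - _ q) < eps));
      apply locally_C3; exists eps; auto.
  - intros [A [B D]] P HP. apply locally_C3 in HP. destruct HP as [d [Hd HP]].
    unfold filtermap. generalize (filter_and (F:=F) _ _ (A d Hd) (filter_and (F:=F) _ _ (B d Hd) (D d Hd))).
    apply filter_imp. intros x [X [Y Z]]. apply HP; assumption.
Qed.


Lemma norm_C3_ge (p : C3) : Cmod (c1 p) <= norm p /\ Cmod (c2 p) <= norm p /\ Cmod (c3 p) <= norm p.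
Proof.
  destruct p as [[x s] t].
  pose proof (norm_prod (K:=C_AbsRing) (U:=C2) (V:=C_NormedModule) (x, s) t) as [H _].
  pose proof (norm_prod (K:=C_AbsRing) (U:=C_NormedModule) (V:=C_NormedModule) x s) as [H' _].
  pose proof (Rle_trans _ _ _ (Rmax_l _ _) H) as A. pose proof (Rle_trans _ _ _ (Rmax_r _ _) H) as B.
  pose proof (Rle_trans _ _ _ (Rle_trans _ _ _ (Rmax_l _ _) H') A) as A1.
  pose proof (Rle_trans _ _ _ (Rle_trans _ _ _ (Rmax_r _ _) H') A) as A2.
  split; [exact A1|split; [exact A2|exact B]].
Qed.

Lemma sqrt_sum_sq_le a b : 0 <= a -> 0 <= b -> sqrt (a ^ 2 + b ^ 2) <= a + b.
Proof.
  intros Ha Hb. rewrite <- (sqrt_pow2 (a + b)) by lra. apply sqrt_le_1_alt. nra.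
Qed.

Lemma norm_C3_le (p : C3) : norm p <= Cmod (c1 p) + Cmod (c2 p) + Cmod (c3 p).
Proof.
  destruct p as [[x s] t]. unfold c1, c2, c3; simpl fst; simpl snd.
  change (@norm C_AbsRing C3 ((x, s), t)) with (sqrt (sqrt (Cmod x ^ 2 + Cmod s ^ 2) ^ 2 + Cmod t ^ 2)).
  eapply Rle_trans; [apply sqrt_sum_sq_le; [apply sqrt_pos|apply Cmod_ge_0]|].
  apply Rplus_le_compat_r. apply sqrt_sum_sq_le; apply Cmod_ge_0.
Qed.

(** The analogue of [Cderiv] in three variables. *)
Definition Cdiff3 (F : C3 -> C) (p : C3) : Prop :=
  exists A B D : C3 -> C,
    (forall q, F q = F p + A q * (c1 q - c1 p) + B q * (c2 q - c2 p) + D q * (c3 q - c3 p))%C /\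
    Clim (@locally C3 p) A (A p) /\ Clim (@locally C3 p) B (B p) /\ Clim (@locally C3 p) D (D p).

Definition lin3 (a b d : C) (v : C3) : C := (a * c1 v + b * c2 v + d * c3 v)%C.

Lemma lin3_bound a b d v : Cmod (lin3 a b d v) <= (Cmod a + Cmod b + Cmod d) * norm v.
Proof.
  unfold lin3. destruct (norm_C3_ge v) as [H1 [H2 H3]].
  eapply Rle_trans; [apply Cmod_triangle|].
  eapply Rle_trans; [apply Rplus_le_compat_r, Cmod_triangle|].
  rewrite !Cmod_mult. pose proof (Cmod_ge_0 a). pose proof (Cmod_ge_0 b). pose proof (Cmod_ge_0 d).
  rewrite !Rmult_plus_distr_r. repeat apply Rplus_le_compat; apply Rmult_le_compat_l; auto.
Qed.

Lemma is_linear_C3 a1 b1 d1 a2 b2 d2 a3 b3 d3 :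
  @is_linear C_AbsRing C3 C3 (fun v => pt (lin3 a1 b1 d1 v) (lin3 a2 b2 d2 v) (lin3 a3 b3 d3 v)).
Proof.
  constructor.
  - intros [[x s] t] [[x' s'] t'].
    apply C3_ext; unfold pt, lin3, c1, c2, c3, plus; simpl; unfold plus; simpl; ring.
  - intros k [[x s] t].
    apply C3_ext; unfold pt, lin3, c1, c2, c3, scal; simpl; unfold scal; simpl; unfold mult; simpl; ring.
  - exists (Cmod a1 + Cmod b1 + Cmod d1 + (Cmod a2 + Cmod b2 + Cmod d2) + (Cmod a3 + Cmod b3 + Cmod d3) + 1).
    split.
    + pose proof (Cmod_ge_0 a1). pose proof (Cmod_ge_0 b1). pose proof (Cmod_ge_0 d1).
      pose proof (Cmod_ge_0 a2). pose proof (Cmod_ge_0 b2). pose proof (Cmod_ge_0 d2).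
      pose proof (Cmod_ge_0 a3). pose proof (Cmod_ge_0 b3). pose proof (Cmod_ge_0 d3). lra.
    + intros v. eapply Rle_trans; [apply norm_C3_le|].
      unfold pt, c1, c2, c3; simpl fst; simpl snd.
      pose proof (lin3_bound a1 b1 d1 v). pose proof (lin3_bound a2 b2 d2 v). pose proof (lin3_bound a3 b3 d3 v).
      pose proof (norm_ge_0 v). lra.
Qed.

Lemma Cdiff3_eps F p : Cdiff3 F p -> exists a b d : C, forall eps, 0 < eps ->
  locally p (fun q : C3 => Cmod (F q - F p - lin3 a b d (minus q p)) <= eps * norm (minus q p)).
Proof.
  intros [A [B [D [E [LA [LB LD]]]]]]. exists (A p), (B p), (D p). intros eps He.
  generalize (filter_and (F:=locally p) _ _ (LA (eps/3) ltac:(lra))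
    (filter_and (F:=locally p) _ _ (LB (eps/3) ltac:(lra)) (LD (eps/3) ltac:(lra)))).
  apply filter_imp. intros q [HA [HB HD]].
  destruct (norm_C3_ge (minus q p)) as [H1 [H2 H3]].
  change (c1 (minus q p)) with (c1 q - c1 p)%C in *. change (c2 (minus q p)) with (c2 q - c2 p)%C in *.
  change (c3 (minus q p)) with (c3 q - c3 p)%C in *.
  set (n := norm (minus q p)) in *.
  replace (F q - F p - lin3 (A p) (B p) (D p) (minus q p))%C with
    ((A q - A p) * (c1 q - c1 p) + (B q - B p) * (c2 q - c2 p) + (D q - D p) * (c3 q - c3 p))%C.
  2:{ rewrite (E q). unfold lin3. change (c1 (minus q p)) with (c1 q - c1 p)%C.
      change (c2 (minus q p)) with (c2 q - c2 p)%C. change (c3 (minus q p)) with (c3 q - c3 p)%C. ring. }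
  eapply Rle_trans; [apply Cmod_triangle|].
  eapply Rle_trans; [apply Rplus_le_compat_r, Cmod_triangle|].
  rewrite !Cmod_mult.
  assert (forall x y, x < eps / 3 -> 0 <= x -> 0 <= y -> y <= n -> x * y <= eps / 3 * n) as K.
  { intros. apply Rmult_le_compat; lra. }
  pose proof (K _ _ HA (Cmod_ge_0 _) (Cmod_ge_0 _) H1). pose proof (K _ _ HB (Cmod_ge_0 _) (Cmod_ge_0 _) H2).
  pose proof (K _ _ HD (Cmod_ge_0 _) (Cmod_ge_0 _) H3). lra.
Qed.

Lemma ex_filterdiff_C3 F1 F2 F3 (p : C3) : Cdiff3 F1 p -> Cdiff3 F2 p -> Cdiff3 F3 p ->
  @ex_filterdiff C_AbsRing C3 C3 (fun q => pt (F1 q) (F2 q) (F3 q)) (locally p).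
Proof.
  intros H1 H2 H3.
  destruct (Cdiff3_eps _ _ H1) as [a1 [b1 [d1 E1]]]. destruct (Cdiff3_eps _ _ H2) as [a2 [b2 [d2 E2]]].
  destruct (Cdiff3_eps _ _ H3) as [a3 [b3 [d3 E3]]].
  exists (fun v => pt (lin3 a1 b1 d1 v) (lin3 a2 b2 d2 v) (lin3 a3 b3 d3 v)).
  split; [apply is_linear_C3|].
  intros x Hx. assert (E0 : p = x) by (apply is_filter_lim_locally_unique; exact Hx). subst x.
  intros eps. pose proof (cond_pos eps) as He.
  generalize (filter_and (F:=locally p) _ _ (E1 (eps/3) ltac:(lra))
    (filter_and (F:=locally p) _ _ (E2 (eps/3) ltac:(lra)) (E3 (eps/3) ltac:(lra)))).
  apply filter_imp. intros q [HA [HB HD]].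
  eapply Rle_trans; [apply norm_C3_le|].
  match goal with |- Cmod (c1 ?w) + _ + _ <= _ =>
    change (c1 w) with ((F1 q - F1 p) - lin3 a1 b1 d1 (minus q p))%C;
    change (c2 w) with ((F2 q - F2 p) - lin3 a2 b2 d2 (minus q p))%C;
    change (c3 w) with ((F3 q - F3 p) - lin3 a3 b3 d3 (minus q p))%C end.
  lra.
Qed.

Lemma Cdiff3_of_x (f : C -> C) p : Cdiff f (c1 p) -> Cdiff3 (fun q => f (c1 q)) p.
Proof.
  intros [d [phi [E [P L]]]].
  exists (fun q => phi (c1 q)), (fun _ => RtoC 0), (fun _ => RtoC 0). repeat split.
  - intros q. rewrite (E (c1 q)). ring.
  - cap (Clim_comp _ c1 phi (c1 p)); [apply Clim_c1|rewrite P; exact L].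
  - cap Clim_const.
  - cap Clim_const.
Qed.

Lemma Cdiff3_mult F G p : Cdiff3 F p -> Cdiff3 G p -> Cdiff3 (fun q => F q * G q)%C p.
Proof.
  intros [A [B [D [E [LA [LB LD]]]]]] [A' [B' [D' [E' [LA' [LB' LD']]]]]].
  assert (LG : Clim (@locally C3 p) G (G p)).
  { apply (Clim_ext _ (fun q => G p + A' q * (c1 q - c1 p) + B' q * (c2 q - c2 p) + D' q * (c3 q - c3 p))%C).
    { apply filter_forall. intros; symmetry; apply E'. }
    apply (Clim_eq _ _ (G p + A' p * (c1 p - c1 p) + B' p * (c2 p - c2 p) + D' p * (c3 p - c3 p))%C); [ring|].
    repeat (cap Clim_plus); [cap Clim_const| | |]; (cap Clim_mult; [assumption|]; cap Clim_minus; [|cap Clim_const]).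
    - apply Clim_c1. - apply Clim_c2. - apply Clim_c3. }
  exists (fun q => A q * G q + F p * A' q)%C, (fun q => B q * G q + F p * B' q)%C, (fun q => D q * G q + F p * D' q)%C.
  repeat split.
  - intros q. rewrite (E q) at 1. 
    transitivity (F p * G q + (A q * (c1 q - c1 p) + B q * (c2 q - c2 p) + D q * (c3 q - c3 p)) * G q)%C; [ring|].
    rewrite (E' q) at 1. ring.
  - cap Clim_plus; cap Clim_mult; auto; cap Clim_const.
  - cap Clim_plus; cap Clim_mult; auto; cap Clim_const.
  - cap Clim_plus; cap Clim_mult; auto; cap Clim_const.
Qed.

Lemma Cdiff3_c2 p : Cdiff3 c2 p.
Proof.
  exists (fun _ => RtoC 0), (fun _ => RtoC 1), (fun _ => RtoC 0). repeat split; try (cap Clim_const).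
  intros q. ring.
Qed.

Lemma Cdiff3_c3 p : Cdiff3 c3 p.
Proof.
  exists (fun _ => RtoC 0), (fun _ => RtoC 0), (fun _ => RtoC 1). repeat split; try (cap Clim_const).
  intros q. ring.
Qed.

(** Holomorphy of a map on the surface is given by ambient extensions; composing with a branch
    [x |-> (x, z2 x, z3 x)] turns it into differentiability in one variable. *)
Lemma ex_filterdiff_curve (G : C3 -> C3) (z2 z3 : C -> C) (x : C) :
  ex_filterdiff G (locally (pt x (z2 x) (z3 x))) -> Cdiff z2 x -> Cdiff z3 x ->
  Cdiff (fun y => c1 (G (pt y (z2 y) (z3 y)))) x.
Proof.
  intros [l [Hl H]] D2 D3. set (p := pt x (z2 x) (z3 x)) in *.
  specialize (H p (fun P HP => HP)).
  pose proof (Cdiff_cont _ _ D2) as K2. pose proof (Cdiff_cont _ _ D3) as K3.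
  destruct D2 as [d2 [f2 [E2 [P2 L2]]]]. destruct D3 as [d3 [f3 [E3 [P3 L3]]]].
  set (l1 := c1 (l (pt 1 0 0))). set (l2 := c1 (l (pt 0 1 0))). set (l3 := c1 (l (pt 0 0 1))).
  assert (Lin : forall a b d, c1 (l (pt a b d)) = (a * l1 + b * l2 + d * l3)%C).
  { intros a b d.
    assert (E : pt a b d = plus (plus (scal a (pt 1 0 0)) (scal b (pt 0 1 0))) (scal d (pt 0 0 1))).
    { apply C3_ext; unfold pt, c1, c2, c3, plus, scal; simpl; unfold plus, scal; simpl; unfold mult; simpl; ring. }
    rewrite E, !(linear_plus _ Hl), !(linear_scal _ Hl). reflexivity. }
  exists (l1 + d2 * l2 + d3 * l3)%C. apply Cderiv_eps. intros eps He.
  set (M := 3 + Cmod d2 + Cmod d3 + Cmod l2 + Cmod l3).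
  pose proof (Cmod_ge_0 d2) as Q2. pose proof (Cmod_ge_0 d3) as Q3.
  pose proof (Cmod_ge_0 l2) as Q4. pose proof (Cmod_ge_0 l3) as Q5.
  assert (HM : 3 <= M) by (unfold M; lra).
  assert (He1 : 0 < eps / (3 * M)) by (apply Rdiv_lt_0_compat; lra).
  assert (Curve : filterlim (fun y => pt y (z2 y) (z3 y)) (@locally C_UniformSpace x) (locally p)).
  { apply filterlim_C3; [exact _|]. split; [|split]; [apply Clim_id|exact K2|exact K3]. }
  pose proof (Curve _ (H (mkposreal _ He1))) as N1. unfold filtermap in N1. simpl in N1.
  assert (R1 : 0 < Rmin 1 (eps / (3 * M))) by (apply Rmin_pos; lra).
  pose proof (filter_and (F:=locally x) _ _ N1 (filter_and (F:=locally x) _ _ (L2 _ R1) (L3 _ R1))) as N.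
  apply locally_Cmod in N. destruct N as [r [Hr N]]. exists r; split; auto.
  intros y Hy. destruct (N y Hy) as [A [B2 B3]]. clear N.
  pose proof (Rmin_l 1 (eps / (3 * M))) as m1. pose proof (Rmin_r 1 (eps / (3 * M))) as m2.
  set (q := pt y (z2 y) (z3 y)) in *.
  assert (Eq : minus q p = pt (y - x)%C ((y - x) * f2 y)%C ((y - x) * f3 y)%C).
  { apply C3_ext.
    - reflexivity.
    - change (z2 y - z2 x = (y - x) * f2 y)%C. rewrite (E2 y). ring.
    - change (z3 y - z3 x = (y - x) * f3 y)%C. rewrite (E3 y). ring. }
  rewrite Eq in A.
  pose proof (norm_C3_ge (minus (minus (G q) (G p)) (l (pt (y - x)%C ((y - x) * f2 y)%C ((y - x) * f3 y)%C)))) as [G1 _].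
  match type of G1 with Cmod (c1 (minus (minus ?a ?b) ?c)) <= _ =>
    change (c1 (minus (minus a b) c)) with (c1 a - c1 b - c1 c)%C in G1 end.
  rewrite Lin in G1.
  pose proof (norm_C3_le (pt (y - x)%C ((y - x) * f2 y)%C ((y - x) * f3 y)%C)) as G2.
  unfold pt at 2 3 4 in G2. unfold c1, c2, c3 in G2. simpl fst in G2. simpl snd in G2.
  rewrite !Cmod_mult in G2. set (h := Cmod (y - x)) in *.
  assert (h0 : 0 <= h) by apply Cmod_ge_0.
  assert (F2 : Cmod (f2 y) <= Cmod d2 + 1).
  { replace (f2 y) with ((f2 y - d2) + d2)%C by ring. eapply Rle_trans; [apply Cmod_triangle|]. lra. }
  assert (F3 : Cmod (f3 y) <= Cmod d3 + 1).
  { replace (f3 y) with ((f3 y - d3) + d3)%C by ring. eapply Rle_trans; [apply Cmod_triangle|]. lra. }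
  assert (G3 : norm (pt (y - x)%C ((y - x) * f2 y)%C ((y - x) * f3 y)%C) <= M * h).
  { eapply Rle_trans; [exact G2|]. unfold M. nra. }
  set (u := (c1 (G q) - c1 (G p) - ((y - x) * l1 + (y - x) * f2 y * l2 + (y - x) * f3 y * l3))%C) in *.
  assert (U : Cmod u <= eps / 3 * h).
  { eapply Rle_trans; [exact G1|]. eapply Rle_trans; [exact A|].
    apply Rle_trans with (eps / (3 * M) * (M * h)); [apply Rmult_le_compat_l; lra|].
    right. field. lra. }
  match goal with |- Cmod ?w <= _ => replace w with
    (u + ((f2 y - d2) * l2 + (f3 y - d3) * l3) * (y - x))%C end.
  2:{ unfold u. cbv beta. fold q. fold p. ring. }
  eapply Rle_trans; [apply Cmod_triangle|]. rewrite Cmod_mult. fold h.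
  assert (S : Cmod ((f2 y - d2) * l2 + (f3 y - d3) * l3) <= 2 / 3 * eps).
  { eapply Rle_trans; [apply Cmod_triangle|]. rewrite !Cmod_mult.
    apply Rle_trans with (eps / (3 * M) * M + eps / (3 * M) * M).
    - apply Rplus_le_compat; apply Rmult_le_compat; try apply Cmod_ge_0; try lra; unfold M; lra.
    - right. field. lra. }
  nra.
Qed.

(** * From a biholomorphism of the plane to an isomorphism *)

Definition simple_zero_set (f : C -> C) (Z : C -> Prop) : Prop :=
  Entire f /\ (forall z, f z = 0%C <-> Z z) /\
  (forall z, f z = 0%C -> exists d, Cderiv f z d /\ d <> 0%C).

Lemma simple_zero_set_of_simple f Z : entire f -> simple_zeros_exactly f Z -> simple_zero_set f Z.
Proof.
  intros He [Hz Hs]. split; [exact (proj1 (entire_Cdiff f) He)|]. split; auto.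
  intros z Ez. destruct (Hs z Ez) as [_ [d [Hd Nd]]]. exists d. split; auto.
  apply is_derive_Cderiv, Hd.
Qed.

Lemma Cmult_integral_iff (a b : C) : (a * b = 0)%C <-> a = 0%C \/ b = 0%C.
Proof.
  split.
  - intros E. destruct (classic (a = 0%C)); auto. destruct (classic (b = 0%C)); auto.
    exfalso. apply (Cmult_neq_0 a b); auto.
  - intros [-> | ->]; ring.
Qed.

(** By the product rule the derivative at a root is the product of the other factors. *)
Lemma simple_zero_set_product s : NoDup s ->
  simple_zero_set (fun z => fold_right Cmult 1%C (map (fun a => z - a)%C s)) (fun a => In a s).
Proof.
  induction s as [|b s IH]; intros Nd.
  - simpl. split; [apply Entire_const|]. split.
    + intros z; split; [|tauto]. intros E. apply RtoC_inj in E. lra.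
    + intros z E. apply RtoC_inj in E. lra.
  - inversion Nd as [|? ? Nb Nd']; subst. destruct (IH Nd') as [He [Hz Hs]]. simpl.
    set (P := fun z => fold_right Cmult 1%C (map (fun a => z - a)%C s)) in *.
    assert (El : Entire (fun z => z - b)%C) by (apply Entire_minus; [apply Entire_id|apply Entire_const]).
    assert (Zb : forall z, (z - b = 0)%C <-> b = z).
    { intros z; split.
      - intros E. symmetry. apply NNPP. intros N. apply (Cminus_neq _ _ N E).
      - intros ->. ring. }
    split; [apply Entire_mult; auto|]. split.
    + intros z. change ((z - b) * P z = 0 <-> b = z \/ In z s)%C.
      rewrite Cmult_integral_iff, Zb. specialize (Hz z). fold (P z) in Hz. tauto.
    + intros z E. change ((z - b) * P z = 0)%C in E. destruct (He z) as [d D].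
      assert (Dv : Cderiv (fun z => (z - b) * P z)%C z ((1 - 0) * P z + (z - b) * d)%C).
      { apply (Cderiv_mult (fun z => z - b)%C P); [|exact D].
        apply (Cderiv_minus (fun z => z) (fun _ => b)); [apply Cderiv_id|apply Cderiv_const]. }
      eexists; split; [exact Dv|].
      apply Cmult_integral_iff in E. destruct E as [E|E].
      * rewrite E. replace ((1 - 0) * P z + 0 * d)%C with (P z) by ring.
        intros E2. apply Hz in E2. apply Zb in E. subst z. contradiction.
      * rewrite E. replace ((1 - 0) * 0 + (z - b) * d)%C with ((z - b) * d)%C by ring.
        destruct (Hs z E) as [d' [D' Nd2]]. rewrite (Cderiv_unique _ _ _ _ D D').
        apply Cmult_neq_0; auto. intros E2. apply Zb in E2. subst z. apply Hz in E. contradiction.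
Qed.

Lemma simple_zero_set_ext f g Z Y : (forall z, f z = g z) -> (forall z, Z z <-> Y z) -> simple_zero_set f Z -> simple_zero_set g Y.
Proof.
  intros E EZ [He [Hz Hs]]. split; [eapply Entire_ext; eauto|]. split.
  - intros z. rewrite <- E, <- EZ. apply Hz.
  - intros z Ez. rewrite <- E in Ez. destruct (Hs z Ez) as [d [D N]].
    exists d; split; auto. eapply Cderiv_ext; eauto.
Qed.

Lemma simple_zero_set_associated A g : associated_function A g -> simple_zero_set g A.
Proof.
  intros [[s [[Nd HA] Hg]]|[_ [He Hs]]].
  - eapply simple_zero_set_ext; [| |apply (simple_zero_set_product s Nd)].
    + intros z. symmetry. apply Hg.
    + intros z. symmetry. apply HA.
  - apply simple_zero_set_of_simple; auto.
Qed.

Lemma simple_zero_set_comp f Z t : simple_zero_set f Z -> Entire t -> (forall z, ~ Cderiv t z 0) ->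
  simple_zero_set (fun z => f (t z)) (fun z => Z (t z)).
Proof.
  intros [He [Hz Hs]] Ht Nt. split; [apply Entire_comp; auto|]. split.
  - intros z. apply Hz.
  - intros z E. destruct (Hs _ E) as [d [D Nd]]. destruct (Ht z) as [d' D'].
    eexists; split; [apply (Cderiv_comp t f); eassumption|].
    apply Cmult_neq_0; auto. intros ->. apply (Nt z D').
Qed.

Lemma simple_zero_set_factor f Z a : simple_zero_set f Z -> f a = 0%C ->
  exists g, Entire g /\ (forall z, f z = (z - a) * g z)%C /\ g a <> 0%C /\ Cderiv f a (g a).
Proof.
  intros [He [Hz Hs]] E. destruct (divide_entire f a He E) as [g [Hg Eg]].
  destruct (Hs a E) as [d [D Nd]]. destruct (Hg a) as [d' D'].
  assert (Dg : Cderiv f a (g a)).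
  { apply (Cderiv_ext (fun z => (z - a) * g z)%C); [intros; symmetry; apply Eg|].
    eapply Cderiv_eq; [|apply (Cderiv_mult (fun z => z - a)%C g); [apply (Cderiv_minus (fun z => z) (fun _ => a)); [apply Cderiv_id|apply Cderiv_const]|exact D']].
    ring. }
  exists g. repeat split; auto. rewrite (Cderiv_unique _ _ _ _ Dg D). exact Nd.
Qed.

Lemma nonzero_near (g : C -> C) (a : C) : Ccont g a -> g a <> 0%C -> locally (a : C) (fun z => g z <> 0%C).
Proof.
  intros H N. generalize (Clim_away (locally a) g (g a) N H). apply filter_imp.
  intros z Hz. apply Cmod_gt_0. apply Cmod_gt_0 in N. lra.
Qed.

(** At a common zero both functions split off the same linear factor, and the quotients do not vanish
    there. *)
Lemma simple_zero_set_quotient f k Z : simple_zero_set f Z -> simple_zero_set k Z ->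
  exists q, Entire q /\ (forall z, q z <> 0%C) /\ (forall z, k z = f z * q z)%C.
Proof.
  intros Hf Hk.
  assert (Q : forall z, exists q : C, f z <> 0%C /\ q = (k z / f z)%C \/
     f z = 0%C /\ exists a b, Cderiv f z a /\ Cderiv k z b /\ a <> 0%C /\ b <> 0%C /\ q = (b / a)%C).
  { intros z. destruct (classic (f z = 0%C)) as [E|N].
    - destruct Hf as [_ [Zf Sf]]. destruct Hk as [_ [Zk Sk]].
      destruct (Sf z E) as [a [Da Na]]. destruct (Sk z) as [b [Db Nb]].
      { apply Zk, Zf, E. }
      exists (b / a)%C. right. split; auto. exists a, b. auto.
    - exists (k z / f z)%C. auto. }
  destruct (choice _ Q) as [q Hq]. clear Q. exists q.
  assert (ZZ : forall z, f z = 0%C <-> k z = 0%C).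
  { intros z. destruct Hf as [_ [Zf _]]. destruct Hk as [_ [Zk _]]. rewrite Zf, Zk. tauto. }
  split; [|split].
  - intros z. destruct (classic (f z = 0%C)) as [E|N].
    + destruct (simple_zero_set_factor f Z z Hf E) as [f1 [Ef1 [F1 [Nf Df]]]].
      destruct (simple_zero_set_factor k Z z Hk (proj1 (ZZ z) E)) as [k1 [Ek1 [K1 [Nk Dk]]]].
      apply (Cdiff_ext_loc (fun y => k1 y / f1 y)%C).
      * generalize (nonzero_near f1 z (Cdiff_cont _ _ (Ef1 z)) Nf). apply filter_imp.
        intros y Ny. destruct (classic (y = z)) as [->|Nyz].
        -- destruct (Hq z) as [[N _]|[_ [a [b [Da [Db [Na [Nb Eq]]]]]]]]; [contradiction|].
           rewrite Eq, (Cderiv_unique _ _ _ _ Da Df), (Cderiv_unique _ _ _ _ Db Dk). reflexivity.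
        -- pose proof (Cminus_neq _ _ Nyz) as Nm.
           destruct (Hq y) as [[N Eq]|[E0 _]].
           ++ rewrite Eq, F1, K1. field. auto.
           ++ exfalso. rewrite F1 in E0. apply (Cmult_neq_0 _ _ Nm Ny E0).
      * apply Cdiff_div; auto.
    + apply (Cdiff_ext_loc (fun y => k y / f y)%C).
      * generalize (nonzero_near f z (Cdiff_cont _ _ (proj1 Hf z)) N). apply filter_imp.
        intros y Ny. destruct (Hq y) as [[_ Eq]|[E0 _]]; [auto|contradiction].
      * apply Cdiff_div; auto; [apply (proj1 Hk)|apply (proj1 Hf)].
  - intros z. destruct (Hq z) as [[N ->]|[_ [a [b [_ [_ [Na [Nb ->]]]]]]]].
    + intros E. apply N, ZZ. replace (k z) with (k z / f z * f z)%C by (field; auto). rewrite E. ring.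
    + intros E. apply Nb. replace b with (b / a * a)%C by (field; auto). rewrite E. ring.
  - intros z. destruct (Hq z) as [[N ->]|[E _]].
    + field; auto.
    + rewrite (proj1 (ZZ z) E), E. ring.
Qed.

Lemma ex_filterdiff_cont {V W : NormedModule C_AbsRing} (F : V -> W) p :
  ex_filterdiff F (locally p) -> filterlim F (locally p) (locally (F p)).
Proof. intros H. apply (filterdiff_continuous F p H). Qed.

(** Precompose the chart with the inverse biholomorphism. *)
Lemma Sing_transfer (S1 S2 : C3 -> Prop) (F G : C3 -> C3) :
  (forall p, S1 p -> S2 (F p)) -> (forall q, S2 q -> S1 (G q)) ->
  (forall p, G (F p) = p) -> (forall q, F (G q) = q) ->
  (forall p, ex_filterdiff F (locally p)) -> (forall q, ex_filterdiff G (locally q)) ->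
  forall p, Sing S1 p -> Sing S2 (F p).
Proof.
  intros H12 H21 GF FG DF DG p [Hp [n [m [U [Phi [Hn [Hm [Hg [HU [Up [[Psi [Hinv [HPhi HPsi]]] P0]]]]]]]]]]].
  split; [apply H12; auto|].
  exists n, m, (fun q => U (G q)), (fun q => Phi (G q)).
  repeat (split; [assumption|]). split; [|split; [|split]].
  - apply (open_comp G U); auto. intros x _. apply ex_filterdiff_cont, DG.
  - rewrite GF; auto.
  - exists (fun v => F (Psi v)). destruct Hinv as [I1 [I2 [I3 I4]]]. split; [|split].
    + split; [|split; [|split]].
      * intros q [Hq HUq]. apply I1. split; [apply H21|]; auto.
      * intros q Hq. destruct (I2 q Hq) as [Sq Uq]. split; [auto|]. rewrite GF. auto.
      * intros q [Hq HUq]. rewrite I3 by (split; [apply H21|]; auto). apply FG.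
      * intros q Hq. rewrite GF. apply I4; auto.
    + intros q [Hq HUq]. destruct (HPhi (G q) (conj (H21 q Hq) HUq)) as [W [Phi' [OW [Wq [DW EW]]]]].
      exists (fun q => W (G q)), (fun q => Phi' (G q)). repeat split; auto.
      * apply (open_comp G W); auto. intros x _. apply ex_filterdiff_cont, DG.
      * intros x Hx. apply ex_filterdiff_comp'; [apply DG|apply DW; auto].
      * intros x Hx [Sx Ux]. apply EW; auto.
    + intros v Hv. destruct (HPsi v Hv) as [W [Psi' [OW [Wv [DW EW]]]]].
      exists W, (fun v => F (Psi' v)). repeat split; auto.
      * intros x Hx. apply ex_filterdiff_comp'; [apply DW; auto|apply DF].
      * intros x Hx Vx. rewrite EW; auto.
  - rewrite GF. exact P0.
Qed.

Lemma surface_pt f g x s t : surface f g (pt x s t) <-> (s * s = f x)%C /\ (t * t = g x)%C.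
Proof. unfold surface, pt. simpl. rewrite !Cmult_1_r. tauto. Qed.

Lemma surface_c f g p : surface f g p <-> (c2 p * c2 p = f (c1 p))%C /\ (c3 p * c3 p = g (c1 p))%C.
Proof. rewrite (pt_eta p) at 1. apply surface_pt. Qed.

Lemma biholomorphism_deriv t s : Entire t -> Entire s -> (forall z, s (t z) = z) ->
  forall z, ~ Cderiv t z 0.
Proof.
  intros Ht Hs E z D. destruct (Hs (t z)) as [d Dd].
  assert (A : Cderiv (fun z => s (t z)) z (d * 0)%C) by (apply (Cderiv_comp t s); auto).
  assert (B : Cderiv (fun z => s (t z)) z 1%C).
  { apply (Cderiv_ext (fun z => z)); [intros; symmetry; apply E|apply Cderiv_id]. }
  pose proof (Cderiv_unique _ _ _ _ A B) as H. rewrite Cmult_0_r in H. apply RtoC_inj in H. lra.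
Qed.

Theorem isomorphic_of_biholomorphism W A B f g h t s :
  simple_zero_set f W -> simple_zero_set g A -> simple_zero_set h B -> Entire t -> Entire s ->
  (forall z, s (t z) = z) -> (forall z, t (s z) = z) ->
  (forall z, W z <-> W (t z)) -> (forall z, A z <-> B (t z)) ->
  isomorphic (surface f g) (surface f h).
Proof.
  intros Hf Hg Hh Ht Hs st ts HW HAB.
  pose proof (biholomorphism_deriv t s Ht Hs st) as Nt.
  destruct (simple_zero_set_quotient f (fun z => f (t z)) W Hf) as [q [Eq [Nq Q]]].
  { eapply simple_zero_set_ext; [| |apply (simple_zero_set_comp f W t Hf Ht Nt)]; [reflexivity|]. intros z; symmetry; apply HW. }
  destruct (simple_zero_set_quotient g (fun z => h (t z)) A Hg) as [r [Er [Nr Rr]]].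
  { eapply simple_zero_set_ext; [| |apply (simple_zero_set_comp h B t Hh Ht Nt)]; [reflexivity|]. intros z; symmetry; apply HAB. }
  destruct (entire_sqrt q Eq Nq) as [u [Hu Eu]]. destruct (entire_sqrt r Er Nr) as [v [Hv Ev]].
  assert (Nu : forall z, u z <> 0%C) by (intros z E; apply (Nq z); rewrite <- Eu, E; ring).
  assert (Nv : forall z, v z <> 0%C) by (intros z E; apply (Nr z); rewrite <- Ev, E; ring).
  set (F := fun p : C3 => pt (t (c1 p)) (u (c1 p) * c2 p)%C (v (c1 p) * c3 p)%C).
  set (ui := fun z => (/ u (s z))%C). set (vi := fun z => (/ v (s z))%C).
  set (G := fun p : C3 => pt (s (c1 p)) (ui (c1 p) * c2 p)%C (vi (c1 p) * c3 p)%C).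
  assert (Hui : Entire ui).
  { intros z. apply (Cdiff_inv (fun z => u (s z))); auto. apply Entire_comp; auto. }
  assert (Hvi : Entire vi).
  { intros z. apply (Cdiff_inv (fun z => v (s z))); auto. apply Entire_comp; auto. }
  assert (GF : forall p, G (F p) = p).
  { intros p. apply C3_ext; unfold G, F, pt, ui, vi, c1, c2, c3; simpl; rewrite st; auto; field; auto. }
  assert (FG : forall p, F (G p) = p).
  { intros p. apply C3_ext; unfold G, F, pt, ui, vi, c1, c2, c3; simpl; [apply ts| |]; field; auto. }
  assert (S12 : forall p, surface f g p -> surface f h (F p)).
  { intros p Hp. apply surface_c in Hp. destruct Hp as [H2 H3]. apply surface_pt. split.
    - rewrite Q, <- H2, <- Eu. ring.
    - rewrite Rr, <- H3, <- Ev. ring. }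
  assert (S21 : forall p, surface f h p -> surface f g (G p)).
  { intros p Hp. apply surface_c in Hp. destruct Hp as [H2 H3]. apply surface_pt.
    specialize (Q (s (c1 p))). specialize (Rr (s (c1 p))). rewrite ts in Q, Rr.
    rewrite <- Eu in Q. rewrite <- Ev in Rr. unfold ui, vi. split.
    - replace (/ u (s (c1 p)) * c2 p * (/ u (s (c1 p)) * c2 p))%C with
        (c2 p * c2 p / (u (s (c1 p)) * u (s (c1 p))))%C by (field; auto).
      rewrite H2, Q. field; auto.
    - replace (/ v (s (c1 p)) * c3 p * (/ v (s (c1 p)) * c3 p))%C with
        (c3 p * c3 p / (v (s (c1 p)) * v (s (c1 p))))%C by (field; auto).
      rewrite H3, Rr. field; auto. }
  assert (DF : forall p : C3, ex_filterdiff F (locally p)).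
  { intros p. apply ex_filterdiff_C3.
    - apply (Cdiff3_of_x t), Ht.
    - apply Cdiff3_mult; [apply (Cdiff3_of_x u), Hu|apply Cdiff3_c2].
    - apply Cdiff3_mult; [apply (Cdiff3_of_x v), Hv|apply Cdiff3_c3]. }
  assert (DG : forall p : C3, ex_filterdiff G (locally p)).
  { intros p. apply ex_filterdiff_C3.
    - apply (Cdiff3_of_x s), Hs.
    - apply Cdiff3_mult; [apply (Cdiff3_of_x ui), Hui|apply Cdiff3_c2].
    - apply Cdiff3_mult; [apply (Cdiff3_of_x vi), Hvi|apply Cdiff3_c3]. }
  exists F. split; [|split].
  - exists G. split; [split; [|split; [|split]]; auto|split].
    + intros p _. eapply filterlim_filter_le_1; [|apply ex_filterdiff_cont, DF].
      apply filter_le_within.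
    + intros p _. eapply filterlim_filter_le_1; [|apply ex_filterdiff_cont, DG].
      apply filter_le_within.
  - intros y. split.
    + intros Hy. exists (G y). split; auto. eapply (Sing_transfer _ _ G F); eauto.
    + intros [x [Hx <-]]. eapply (Sing_transfer _ _ F G); eauto.
  - intros p Hp. exists (fun _ => True), F. split; [apply open_true|auto].
Qed.

(** * Branches of the square root and local local_cut_point points *)

(** A root of [v] whose distance to [s] is controlled by [near_root]; near [s^2] it is the branch of
    the square root through [s]. *)
Definition nearby_root (s v : C) : C := proj1_sig (constructive_indefinite_description _ (near_root s v)).

Lemma nearby_root_sq s v : (nearby_root s v * nearby_root s v = v)%C.
Proof. unfold nearby_root. destruct constructive_indefinite_description as [z [H1 H2]]. exact H1. Qed.

Lemma nearby_root_dist s v : Cmod (nearby_root s v - s) * Cmod (nearby_root s v - s) <= Cmod (v - s * s).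
Proof. unfold nearby_root. destruct constructive_indefinite_description as [z [H1 H2]]. exact H2. Qed.

Lemma nearby_root_near s v : Cmod (v - s * s) < Cmod s * Cmod s -> Cmod (nearby_root s v - s) < Cmod s.
Proof.
  intros H. pose proof (nearby_root_dist s v). pose proof (Cmod_ge_0 (nearby_root s v - s)). pose proof (Cmod_ge_0 s). nra.
Qed.

(** Both numbers lie in the disc around [s] with the origin on its boundary, hence in an open half
    plane, so their sum stays away from zero. *)
Lemma same_side (s z z' : C) : Cmod (z - s) < Cmod s -> Cmod (z' - s) < Cmod s ->
  Cmod s - Cmod (z - s) <= Cmod (z' + z).
Proof.
  intros H1 H2. pose proof (Cmod_ge_0 (z - s)).
  assert (Ns : s <> 0%C) by (apply Cmod_gt_0; lra).
  assert (Ps : 0 < Cmod s) by lra.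
  assert (R1 : forall y, Cmod s - Cmod (y - s) <= Cmod s * Re (y / s)).
  { intros y. assert (E : Re (y / s) = 1 + Re ((y - s) / s)).
    { replace (y / s)%C with (1 + (y - s) / s)%C by (field; auto). rewrite re_plus. reflexivity. }
    pose proof (re_le_Cmod ((y - s) / s)) as B. rewrite Cmod_div in B by auto.
    apply Rabs_le_between in B. rewrite E.
    assert (Cmod s * (Cmod (y - s) / Cmod s) = Cmod (y - s)) by (field; lra). nra. }
  pose proof (R1 z) as A. pose proof (R1 z') as B.
  assert (D : Cmod s * Re ((z' + z) / s) <= Cmod (z' + z)).
  { pose proof (re_le_Cmod ((z' + z) / s)) as Q. rewrite Cmod_div in Q by auto.
    apply Rabs_le_between in Q.
    replace (Cmod (z' + z)) with (Cmod s * (Cmod (z' + z) / Cmod s)) by (field; lra).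
    apply Rmult_le_compat_l; lra. }
  replace ((z' + z) / s)%C with (z' / s + z / s)%C in D by (field; auto). rewrite re_plus in D. lra.
Qed.

Lemma root_unique s z z' : (z * z = z' * z')%C -> Cmod (z - s) < Cmod s -> Cmod (z' - s) < Cmod s -> z = z'.
Proof.
  intros E H1 H2. destruct (sq_eq _ _ E) as [|N]; auto.
  pose proof (same_side s z z' H1 H2) as D. rewrite N in D at 2.
  replace (z' + - z')%C with (RtoC 0) in D by ring. rewrite Cmod_0 in D. lra.
Qed.

(** Two roots on the same side of the origin satisfy [(z' - z) (z' + z) = v' - v] with [z' + z] bounded
    below. *)
Lemma nearby_root_cont s v : Cmod (v - s * s) < Cmod s * Cmod s -> Ccont (nearby_root s) v.
Proof.
  intros H eps He. pose proof (nearby_root_near s v H) as N. set (z := nearby_root s v) in *.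
  set (k := Cmod s - Cmod (z - s)). assert (Hk : 0 < k) by (unfold k; lra).
  apply locally_Cmod. exists (Rmin (Cmod s * Cmod s - Cmod (v - s * s)) (eps * k)).
  split; [apply Rmin_pos; [lra|apply Rmult_lt_0_compat; auto]|].
  intros v' Hv'.
  pose proof (Rmin_l (Cmod s * Cmod s - Cmod (v - s * s)) (eps * k)) as m1.
  pose proof (Rmin_r (Cmod s * Cmod s - Cmod (v - s * s)) (eps * k)) as m2.
  assert (N' : Cmod (nearby_root s v' - s) < Cmod s).
  { apply nearby_root_near. pose proof (Cmod_tri3 v' v (s * s)). lra. }
  set (z' := nearby_root s v') in *.
  pose proof (same_side s z z' N N') as D. fold k in D.
  assert (E : Cmod (z' - z) * Cmod (z' + z) = Cmod (v' - v)).
  { rewrite <- Cmod_mult. replace ((z' - z) * (z' + z))%C with (z' * z' - z * z)%C by ring.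
    unfold z, z'. rewrite !nearby_root_sq. reflexivity. }
  pose proof (Cmod_ge_0 (z' - z)).
  apply Rmult_lt_reg_r with k; auto. apply Rle_lt_trans with (Cmod (z' - z) * Cmod (z' + z)).
  - apply Rmult_le_compat_l; auto.
  - lra.
Qed.

Lemma nearby_root_self s : nearby_root s (s * s)%C = s.
Proof.
  pose proof (nearby_root_dist s (s * s)%C) as H. rewrite Cmod_self in H.
  pose proof (Cmod_ge_0 (nearby_root s (s * s) - s)).
  apply NNPP. intros N. apply Cmod_minus_pos in N. nra.
Qed.

(** Removing [p] disconnects its small neighbourhoods: [psi] is locally constant off [p] and takes both
    truth values arbitrarily close to [p]. The condition only involves the topology of [S], and it
    separates the nodes from the other points. *)
Definition local_cut_point (S : C3 -> Prop) (p : C3) : Prop :=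
  exists U psi : C3 -> Prop, locally p U /\
    (forall q, S q -> U q -> q <> p -> locally q (fun q' => S q' -> (psi q' <-> psi q))) /\
    (forall V : C3 -> Prop, locally p V ->
       (exists q, S q /\ V q /\ q <> p /\ psi q) /\ (exists q, S q /\ V q /\ q <> p /\ ~ psi q)).

Lemma local_cut_point_homeo S1 S2 (F G : C3 -> C3) p : inverse_maps S1 S2 F G ->
  continuous_on_subset S1 F -> continuous_on_subset S2 G -> S1 p -> local_cut_point S1 p -> local_cut_point S2 (F p).
Proof.
  intros [I1 [I2 [I3 I4]]] CF CG Hp [U [psi [HU [Hl Hc]]]].
  exists (fun q => S2 q -> U (G q)), (fun q => psi (G q)). split; [|split].
  - pose proof (CG (F p) (I1 p Hp)) as K. rewrite I3 in K by auto. exact (K U HU).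
  - intros q Sq Uq Nq.
    assert (N : G q <> p) by (intros E; apply Nq; rewrite <- E; symmetry; apply I4; auto).
    pose proof (CG q Sq _ (Hl (G q) (I2 q Sq) (Uq Sq) N)) as K.
    unfold filtermap, within in K. revert K. apply filter_imp. intros q' H Sq'. apply H; auto.
  - intros V HV. pose proof (CF p Hp V HV) as K. unfold filtermap, within in K.
    destruct (Hc _ K) as [[q [Sq [Vq [Nq Pq]]]] [q' [Sq' [Vq' [Nq' Pq']]]]].
    assert (N : forall x, S1 x -> x <> p -> F x <> F p).
    { intros x Sx Nx E. apply Nx. rewrite <- (I3 x Sx), E. apply I3; auto. }
    split; [exists (F q)|exists (F q')]; rewrite I3 by auto; auto.
Qed.

Fixpoint geom_sum (k : C) (n : nat) : C := match n with O => 0%C | S n => (geom_sum k n + Cpow k n)%C end.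

Lemma geom_sum_eq k n : ((k - 1) * geom_sum k n = Cpow k n - 1)%C.
Proof. induction n; simpl; [ring|]. rewrite Cmult_plus_distr_l, IHn. ring. Qed.

Lemma geom_sum_1 n : geom_sum 1 n = RtoC (INR n).
Proof. induction n; [reflexivity|]. rewrite S_INR, RtoC_plus. simpl geom_sum. rewrite IHn, Cpow_1_l. reflexivity. Qed.

Lemma geom_sum_cont n k : Ccont (fun k => geom_sum k n) k.
Proof.
  induction n; simpl; [cap Clim_const|]. cap Clim_plus; [exact IHn|]. cap Clim_pow. apply Clim_id.
Qed.

(** If [k^d = 1] and [k <> 1], then the geometric sum vanishes; but at [k = 1] it equals [d]. *)
Lemma one_isolated_root_of_unity d : (1 <= d)%nat -> @locally C_UniformSpace (RtoC 1) (fun k : C => Cpow k d = 1%C -> k = 1%C).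
Proof.
  intros Hd. assert (N : geom_sum 1 d <> 0%C).
  { rewrite geom_sum_1. intros E. apply RtoC_inj in E. apply not_0_INR in E; lia. }
  generalize (nonzero_near (fun k => geom_sum k d) (RtoC 1) (geom_sum_cont d _) N). apply filter_imp.
  intros k Hk E. apply NNPP. intros N1. apply Cminus_neq in N1.
  apply (Cmult_neq_0 _ _ N1 Hk). rewrite geom_sum_eq, E. ring.
Qed.

(** The value 1 is isolated among the roots of unity, so it is taken on an open and closed set. *)
Lemma root_of_unity_locally_constant {T} (F : (T -> Prop) -> Prop) {FF : Filter F}
  (k : T -> C) (psi : T -> Prop) (l : C) d (P : Prop) : (1 <= d)%nat ->
  Clim F k l -> F (fun q => Cpow (k q) d = 1%C /\ (psi q <-> k q = 1%C)) -> (P <-> l = 1%C) ->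
  F (fun q => psi q <-> P).
Proof.
  intros Hd L H HP. destruct (classic (l = 1%C)) as [->|N].
  - pose proof (one_isolated_root_of_unity d Hd) as I. apply locally_Cmod in I. destruct I as [r [Hr I]].
    generalize (filter_and (F:=F) _ _ H (L r Hr)). apply filter_imp. intros q [[E Q] D].
    specialize (I _ D E). tauto.
  - generalize (filter_and (F:=F) _ _ H (L _ (Cmod_minus_pos _ _ N))). apply filter_imp.
    intros q [[E Q] D]. assert (k q <> 1%C); [|tauto].
    intros E1. rewrite E1, Cmod_sub_sym in D. lra.
Qed.

Lemma locally_const_segment (chi : C -> Prop) a b :
  onseg (fun z => locally z (fun y => chi y <-> chi z)) a b -> (chi a <-> chi b).
Proof.
  intros H. set (f := fun t : R => if excluded_middle_informative (chi (seg a b t)) then 1 else 0).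
  assert (E : f 0 = f 1).
  { apply (eq_is_derive f 0 1); [|lra]. intros t Ht.
    apply (is_derive_ext_loc (fun _ => f t)); [|apply (@is_derive_const R_AbsRing R_NormedModule)].
    pose proof (H t Ht) as K. apply locally_Cmod in K. destruct K as [r [Hr K]].
    generalize (seg_cont a b t r Hr). apply filter_imp. intros s Hs. specialize (K _ Hs). unfold f.
    destruct excluded_middle_informative, excluded_middle_informative; tauto. }
  unfold f in E.
  replace (seg a b 0) with a in E by (unfold seg; ring).
  replace (seg a b 1) with b in E by (unfold seg; ring).
  destruct excluded_middle_informative, excluded_middle_informative; try tauto; lra.
Qed.

(** Two points are joined by a segment, or by a broken line through a quarter turn of the first point
    when the segment passes through the origin. *)
Lemma punctured_disc_connected (chi : C -> Prop) r :
  (forall s : C, s <> 0%C -> Cmod s < r -> locally s (fun y => chi y <-> chi s)) ->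
  forall s1 s2 : C, s1 <> 0%C -> s2 <> 0%C -> Cmod s1 < r -> Cmod s2 < r -> (chi s1 <-> chi s2).
Proof.
  intros H.
  assert (Sg : forall a b, Cmod a < r -> Cmod b < r -> (forall t, 0 <= t <= 1 -> seg a b t <> 0%C) -> (chi a <-> chi b)).
  { intros a b Ha Hb N. apply locally_const_segment. intros t Ht. apply H; auto.
    apply Rle_lt_trans with (Rmax (Cmod a) (Cmod b)); [|apply Rmax_lub_lt; auto].
    replace (seg a b t) with (seg a b t - 0)%C by ring.
    apply Cmod_seg_le; auto; [replace (a - 0)%C with a by ring; apply Rmax_l|replace (b - 0)%C with b by ring; apply Rmax_r]. }
  intros s1 s2 N1 N2 H1 H2.
  destruct (classic (exists t, 0 <= t <= 1 /\ seg s1 s2 t = 0%C)) as [[t [Ht E]]|N].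
  2:{ apply Sg; auto. intros t Ht E. apply N. exists t; auto. }
  assert (Hi : Cmod (Ci * s1) < r) by (rewrite Cmod_mult, Cmod_Ci, Rmult_1_l; auto).
  transitivity (chi (Ci * s1)%C); apply Sg; auto.
  - intros u Hu E1. unfold seg in E1.
    assert (E2 : (s1 * (RtoC (1 - u) + Ci * RtoC u) = 0)%C) by (rewrite RtoC_minus, <- E1; ring).
    apply Cmult_integral_iff in E2. destruct E2 as [E2|E2]; [contradiction|].
    pose proof (f_equal fst E2) as A. pose proof (f_equal snd E2) as B. simpl in A, B. lra.
  - intros u Hu E1. unfold seg in E, E1.
    assert (E2 : (s1 * (RtoC (t * (1 - u)) * Ci - RtoC (u * (1 - t))) = 0)%C).
    { transitivity (RtoC t * (Ci * s1 + RtoC u * (s2 - Ci * s1)) - RtoC u * (s1 + RtoC t * (s2 - s1)))%C.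
      - rewrite !RtoC_mult, !RtoC_minus. ring.
      - rewrite E, E1. ring. }
    apply Cmult_integral_iff in E2. destruct E2 as [E2|E2]; [contradiction|].
    pose proof (f_equal fst E2) as A. pose proof (f_equal snd E2) as B. simpl in A, B.
    assert (T0 : t <> 0).
    { intros ->. apply N1. rewrite <- E. ring. }
    assert (u = 1) by nra. assert (t = 1) by nra. subst. apply N2. rewrite <- E. ring.
Qed.

(** A neighbourhood of the point is the image of a disc, and a punctured disc is connected. *)
Lemma not_cut_point_param (S : C3 -> Prop) (sigma : C -> C3) rho : 0 < rho ->
  (forall s : C, Cmod s < rho -> S (sigma s)) ->
  (forall s : C, Cmod s < rho -> filterlim sigma (@locally C_UniformSpace s) (locally (sigma s))) ->
  (forall s : C, s <> 0%C -> Cmod s < rho -> sigma s <> sigma 0%C) ->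
  (forall r, 0 < r -> locally (sigma 0%C) (fun q => S q -> exists s, Cmod s < r /\ sigma s = q)) ->
  ~ local_cut_point S (sigma 0%C).
Proof.
  intros Hrho HS Hc Hi Hcov [U [psi [HU [Hl Hd]]]].
  assert (H0 : Cmod 0%C < rho) by (rewrite Cmod_0; auto).
  pose proof (Hc 0%C H0 U HU) as K. apply locally_Cmod in K. destruct K as [r0 [Hr0 K]].
  set (r := Rmin r0 rho). assert (Hr : 0 < r) by (apply Rmin_pos; auto).
  assert (L1 : r <= r0) by apply Rmin_l. assert (L2 : r <= rho) by apply Rmin_r.
  destruct (Hd _ (Hcov r Hr)) as [[q1 [S1 [V1 [N1 P1]]]] [q2 [S2 [V2 [N2 P2]]]]].
  destruct (V1 S1) as [s1 [R1 <-]]. destruct (V2 S2) as [s2 [R2 <-]].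
  apply P2. apply (punctured_disc_connected (fun s => psi (sigma s)) r) with (s1 := s1); auto.
  - intros s Ns Hs. assert (Us : U (sigma s)).
    { apply K. replace (s - 0)%C with s by ring. lra. }
    pose proof (Hc s ltac:(lra) _ (Hl (sigma s) (HS s ltac:(lra)) Us (Hi s Ns ltac:(lra)))) as Q.
    unfold filtermap in Q.
    assert (B : locally s (fun y => Cmod y < rho)).
    { apply locally_Cmod. exists (rho - Cmod s). split; [lra|]. intros y Hy.
      replace y with ((y - s) + s)%C by ring. eapply Rle_lt_trans; [apply Cmod_triangle|]. lra. }
    generalize (filter_and (F:=locally s) _ _ Q B). apply filter_imp. intros y [A1 A2]. apply A1. auto.
  - intros ->. apply N1; auto.
  - intros ->. apply N2; auto.
Qed.

(** * Singular points and nodes are local local_cut_point points *)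

Lemma locally_C2 (v : C2) (P : C2 -> Prop) :
  locally v P <-> exists d, 0 < d /\ forall q : C2,
    Cmod (fst q - fst v) < d -> Cmod (snd q - snd v) < d -> P q.
Proof.
  split.
  - intros [d Hd]. exists d; split; [apply cond_pos|].
    intros q H1 H2. apply Hd. split; apply C_NormedModule_mixin_compat1; assumption.
  - intros [d [Hd H]].
    assert (Hs : 0 < sqrt 2) by (apply sqrt_lt_R0; lra).
    assert (Hp : 0 < d / sqrt 2) by (apply Rdiv_lt_0_compat; lra).
    exists (mkposreal _ Hp). intros q [B1 B2].
    assert (K : forall x y : C, ball x (d / sqrt 2) y -> Cmod (y - x) < d).
    { intros x y B. pose proof (C_NormedModule_mixin_compat2 x y (mkposreal _ Hp) B) as K.
      simpl in K. replace (sqrt 2 * (d / sqrt 2)) with d in K by (field; lra). exact K. }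
    apply H; apply K; assumption.
Qed.

Lemma holomorphic_on_continuous {V W : NormedModule C_AbsRing} (X : V -> Prop) (F : V -> W) p :
  holomorphic_on X F -> X p -> filterlim F (within X (locally p)) (locally (F p)).
Proof.
  intros H Hp P HP. destruct (H p Hp) as [U [G [OU [Up [DG EG]]]]].
  rewrite <- (EG p Up Hp) in HP.
  pose proof (ex_filterdiff_cont G p (DG p Up) P HP) as K. unfold filtermap in *; unfold within.
  generalize (filter_and (F:=locally p) _ _ K (OU p Up)). apply filter_imp.
  intros q [A B] Xq. rewrite <- EG; auto.
Qed.

Lemma primitive_root_neq_1 d : (2 <= d)%nat -> Cexp (Ci * RtoC (2 * PI / INR d)) <> (RtoC 1).
Proof.
  intros Hd E. rewrite Cexp_i in E. apply (f_equal fst) in E. simpl in E.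
  assert (D : 2 <= INR d) by (replace 2 with (INR 2) by reflexivity; apply le_INR; auto).
  pose proof PI_RGT_0 as PP.
  assert (T1 : 0 < 2 * PI / INR d) by (apply Rdiv_lt_0_compat; lra).
  assert (T2 : 2 * PI / INR d <= PI).
  { apply Rle_div_l; [lra|]. nra. }
  pose proof (cos_decreasing_1 0 (2 * PI / INR d)) as C1. rewrite cos_0 in C1. lra.
Qed.

Lemma Cpow_zero_inv (z : C) n : Cpow z n = (RtoC 0) -> z = (RtoC 0).
Proof. intros E. apply NNPP. intros N. apply (Cpow_nz z n N E). Qed.

Lemma Cpow_0_pos n : (1 <= n)%nat -> Cpow (RtoC 0) n = RtoC 0.
Proof. destruct n; [lia|intros _; simpl; ring]. Qed.

(** On the model [z^n = w^m] with [d = gcd n m >= 2], the quotient of [z^(n/d)] and [w^(m/d)] is a d-th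
    root of unity off the origin; the branch where it equals 1 is open and closed. *)
Lemma Sing_local_cut_point S p : Sing S p -> local_cut_point S p.
Proof.
  intros [Hp [n [m [U [Phi [Hn [Hm [Hg [HU [Up [[Psi [[I1 [I2 [I3 I4]]] [HPhi HPsi]]] P0]]]]]]]]]]].
  set (d := Nat.gcd n m) in *.
  destruct (Nat.gcd_divide_l n m) as [n' En]. destruct (Nat.gcd_divide_r n m) as [m' Em].
  fold d in En, Em.
  assert (Hn' : (1 <= n')%nat) by (destruct n'; [simpl in En; lia|lia]).
  assert (Hm' : (1 <= m')%nat) by (destruct m'; [simpl in Em; lia|lia]).
  exists U, (fun q => Cpow (fst (Phi q)) n' = Cpow (snd (Phi q)) m').
  split; [apply HU; auto|]. split.
  - intros q Sq Uq Nq.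
    assert (Nz : Phi q <> ((0 : C), (0 : C))).
    { intros E. apply Nq. rewrite <- (I3 q), <- (I3 p), E, P0; auto. }
    destruct (I1 q (conj Sq Uq)) as [_ [_ Vq]].
    assert (N2 : snd (Phi q) <> (RtoC 0)).
    { intros E. apply Nz. rewrite E in Vq.
      assert (E0 : Cpow (RtoC 0) m = (RtoC 0)) by (apply Cpow_0_pos; auto).
      rewrite E0 in Vq. apply Cpow_zero_inv in Vq.
      apply injective_projections; assumption. }
    pose proof (holomorphic_on_continuous _ Phi q HPhi (conj Sq Uq)) as CPhi.
    set (F := within (fun q => S q /\ U q) (locally q)) in *.
    assert (L1 : Clim F (fun q => fst (Phi q)) (fst (Phi q))).
    { intros eps He. apply (CPhi (fun v : C2 => Cmod (fst v - fst (Phi q)) < eps)).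
      apply locally_C2. exists eps; auto. }
    assert (L2 : Clim F (fun q => snd (Phi q)) (snd (Phi q))).
    { intros eps He. apply (CPhi (fun v : C2 => Cmod (snd v - snd (Phi q)) < eps)).
      apply locally_C2. exists eps; auto. }
    assert (Lk : Clim F (fun q => Cpow (fst (Phi q)) n' / Cpow (snd (Phi q)) m')%C
       (Cpow (fst (Phi q)) n' / Cpow (snd (Phi q)) m')%C).
    { cap Clim_div; [apply Cpow_nz; auto| |]; cap Clim_pow; assumption. }
    assert (Div : forall a b : C, b <> (RtoC 0) -> (a = b <-> (a / b)%C = (RtoC 1))).
    { intros a b Nb. split; [intros ->; field; auto|]. intros E.
      replace a with (a / b * b)%C by (field; auto). rewrite E; ring. }
    assert (Main : F (fun q' => Cpow (fst (Phi q')) n' = Cpow (snd (Phi q')) m' <->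
                                Cpow (fst (Phi q)) n' = Cpow (snd (Phi q)) m')).
    { apply (root_of_unity_locally_constant F _ _ _ d _ ltac:(lia) Lk).
      - assert (A1 : F (fun q' => snd (Phi q') <> (RtoC 0))).
        { generalize (Clim_away F _ _ N2 L2). apply filter_imp. intros q' H. apply Cmod_gt_0.
          apply Cmod_gt_0 in N2. lra. }
        assert (A2 : F (fun q' => S q' /\ U q')).
        { unfold F, within. apply filter_forall. auto. }
        generalize (filter_and (F:=F) _ _ A1 A2). apply filter_imp. intros q' [B1 B2]. split.
        + destruct (I1 q' B2) as [_ [_ Vq']]. pose proof (Cpow_nz _ m B1) as B3.
          unfold Cdiv. rewrite Cpow_mult_l, Cpow_inv by (apply Cpow_nz; auto).
          rewrite <- !Cpow_mult_r, <- En, <- Em, Vq'. field; auto.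
        + apply Div. apply Cpow_nz; auto.
      - apply Div. apply Cpow_nz; auto. }
    unfold F, within in Main. generalize (filter_and (F:=locally q) _ _ Main (HU q Uq)).
    apply filter_imp. intros q' [A B] Sq'. apply A. auto.
  - intros V HV.
    assert (V00 : V_model n m ((0 : C), (0 : C))) by (rewrite <- P0; apply I1; auto).
    pose proof (holomorphic_on_continuous _ Psi _ HPsi V00) as CPsi.
    assert (EP : Psi ((0 : C), (0 : C)) = p) by (rewrite <- P0; apply I3; auto).
    rewrite EP in CPsi. specialize (CPsi V HV). unfold filtermap, within in CPsi.
    apply locally_C2 in CPsi. destruct CPsi as [r0 [Hr0 K]]. simpl in K.
    set (r := Rmin (1/2) (r0 / 2)).
    assert (R0 : 0 < r) by (apply Rmin_pos; lra).
    assert (R1 : r <= 1/2) by apply Rmin_l. assert (R2 : r <= r0/2) by apply Rmin_r.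
    assert (Rk : forall k, (1 <= k)%nat -> Cmod (Cpow (RtoC r) k) <= r).
    { intros k Hk. rewrite Cmod_pow, Cmod_R, Rabs_pos_eq by lra. destruct k; [lia|]. simpl.
      assert (r ^ k <= 1). { rewrite <- (pow1 k). apply pow_incr. lra. }
      nra. }
    assert (Nr : RtoC r <> (RtoC 0)) by (intros E; apply RtoC_inj in E; lra).
    (* a primitive n-th root of unity moves (r^m', r^n') to the other branch *)
    set (om := Cexp (Ci * RtoC (2 * PI / INR n))).
    assert (Om : Cmod om = 1) by apply Cmod_Cexp_i.
    assert (Nom : om <> (RtoC 0)) by apply Cexp_neq_0.
    assert (In0 : INR n <> 0) by (apply not_0_INR; lia).
    assert (Id0 : INR d <> 0) by (apply not_0_INR; lia).
    assert (In'0 : INR n' <> 0) by (apply not_0_INR; lia).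
    assert (On : Cpow om n = (RtoC 1)).
    { unfold om. rewrite Cexp_pow. 
      replace (RtoC (INR n) * (Ci * RtoC (2 * PI / INR n)))%C with (Ci * (RtoC (INR n) * RtoC (2 * PI / INR n)))%C by ring.
      rewrite <- RtoC_mult. replace (INR n * (2 * PI / INR n)) with (2 * PI) by (field; auto). apply Cexp_2PI. }
    assert (On' : Cpow om n' <> (RtoC 1)).
    { unfold om. rewrite Cexp_pow.
      replace (RtoC (INR n') * (Ci * RtoC (2 * PI / INR n)))%C with (Ci * (RtoC (INR n') * RtoC (2 * PI / INR n)))%C by ring.
      rewrite <- RtoC_mult. replace (INR n' * (2 * PI / INR n)) with (2 * PI / INR d).
      - apply primitive_root_neq_1; auto.
      - rewrite En, mult_INR. field; auto. }
    assert (Z0 : forall z : C, (z - 0)%C = z) by (intros; ring).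
    assert (W : forall x, Cmod x = 1 -> Cpow x n = (RtoC 1) ->
       let v := ((x * Cpow (RtoC r) m')%C, Cpow (RtoC r) n') : C2 in
       S (Psi v) /\ V (Psi v) /\ Psi v <> p /\ Phi (Psi v) = v).
    { intros x Hx Hxn v.
      assert (M1 : Cmod (fst v) <= r).
      { simpl. rewrite Cmod_mult, Hx, Rmult_1_l. apply Rk; auto. }
      assert (M2 : Cmod (snd v) <= r) by (apply Rk; auto).
      assert (Vv : V_model n m v).
      { split; [lra|]. split; [lra|]. unfold v; simpl fst; simpl snd.
        rewrite Cpow_mult_l, Hxn, <- !Cpow_mult_r. rewrite Cmult_1_l. f_equal. 
        rewrite En, Em. lia. }
      assert (Pv : Phi (Psi v) = v) by (apply I4; auto).
      split; [apply I2; auto|]. split.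
      { apply K; auto; rewrite Z0.
        - eapply Rle_lt_trans; [exact M1|lra].
        - eapply Rle_lt_trans; [exact M2|lra]. }
      split; auto.
      intros E. rewrite E, P0 in Pv. apply (f_equal snd) in Pv. simpl in Pv.
      symmetry in Pv. apply Cpow_zero_inv in Pv. contradiction. }
    split.
    + destruct (W (RtoC 1)) as [A [B [D E]]]; [apply Cmod_1|apply Cpow_1_l|].
      eexists; repeat split; eauto. rewrite E; simpl.
      rewrite Cmult_1_l, <- !Cpow_mult_r. f_equal. lia.
    + destruct (W om) as [A [B [D E]]]; auto.
      eexists; repeat split; eauto. rewrite E; simpl.
      rewrite Cpow_mult_l, <- !Cpow_mult_r. rewrite (Nat.mul_comm m' n').
      intros E2. apply On'. pose proof (Cpow_nz _ (n' * m') Nr) as N.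
      replace (Cpow om n') with ((Cpow om n' * Cpow (RtoC r) (n' * m')) / Cpow (RtoC r) (n' * m'))%C by (field; auto).
      rewrite E2. field; auto.
Qed.

Lemma Clim_within {T} (F : (T -> Prop) -> Prop) {FF : Filter F} D f l : Clim F f l -> Clim (within D F) f l.
Proof. intros H eps He. unfold within. generalize (H eps He). apply filter_imp. auto. Qed.

(** Near [a] the quotient [g/f] extends continuously without zeros, so it has a square root [r], and
    [z3 = r z2] or [z3 = - r z2]; these are the two branches. *)
Lemma surface_node_local_cut_point f g W A a : simple_zero_set f W -> simple_zero_set g A -> f a = (RtoC 0) -> g a = (RtoC 0) ->
  local_cut_point (surface f g) (pt a 0 0).
Proof.
  intros Hf Hg Fa Ga.
  destruct (simple_zero_set_factor f W a Hf Fa) as [f1 [Ef1 [F1 [Nf _]]]].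
  destruct (simple_zero_set_factor g A a Hg Ga) as [g1 [Eg1 [G1 [Ng _]]]].
  set (ka := fun x => (g1 x / f1 x)%C).
  assert (Nka : ka a <> (RtoC 0)).
  { unfold ka, Cdiv. apply Cmult_neq_0; auto. intros E. apply Nf.
    replace (f1 a) with (f1 a * f1 a * / f1 a)%C by (field; auto). rewrite E; ring. }
  destruct (Csqrt_exists (ka a)) as [s0 Hs0].
  assert (Ns0 : s0 <> (RtoC 0)) by (intros ->; apply Nka; rewrite <- Hs0; ring).
  assert (Ms0 : Cmod s0 * Cmod s0 = Cmod (ka a)) by (rewrite <- Cmod_mult, Hs0; reflexivity).
  set (U := fun x => f1 x <> (RtoC 0) /\ Cmod (ka x - ka a) < Cmod (ka a)).
  assert (Kc : forall x, f1 x <> (RtoC 0) -> Ccont ka x).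
  { intros x N. apply Cdiff_cont, Cdiff_div; auto. }
  assert (HU : locally a U).
  { apply filter_and; [apply nonzero_near; auto; apply Cdiff_cont, Ef1|].
    apply Kc; auto. apply Cmod_gt_0; auto. }
  set (r := fun x => nearby_root s0 (ka x)).
  assert (Rc : forall x, U x -> Ccont r x).
  { intros x [N Hx]. unfold r. cap (Clim_comp _ ka (nearby_root s0) (ka x)); [apply Kc; auto|].
    apply nearby_root_cont. rewrite Hs0, Ms0. exact Hx. }
  assert (Rsq : forall x, (r x * r x = ka x)%C) by (intros; apply nearby_root_sq).
  assert (Rn : forall x, U x -> r x <> (RtoC 0)).
  { intros x [N Hx] E. specialize (Rsq x). rewrite E in Rsq.
    rewrite <- Rsq, Cmult_0_l in Hx. replace (0 - ka a)%C with (- ka a)%C in Hx by ring.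
    rewrite Cmod_opp in Hx. lra. }
  assert (Hsurf : forall q, surface f g q -> U (c1 q) -> c1 q <> a ->
     c2 q <> (RtoC 0) /\ (c3 q * c3 q = (r (c1 q) * c2 q) * (r (c1 q) * c2 q))%C).
  { intros q Hq [N Hx] Nq. apply surface_c in Hq. destruct Hq as [H2 H3].
    split.
    - intros E. rewrite E, F1 in H2. apply (Cmult_neq_0 (c1 q - a) (f1 (c1 q))); auto.
      + apply Cminus_neq; auto.
      + rewrite <- H2; ring.
    - replace (r (c1 q) * c2 q * (r (c1 q) * c2 q))%C with ((r (c1 q) * r (c1 q)) * (c2 q * c2 q))%C by ring.
      rewrite Rsq, H2, H3, F1, G1. unfold ka. field; auto. }
  assert (Npt : forall q, surface f g q -> q <> pt a 0 0 -> c1 q <> a).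
  { intros q Hq Nq E. apply Nq. apply surface_c in Hq. destruct Hq as [H2 H3]. rewrite E in H2, H3.
    rewrite Fa in H2. rewrite Ga in H3. apply Cmult_integral_iff in H2, H3.
    apply C3_ext; unfold pt, c1, c2, c3; simpl; [exact E| |].
    - destruct H2; auto. - destruct H3; auto. }
  exists (fun q => U (c1 q)), (fun q => c3 q = (r (c1 q) * c2 q)%C). split; [|split].
  - pose proof (Clim_c1 (pt a 0 0)) as K. apply locally_Cmod in HU. destruct HU as [e [He HU]].
    generalize (K e He). apply filter_imp. intros q Hq. apply HU, Hq.
  - intros q Sq Uq Nq. pose proof (Npt q Sq Nq) as Nx. destruct (Hsurf q Sq Uq Nx) as [N2 E3].
    assert (Nrq : (r (c1 q) * c2 q)%C <> (RtoC 0)) by (apply Cmult_neq_0; auto).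
    assert (Lr : Clim (@locally C3 q) (fun q => r (c1 q)) (r (c1 q))).
    { cap (Clim_comp _ c1 r (c1 q)); [apply Clim_c1|apply Rc; auto]. }
    assert (Lk : Clim (@locally C3 q) (fun q => c3 q / (r (c1 q) * c2 q))%C (c3 q / (r (c1 q) * c2 q))%C).
    { cap Clim_div; [exact Nrq|apply Clim_c3|]. cap Clim_mult; [exact Lr|apply Clim_c2]. }
    assert (Div : forall a b : C, b <> (RtoC 0) -> (a = b <-> (a / b)%C = (RtoC 1))).
    { intros u b Nb. split; [intros ->; field; auto|]. intros E.
      replace u with (u / b * b)%C by (field; auto). rewrite E; ring. }
    assert (NU : locally q (fun q' : C3 => U (c1 q') /\ c1 q' <> a)).
    { assert (B1 : locally (c1 q) (fun x => U x /\ x <> a)).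
      { destruct Uq as [Uq1 Uq2].
        assert (B0 : locally (c1 q) (fun x => Cmod (ka x - ka (c1 q)) < Cmod (ka a) - Cmod (ka (c1 q) - ka a))) by (apply Kc; auto; lra).
        pose proof (nonzero_near f1 (c1 q) (Cdiff_cont _ _ (Ef1 _)) Uq1) as B2.
        assert (B3 : locally (c1 q) (fun x => x <> a)).
        { apply locally_Cmod. exists (Cmod (c1 q - a)). split; [apply Cmod_minus_pos; auto|].
          intros y Hy ->. rewrite Cmod_sub_sym in Hy. lra. }
        generalize (filter_and (F:=locally (c1 q)) _ _ B0 (filter_and (F:=locally (c1 q)) _ _ B2 B3)).
        apply filter_imp. intros x [D1 [D2 D3]]. repeat split; auto.
        pose proof (Cmod_tri3 (ka x) (ka (c1 q)) (ka a)). lra. }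
      apply locally_Cmod in B1. destruct B1 as [e [He B1]].
      generalize (Clim_c1 q e He). apply filter_imp. intros q' Hq'. apply B1, Hq'. }
    assert (Main : within (surface f g) (@locally C3 q) (fun q' => c3 q' = (r (c1 q') * c2 q')%C <-> c3 q = (r (c1 q) * c2 q)%C)).
    { apply (root_of_unity_locally_constant (within (surface f g) (@locally C3 q)) (fun q => c3 q / (r (c1 q) * c2 q))%C _ _ 2 _ ltac:(lia) (Clim_within (@locally C3 q) _ _ _ Lk)).
      - unfold within. revert NU. apply filter_imp. intros q' [A1 A2] Sq'.
        destruct (Hsurf q' Sq' A1 A2) as [N2' E3'].
        assert (N' : (r (c1 q') * c2 q')%C <> (RtoC 0)) by (apply Cmult_neq_0; auto).
        split; [|apply Div; auto]. simpl.
        replace (c3 q' / (r (c1 q') * c2 q') * (c3 q' / (r (c1 q') * c2 q') * 1))%C with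
          ((c3 q' * c3 q') / ((r (c1 q') * c2 q') * (r (c1 q') * c2 q')))%C by (field; split; auto).
        rewrite E3'. field; split; auto.
      - apply Div; auto. }
    exact Main.
  - intros V HV. apply locally_C3 in HV. destruct HV as [e [He HV]].
    unfold pt at 1 2 3 in HV. unfold c1 at 2, c2 at 2, c3 at 2 in HV. simpl in HV.
    assert (Z0 : forall z : C, (z - 0)%C = z) by (intros; ring).
    pose proof (Cdiff_cont _ _ (proj1 Hf a)) as Cf. pose proof (Cdiff_cont _ _ (proj1 Hg a)) as Cg.
    rewrite Fa in Cf. rewrite Ga in Cg.
    assert (e2 : 0 < e * e) by nra.
    pose proof (filter_and (F:=locally a) _ _ HU (filter_and (F:=locally a) _ _ (Cf _ e2) (Cg _ e2))) as Q.
    apply locally_Cmod in Q. destruct Q as [dl [Hdl Q]].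
    set (et := Rmin (dl / 2) (e / 2)).
    assert (E0 : 0 < et) by (apply Rmin_pos; lra).
    assert (E1 : et <= dl / 2) by apply Rmin_l. assert (E2 : et <= e / 2) by apply Rmin_r.
    set (x := (a + RtoC et)%C).
    assert (Dx : Cmod (x - a) = et).
    { unfold x. replace (a + et - a)%C with (RtoC et) by ring. rewrite Cmod_R, Rabs_pos_eq; lra. }
    destruct (Q x ltac:(lra)) as [Ux [Hfx Hgx]]. rewrite !Z0 in Hfx, Hgx.
    assert (Nx : x <> a). { intros E. rewrite E, Cmod_self in Dx. lra. }
    destruct (Csqrt_exists (f x)) as [z Hz].
    assert (Small : forall y v, (y * y = v)%C -> Cmod v < e * e -> Cmod y < e).
    { intros y v Ey Hv. rewrite <- Ey, Cmod_mult in Hv. pose proof (Cmod_ge_0 y). nra. }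
    assert (Nz : z <> (RtoC 0)).
    { intros E. rewrite E, F1 in Hz. apply (Cmult_neq_0 (x - a) (f1 x)); [apply Cminus_neq; auto|apply Ux|].
      rewrite <- Hz. ring. }
    assert (Pts : forall t, (t * t = (r x * z) * (r x * z))%C ->
       surface f g (pt x z t) /\ V (pt x z t) /\ pt x z t <> pt a 0 0).
    { intros t Ht.
      assert (Tg : (t * t = g x)%C).
      { rewrite Ht. replace (r x * z * (r x * z))%C with ((r x * r x) * (z * z))%C by ring.
        rewrite Rsq, Hz, F1, G1. unfold ka. field. apply Ux. }
      split; [apply surface_pt; auto|]. split.
      - apply HV; unfold pt, c1, c2, c3; simpl; rewrite ?Z0; eauto. lra.
      - intros E. apply Nx. apply (f_equal c1) in E. exact E. }
    split.
    + destruct (Pts (r x * z)%C eq_refl) as [A1 [A2 A3]]. exists (pt x z (r x * z)%C). repeat split; auto; apply A1.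
    + destruct (Pts (- (r x * z))%C ltac:(ring)) as [A1 [A2 A3]]. exists (pt x z (- (r x * z))%C).
      repeat split; auto; try apply A1. unfold pt, c1, c2, c3; simpl. intros E.
      assert (N : (r x * z)%C <> (RtoC 0)) by (apply Cmult_neq_0; auto).
      apply N. apply Cmod_eq_0. 
      assert (E' : (RtoC 2 * (r x * z) = 0)%C).
      { replace (RtoC 2 * (r x * z))%C with ((r x * z) - (- (r x * z)))%C by ring. rewrite E. ring. }
      apply (f_equal Cmod) in E'. rewrite Cmod_mult, Cmod_0, Cmod_R, Rabs_pos_eq in E' by lra. lra.
Qed.

(** * Other points are not local local_cut_point points *)

Lemma nearby_root_branch (g : C -> C) (x0 t : C) : Entire g -> (t * t = g x0)%C -> t <> (RtoC 0) ->
  exists r, 0 < r /\ forall x, Cmod (x - x0) < r ->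
    Ccont (fun x => nearby_root t (g x)) x /\ Cmod (nearby_root t (g x) - t) < Cmod t.
Proof.
  intros Hg Ht Nt. assert (P : 0 < Cmod t * Cmod t) by (apply Cmod_gt_0 in Nt; nra).
  destruct (Ccont_loc g x0 _ P (Cdiff_cont _ _ (Hg x0))) as [r [Hr H]].
  exists r. split; auto. intros x Hx. specialize (H x Hx). rewrite <- Ht in H. split.
  - cap (Clim_comp _ g (nearby_root t) (g x)); [apply Cdiff_cont, Hg|]. apply nearby_root_cont. exact H.
  - apply nearby_root_near. exact H.
Qed.

Lemma Ccont_shift (g : C -> C) x0 s : Ccont g (x0 + s)%C -> Ccont (fun s => g (x0 + s)%C) s.
Proof.
  intros H. cap (Clim_comp _ (fun s => x0 + s)%C g (x0 + s)%C); [|exact H].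
  cap Clim_plus; [cap Clim_const|apply Clim_id].
Qed.

Lemma Cmod_shift x0 s : Cmod (x0 + s - x0) = Cmod s.
Proof. f_equal. ring. Qed.

Lemma Cadd_0 (x : C) : (x + 0)%C = x.
Proof. ring. Qed.

Lemma c1_pt x s t : c1 (pt x s t) = x. Proof. reflexivity. Qed.
Lemma c2_pt x s t : c2 (pt x s t) = s. Proof. reflexivity. Qed.
Lemma c3_pt x s t : c3 (pt x s t) = t. Proof. reflexivity. Qed.

Section Noncut.
Variables (f g : C -> C) (W A : C -> Prop).
Hypothesis Hf : simple_zero_set f W.
Hypothesis Hg : simple_zero_set g A.

(** The coordinate [x] is a local parameter. *)
Lemma not_cut_point_unramified x0 z t : (z * z = f x0)%C -> (t * t = g x0)%C ->
  z <> (RtoC 0) -> t <> (RtoC 0) -> ~ local_cut_point (surface f g) (pt x0 z t).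
Proof.
  intros Hz Ht Nz Nt.
  destruct (nearby_root_branch f x0 z (proj1 Hf) Hz Nz) as [r1 [R1 B1]].
  destruct (nearby_root_branch g x0 t (proj1 Hg) Ht Nt) as [r2 [R2 B2]].
  set (sg0 := fun s : C => pt (x0 + s)%C (nearby_root z (f (x0 + s)%C)) (nearby_root t (g (x0 + s)%C))).
  assert (E0 : sg0 (RtoC 0) = pt x0 z t).
  { unfold sg0. rewrite !Cadd_0, <- Hz, <- Ht, !nearby_root_self. reflexivity. }
  rewrite <- E0. 
  pose proof (Rmin_l r1 r2) as M1. pose proof (Rmin_r r1 r2) as M2.
  apply (not_cut_point_param _ sg0 (Rmin r1 r2)); [apply Rmin_pos; auto| | | |].
  - intros s _. apply surface_pt. split; apply nearby_root_sq.
  - intros s Hs. apply filterlim_C3; [exact _|]. split; [|split].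
    + change (Ccont (fun s => x0 + s)%C s). cap Clim_plus; [cap Clim_const|apply Clim_id].
    + apply (Ccont_shift (fun x => nearby_root z (f x))). apply B1. rewrite Cmod_shift. lra.
    + apply (Ccont_shift (fun x => nearby_root t (g x))). apply B2. rewrite Cmod_shift. lra.
  - intros s Ns _ E. apply Ns. apply (f_equal c1) in E. unfold sg0, pt, c1 in E; simpl in E.
    replace s with ((x0 + s) - x0)%C by ring. rewrite E. ring.
  - intros r Hr. rewrite E0. apply locally_C3.
    apply Cmod_gt_0 in Nz as Pz. apply Cmod_gt_0 in Nt as Pt.
    exists (Rmin (Rmin r (Rmin r1 r2)) (Rmin (Cmod z) (Cmod t))).
    split; [repeat apply Rmin_pos; auto|]. intros q H1 H2 H3 Sq.
    assert (L : forall a b c d : R, Rmin (Rmin a b) (Rmin c d) <= a /\ Rmin (Rmin a b) (Rmin c d) <= b /\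
      Rmin (Rmin a b) (Rmin c d) <= c /\ Rmin (Rmin a b) (Rmin c d) <= d).
    { intros. unfold Rmin. repeat destruct Rle_dec; lra. }
    destruct (L r (Rmin r1 r2) (Cmod z) (Cmod t)) as [L1 [L2 [L3 L4]]].
    rewrite c1_pt in H1. rewrite c2_pt in H2. rewrite c3_pt in H3.
    apply surface_c in Sq. destruct Sq as [S2 S3].
    exists (c1 q - x0)%C. split; [lra|].
    assert (Ex : (x0 + (c1 q - x0))%C = c1 q) by ring.
    apply C3_ext; unfold sg0; rewrite Ex, ?c1_pt, ?c2_pt, ?c3_pt; auto.
    + apply (root_unique z); [rewrite nearby_root_sq; auto| |lra]. apply B1. lra.
    + apply (root_unique t); [rewrite nearby_root_sq; auto| |lra]. apply B2. lra.
Qed.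

(** A square root of [x - x0] is a local parameter. *)
Lemma not_cut_point_ramified x0 t : f x0 = (RtoC 0) -> (t * t = g x0)%C -> t <> (RtoC 0) ->
  ~ local_cut_point (surface f g) (pt x0 0 t).
Proof.
  intros Fx Ht Nt. destruct (simple_zero_set_factor f W x0 Hf Fx) as [f1 [Ef1 [F1 [Nf _]]]].
  destruct (Csqrt_exists (f1 x0)) as [e Hee].
  assert (Ne : e <> (RtoC 0)) by (intros ->; apply Nf; rewrite <- Hee; ring).
  destruct (nearby_root_branch f1 x0 e Ef1 Hee Ne) as [r1 [R1 B1]].
  destruct (nearby_root_branch g x0 t (proj1 Hg) Ht Nt) as [r2 [R2 B2]].
  set (sg0 := fun s : C => pt (x0 + s * s)%C (s * nearby_root e (f1 (x0 + s * s)))%C (nearby_root t (g (x0 + s * s)%C))).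
  assert (E0 : sg0 (RtoC 0) = pt x0 0 t).
  { unfold sg0. replace (x0 + 0 * 0)%C with x0 by ring. rewrite <- Ht, !nearby_root_self. f_equal. ring. }
  rewrite <- E0. set (rr := Rmin 1 (Rmin r1 r2)).
  assert (Hrr : 0 < rr) by (repeat apply Rmin_pos; lra).
  assert (L1 : rr <= 1) by apply Rmin_l. 
  assert (L2 : rr <= r1) by (eapply Rle_trans; [apply Rmin_r|apply Rmin_l]).
  assert (L3 : rr <= r2) by (eapply Rle_trans; [apply Rmin_r|apply Rmin_r]).
  assert (Sq : forall s : C, Cmod s < rr -> Cmod (s * s) < rr).
  { intros s Hs. rewrite Cmod_mult. pose proof (Cmod_ge_0 s). nra. }
  assert (Csq : forall (k : C -> C) s, Ccont k (x0 + s * s)%C -> Ccont (fun s => k (x0 + s * s)%C) s).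
  { intros k s Hk. cap (Clim_comp _ (fun s => x0 + s * s)%C k (x0 + s * s)%C); [|exact Hk].
    cap Clim_plus; [cap Clim_const|cap Clim_mult; apply Clim_id]. }
  apply (not_cut_point_param _ sg0 rr); auto.
  - intros s _. apply surface_pt. split; [|apply nearby_root_sq].
    replace (s * nearby_root e (f1 (x0 + s * s)) * (s * nearby_root e (f1 (x0 + s * s))))%C with
      (s * s * (nearby_root e (f1 (x0 + s * s)) * nearby_root e (f1 (x0 + s * s))))%C by ring.
    rewrite nearby_root_sq, F1. ring.
  - intros s Hs. specialize (Sq s Hs). apply filterlim_C3; [exact _|]. split; [|split].
    + change (Ccont (fun s => x0 + s * s)%C s). cap Clim_plus; [cap Clim_const|cap Clim_mult; apply Clim_id].
    + change (Ccont (fun s => s * nearby_root e (f1 (x0 + s * s)))%C s). cap Clim_mult; [apply Clim_id|].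
      apply (Csq (fun x => nearby_root e (f1 x))). apply B1. rewrite Cmod_shift. lra.
    + apply (Csq (fun x => nearby_root t (g x))). apply B2. rewrite Cmod_shift. lra.
  - intros s Ns _ E. apply (f_equal c1) in E. unfold sg0, pt, c1 in E; simpl in E.
    apply (Cmult_neq_0 s s Ns Ns).
    replace (s * s)%C with ((x0 + s * s) - x0)%C by ring. rewrite E. ring.
  - intros r Hr. rewrite E0. apply locally_C3. apply Cmod_gt_0 in Nt as Pt.
    exists (Rmin (Rmin (r * r) rr) (Cmod t)).
    split; [repeat apply Rmin_pos; auto; nra|]. intros q H1 H2 H3 Hq.
    pose proof (Rmin_l (Rmin (r * r) rr) (Cmod t)). pose proof (Rmin_r (Rmin (r * r) rr) (Cmod t)).
    pose proof (Rmin_l (r * r) rr). pose proof (Rmin_r (r * r) rr).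
    rewrite c1_pt in H1. rewrite c3_pt in H3.
    apply surface_c in Hq. destruct Hq as [S2 S3].
    destruct (Csqrt_exists (c1 q - x0)%C) as [s Hs].
    assert (Ms : Cmod s < r).
    { rewrite <- Hs, Cmod_mult in H1. pose proof (Cmod_ge_0 s). nra. }
    assert (Ex : (x0 + s * s)%C = c1 q) by (rewrite Hs; ring).
    assert (E3 : nearby_root t (g (c1 q)) = c3 q).
    { apply (root_unique t); [rewrite nearby_root_sq; auto| |lra]. apply B2. lra. }
    assert (E2 : (s * nearby_root e (f1 (c1 q)) * (s * nearby_root e (f1 (c1 q))) = c2 q * c2 q)%C).
    { replace (s * nearby_root e (f1 (c1 q)) * (s * nearby_root e (f1 (c1 q))))%C with
        (s * s * (nearby_root e (f1 (c1 q)) * nearby_root e (f1 (c1 q))))%C by ring.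
      rewrite nearby_root_sq, S2, F1, Hs. reflexivity. }
    destruct (sq_eq _ _ E2) as [E|E].
    + exists s. split; auto. unfold sg0. rewrite Ex, E, E3. symmetry. apply pt_eta.
    + exists (- s)%C. rewrite Cmod_opp. split; auto. unfold sg0.
      replace (- s * - s)%C with (s * s)%C by ring. rewrite Ex, E3.
      replace (- s * nearby_root e (f1 (c1 q)))%C with (- (s * nearby_root e (f1 (c1 q))))%C by ring. rewrite E.
      replace (- - c2 q)%C with (c2 q) by ring. symmetry. apply pt_eta.
Qed.

Lemma surface_not_cut_point p : surface f g p -> ~ A (c1 p) -> ~ local_cut_point (surface f g) p.
Proof.
  intros Sp NA. apply surface_c in Sp. destruct Sp as [S2 S3].
  assert (Nt : c3 p <> (RtoC 0)).
  { intros E. apply NA. apply Hg. rewrite <- S3, E. ring. }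
  rewrite (pt_eta p). destruct (classic (c2 p = (RtoC 0))) as [E|N].
  - rewrite E in *. apply not_cut_point_ramified; auto. rewrite <- S2. ring.
  - apply not_cut_point_unramified; auto.
Qed.
End Noncut.

(** * Totally ramified correspondences *)

Lemma Cderiv_shift_pow a n z : Cderiv (fun x => Cpow (x - a) n) z (RtoC (INR n) * Cpow (z - a) (pred n))%C.
Proof.
  induction n.
  - simpl. eapply Cderiv_eq; [|apply Cderiv_const]. ring.
  - eapply Cderiv_eq.
    2:{ apply (Cderiv_mult (fun x => x - a)%C (fun x => Cpow (x - a) n)); [|exact IHn].
        apply (Cderiv_minus (fun x => x) (fun _ => a)); [apply Cderiv_id|apply Cderiv_const]. }
    rewrite S_INR, RtoC_plus. destruct n; simpl; ring.
Qed.

(** Used to compare the polynomials [x |-> Q x c] for different [c], whose quotients tend to one. *)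
Lemma leading_term_perturb f g m k : leading_term f m k ->
  (forall eps, 0 < eps -> at_infinity (fun z => Cmod (g z - f z) <= eps * Cmod (f z))) -> leading_term g m k.
Proof.
  intros [Nk L] H. split; auto. intros eps He.
  pose proof (Cmod_ge_0 k) as Pk.
  assert (E1 : 0 < Rmin 1 (eps / 2)) by (apply Rmin_pos; lra).
  assert (E2 : 0 < eps / 2 / (Cmod k + 1)) by (apply Rdiv_lt_0_compat; lra).
  generalize (at_infinity_and _ _ (L _ E1) (H _ E2)). apply at_infinity_imp. intros z [A B].
  pose proof (Rmin_l 1 (eps / 2)) as M1. pose proof (Rmin_r 1 (eps / 2)) as M2.
  set (q := Cmod z ^ m) in *. assert (Q : 0 <= q) by (apply pow_le, Cmod_ge_0).
  assert (Fz : Cmod (f z) <= (Cmod k + 1) * q).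
  { replace (f z) with ((f z - k * z ^ m) + k * z ^ m)%C by ring.
    eapply Rle_trans; [apply Cmod_triangle|]. rewrite Cmod_mult, Cmod_pow. fold q.
    assert (Rmin 1 (eps / 2) * q <= 1 * q) by (apply Rmult_le_compat_r; auto). lra. }
  replace (g z - k * z ^ m)%C with ((g z - f z) + (f z - k * z ^ m))%C by ring.
  eapply Rle_trans; [apply Cmod_triangle|].
  assert (Cmod (g z - f z) <= eps / 2 * q).
  { eapply Rle_trans; [exact B|].
    apply Rle_trans with (eps / 2 / (Cmod k + 1) * ((Cmod k + 1) * q)); [apply Rmult_le_compat_l; lra|].
    right. field. lra. }
  assert (Rmin 1 (eps / 2) * q <= eps / 2 * q) by (apply Rmult_le_compat_r; auto). lra.
Qed.

(** These are the points where the interpolated polynomial below may have a multiple root. *)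
Lemma power_gap_bounded k : (2 <= k)%nat ->
  at_infinity (fun u => (Cpow u k - 1 - Cpow (u - 1) k)%C <> (RtoC 0)).
Proof.
  intros Hk. set (th := fun u => (Cpow u k - 1 - Cpow (u - 1) k)%C).
  assert (G1 : forall n, poly_growth n (fun u => Cpow u n)).
  { intros n. apply (poly_growth_intro _ _ 1); [lra|]. exists 0. intros z _. rewrite Cmod_pow. lra. }
  assert (G2 : forall n, poly_growth n (fun u => Cpow (u - 1) n)).
  { intros n. apply (poly_growth_intro _ _ (2 ^ n)); [apply pow_le; lra|]. exists 1. intros z Hz.
    rewrite Cmod_pow, <- Rpow_mult_distr. apply pow_incr. split; [apply Cmod_ge_0|].
    eapply Rle_trans; [apply Cmod_triangle|]. rewrite Cmod_opp, Cmod_1. lra. }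
  assert (Eth : Entire th).
  { apply Entire_minus; [apply Entire_minus|]; [apply Entire_pow, Entire_id|apply Entire_const|].
    apply Entire_pow. apply Entire_minus; [apply Entire_id|apply Entire_const]. }
  assert (Gth : poly_growth k th).
  { apply (poly_growth_ext _ (fun u => (Cpow u k + (- (1))) + (- (1)) * Cpow (u - 1) k)%C); [intros; unfold th; ring|].
    apply poly_growth_plus; [apply poly_growth_plus; [apply G1|]|].
    - apply (poly_growth_le 0); [lia|apply poly_growth_const].
    - apply (poly_growth_mult 0 k); [apply poly_growth_const|apply G2]. }
  destruct (leading_term_exists k th Eth Gth) as [Z|[m [c L]]]; [|exact (leading_term_nonzero _ _ _ L)].
  exfalso. specialize (Z (RtoC 2)). unfold th in Z.
  replace (RtoC 2 - 1)%C with (RtoC 1) in Z by (rewrite <- RtoC_minus; f_equal; ring).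
  rewrite Cpow_1_l, <- RtoC_pow, <- !RtoC_minus in Z. apply RtoC_inj in Z.
  assert (4 <= 2 ^ k).
  { replace 4 with (2 ^ 2) by ring. apply Rle_pow; [lra|auto]. }
  lra.
Qed.

(** For every [c] the function [x |-> Q x c] has the same leading term [k x^m]. At [c = b1] and
    [c = b2] it has a single root, so it is [k (x - a1)^m] and [k (x - a2)^m]; since [Q] is a monic
    quadratic in [c], this determines it. In normalized coordinates
    [Q = (1 - s) u^m + s (u - 1)^m + s (s - 1)]. If [m >= 3], then for large [s] all roots are simple,
    because a multiple root satisfies [u^(m-1) = s] and [power_gap_bounded]; that makes at least three
    of them. If [m = 1], the values at [a1] and [a2] contradict each other. For [m = 2] the
    discriminant vanishes. *)
Lemma ramified_correspondence (al be : C -> C) n (a1 a2 b1 b2 : C) (Good : C -> Prop) :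
  let Q x c := (c * c - c * al x + be x)%C in
  Entire al -> Entire be -> poly_growth n al -> poly_growth n be -> a1 <> a2 -> b1 <> b2 ->
  (forall x, Q x b1 = (RtoC 0) -> x = a1) -> (forall x, Q x b2 = (RtoC 0) -> x = a2) ->
  (forall c, Q a1 c = (c - b1) * (c - b1))%C -> (forall c, Q a2 c = (c - b2) * (c - b2))%C ->
  (forall c c' eps, 0 < eps -> at_infinity (fun x => Cmod (Q x c' - Q x c) <= eps * Cmod (Q x c))) ->
  (forall c, Good c -> forall x y z, Q x c = (RtoC 0) -> Q y c = (RtoC 0) -> Q z c = (RtoC 0) ->
     x = y \/ y = z \/ x = z) ->
  (forall M, exists c, M <= Cmod c /\ Good c) ->
  forall x, (al x * al x = 4 * be x)%C.
Proof.
  intros Q Eal Ebe Gal Gbe Na Nb R1 R2 Q1 Q2 Ratio Three Good_ex.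
  set (D := (a2 - a1)%C). set (dl := (b2 - b1)%C).
  assert (ND : D <> (RtoC 0)) by (apply Cminus_neq; auto).
  assert (Ndl : dl <> (RtoC 0)) by (apply Cminus_neq; auto).
  assert (EQ : forall c, Entire (fun x => Q x c)).
  { intros c. apply Entire_plus; [|exact Ebe]. apply Entire_minus; [apply Entire_const|].
    apply Entire_mult; [apply Entire_const|exact Eal]. }
  assert (GQ : forall c, poly_growth n (fun x => Q x c)).
  { intros c. apply (poly_growth_ext _ (fun x => (c * c + (- c) * al x) + be x)%C); [intros; unfold Q; ring|].
    apply poly_growth_plus; [apply poly_growth_plus|exact Gbe].
    - apply (poly_growth_le 0); [lia|apply poly_growth_const].
    - apply (poly_growth_mult 0 n); [apply poly_growth_const|exact Gal]. }
  destruct (leading_term_exists n _ (EQ b1) (GQ b1)) as [Z|[m [k L]]].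
  { exfalso. specialize (Z a2). cbv beta in Z. rewrite Q2 in Z.
    apply Cmult_integral_iff in Z. apply Nb.
    assert (Z' : (b1 - b2 = 0)%C) by tauto. replace b1 with ((b1 - b2) + b2)%C by ring. rewrite Z'; ring. }
  assert (Lc : forall c, leading_term (fun x => Q x c) m k).
  { intros c. apply (leading_term_perturb (fun x => Q x b1)); auto. }
  assert (Nk : k <> (RtoC 0)) by apply L.
  assert (P1 : forall x, Q x b1 = (k * Cpow (x - a1) m)%C) by (apply single_root; auto).
  assert (P2 : forall x, Q x b2 = (k * Cpow (x - a2) m)%C) by (apply single_root; auto).
  assert (K1 : (k * Cpow D m = dl * dl)%C).
  { unfold D, dl. rewrite <- P1, Q2. ring. }
  assert (K2 : (k * Cpow (a1 - a2) m = dl * dl)%C).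
  { unfold dl. rewrite <- P2, Q1. ring. }
  assert (Interp : forall x s, Q x (b1 + dl * s)%C = ((1 - s) * Q x b1 + s * Q x b2 + dl * dl * (s * (s - 1)))%C).
  { intros x s. unfold Q, dl. ring. }
  assert (Hm2 : (m <= 2)%nat).
  { apply NNPP. intros Hm. assert (Hm3 : (3 <= m)%nat) by lia. clear Hm.
    destruct m as [|j]; [lia|]. assert (Hj : (2 <= j)%nat) by lia.
    destruct (power_gap_bounded j Hj) as [R HR].
    set (R' := Rmax R 1). assert (R'1 : R <= R') by apply Rmax_l. assert (R'2 : 1 <= R') by apply Rmax_r.
    (* large enough to exclude the roots u of u^j = s with u in the exceptional bounded set *)
    set (B := R' ^ j + 1). 
    assert (HB : 1 < B). { assert (0 < R' ^ j) by (apply pow_lt; lra). unfold B; lra. }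
    destruct (Good_ex (Cmod b1 + Cmod dl * B)) as [c [Hc Gc]].
    set (s := ((c - b1) / dl)%C).
    assert (Ec : c = (b1 + dl * s)%C) by (unfold s; field; auto).
    apply Cmod_gt_0 in Ndl as Pdl.
    assert (Hs : B <= Cmod s).
    { unfold s. rewrite Cmod_div by auto. apply Rle_div_r; auto.
      pose proof (Cmod_tri3 c b1 0) as T. replace (c - 0)%C with c in T by ring. replace (b1 - 0)%C with b1 in T by ring.
      lra. }
    assert (Ns0 : s <> (RtoC 0)) by (apply Cmod_gt_0; lra).
    assert (Ns1 : (1 - s)%C <> (RtoC 0)).
    { intros E. assert (s = RtoC 1) by (replace s with (1 - (1 - s))%C by ring; rewrite E; ring).
      rewrite H, Cmod_1 in Hs. lra. }
    assert (S j <= 2)%nat; [|lia].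
    apply (two_simple_roots (fun x => Q x c) (S j) k); auto; [|intros; eapply Three; eauto].
    intros x Hx Dx. cbv beta in Hx.
    set (u := ((x - a1) / D)%C).
    assert (Ex1 : (x - a1 = D * u)%C) by (unfold u; field; auto).
    assert (Ex2 : (x - a2 = D * (u - 1))%C) by (unfold u, D; field; auto).
    assert (Dx' : Cderiv (fun x => Q x c) x
      ((1 - s) * (k * (RtoC (INR (S j)) * Cpow (x - a1) j)) + s * (k * (RtoC (INR (S j)) * Cpow (x - a2) j)))%C).
    { apply (Cderiv_ext (fun x => (1 - s) * (k * Cpow (x - a1) (S j)) + s * (k * Cpow (x - a2) (S j)) + dl * dl * (s * (s - 1)))%C).
      { intros y. rewrite Ec at 1. rewrite Interp, P1, P2. reflexivity. }
      eapply Cderiv_eq.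
      2:{ apply (Cderiv_plus (fun x => (1 - s) * (k * Cpow (x - a1) (S j)) + s * (k * Cpow (x - a2) (S j)))%C
                 (fun _ => dl * dl * (s * (s - 1)))%C); [|apply Cderiv_const].
          apply (Cderiv_plus (fun x => (1 - s) * (k * Cpow (x - a1) (S j)))%C (fun x => s * (k * Cpow (x - a2) (S j)))%C).
          - apply (Cderiv_mult (fun _ => 1 - s)%C (fun x => k * Cpow (x - a1) (S j))%C); [apply Cderiv_const|].
            apply (Cderiv_mult (fun _ => k) (fun x => Cpow (x - a1) (S j))); [apply Cderiv_const|apply Cderiv_shift_pow].
          - apply (Cderiv_mult (fun _ => s) (fun x => k * Cpow (x - a2) (S j))%C); [apply Cderiv_const|].
            apply (Cderiv_mult (fun _ => k) (fun x => Cpow (x - a2) (S j))); [apply Cderiv_const|apply Cderiv_shift_pow]. }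
      simpl pred. ring. }
    pose proof (Cderiv_unique _ _ _ _ Dx' Dx) as E. clear Dx Dx'.
    rewrite Ex1, Ex2, !Cpow_mult_l in E.
    set (p := Cpow u j) in *. set (p' := Cpow (u - 1) j) in *.
    assert (NI : RtoC (INR (S j)) <> (RtoC 0)).
    { intros E0. apply RtoC_inj in E0. apply not_0_INR in E0; auto. }
    assert (NDj : Cpow D j <> (RtoC 0)) by (apply Cpow_nz; auto).
    assert (E' : ((1 - s) * p + s * p' = 0)%C).
    { replace ((1 - s) * p + s * p')%C with
       (((1 - s) * (k * (RtoC (INR (S j)) * (Cpow D j * p))) + s * (k * (RtoC (INR (S j)) * (Cpow D j * p')))) / (k * RtoC (INR (S j)) * Cpow D j))%C
       by (field; auto). rewrite E. field; auto. }
    rewrite Ec, Interp, P1, P2, Ex1, Ex2, !Cpow_mult_l, !Cmult_assoc in Hx.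
    rewrite <- !(Cmult_assoc _ k), K1 in Hx.
    assert (H0 : (dl * dl * ((1 - s) * (u * p) + s * ((u - 1) * p') + s * (s - 1)) = 0)%C).
    { rewrite <- Hx. rewrite !Cpow_S. fold p p'. ring. }
    apply Cmult_integral_iff in H0. destruct H0 as [H0|H0].
    { apply (Cmult_neq_0 dl dl); auto. }
    assert (H1 : ((1 - s) * (p - s) = 0)%C).
    { rewrite <- H0. replace (s * ((u - 1) * p'))%C with ((u - 1) * (s * p'))%C by ring.
      replace (s * p')%C with (((1 - s) * p + s * p') - (1 - s) * p)%C by ring. rewrite E'. ring. }
    apply Cmult_integral_iff in H1. destruct H1 as [H1|H1]; [contradiction|].
    assert (Ep : p = s) by (replace p with ((p - s) + s)%C by ring; rewrite H1; ring).
    assert (H2 : (s * ((1 - s) + p') = 0)%C).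
    { rewrite <- E', Ep. ring. }
    apply Cmult_integral_iff in H2. destruct H2 as [H2|H2]; [contradiction|].
    destruct (Rle_dec R' (Cmod u)) as [HRu|HRu].
    - apply (HR u); [lra|]. fold p p'. rewrite Ep. 
      replace (s - 1 - p')%C with (- ((1 - s) + p'))%C by ring. rewrite H2. ring.
    - assert (Cmod s <= R' ^ j).
      { rewrite <- Ep. unfold p. rewrite Cmod_pow. apply pow_incr. split; [apply Cmod_ge_0|lra]. }
      unfold B in Hs. lra. }
  destruct m as [|[|[|m]]]; [| | |lia].
  - exfalso. specialize (P1 a1). rewrite Q1 in P1. simpl in P1. apply Nk.
    replace k with (k * 1)%C by ring. rewrite <- P1. ring.
  - exfalso. simpl in K1, K2. apply (Cmult_neq_0 dl dl); auto.
    assert (E : (2 * (dl * dl) = 0)%C).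
    { replace (2 * (dl * dl))%C with (dl * dl + dl * dl)%C by ring. rewrite <- K1 at 1. rewrite <- K2. unfold D. ring. }
    apply Cmult_integral_iff in E. destruct E as [E|E]; auto. apply RtoC_inj in E. lra.
  - intros x. specialize (P1 x). specialize (P2 x). simpl in P1, P2, K1.
    set (X := (x - a1)%C) in *.
    assert (EX2 : (x - a2 = X - D)%C) by (unfold X, D; ring). rewrite EX2 in P2.
    assert (E1 : (dl * al x = 2 * dl * b1 + 2 * k * X * D)%C).
    { replace (dl * al x)%C with (dl * (b1 + b2) - (Q x b2 - Q x b1))%C by (unfold Q, dl; ring).
      rewrite P1, P2. replace b2 with (b1 + dl)%C by (unfold dl; ring).
      replace (dl * (b1 + (b1 + dl)))%C with (2 * dl * b1 + dl * dl)%C by ring. rewrite <- K1. ring. }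
    assert (E2 : be x = (k * (X * (X * 1)) - b1 * b1 + b1 * al x)%C).
    { rewrite <- P1. unfold Q. ring. }
    assert (E3 : (dl * dl * (al x * al x - 4 * be x) = 0)%C).
    { rewrite E2. 
      replace (dl * dl * (al x * al x - 4 * (k * (X * (X * 1)) - b1 * b1 + b1 * al x)))%C with
        ((dl * al x) * (dl * al x) - 4 * (dl * dl) * k * X * X + 4 * dl * dl * b1 * b1 - 4 * dl * b1 * (dl * al x))%C by ring.
      rewrite E1, <- K1. replace (4 * dl * dl * b1 * b1)%C with (4 * (dl * dl) * b1 * b1)%C by ring.
      ring_simplify. 
      replace (dl ^ 2)%C with (dl * dl)%C by (simpl; ring). ring. }
    apply Cmult_integral_iff in E3. destruct E3 as [E3|E3].
    { exfalso. apply (Cmult_neq_0 dl dl); auto. }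
    replace (al x * al x)%C with ((al x * al x - 4 * be x) + 4 * be x)%C by ring. rewrite E3. ring.
Qed.

(** * Functions on the surface and descent to the plane *)

(** Only continuity at the single point [x0] is required, so that such roots are obtained by choice and
    functions on the surface can be tested on them pointwise. *)
Definition root_at (f z : C -> C) (x0 : C) : Prop := (forall x, z x * z x = f x)%C /\ Ccont z x0.

Lemma root_at_exists f s x0 : Entire f -> (s * s = f x0)%C -> exists z, root_at f z x0 /\ z x0 = s.
Proof.
  intros Hf Hs. exists (fun x => nearby_root s (f x)).
  assert (E : nearby_root s (f x0) = s) by (rewrite <- Hs; apply nearby_root_self).
  split; [split|]; auto.
  - intros x. apply nearby_root_sq.
  - rewrite E. intros eps He. assert (e2 : 0 < eps * eps) by nra.
    generalize (Cdiff_cont _ _ (Hf x0) _ e2). apply filter_imp. intros x Hx.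
    pose proof (nearby_root_dist s (f x)) as D. rewrite Hs in D. pose proof (Cmod_ge_0 (nearby_root s (f x) - s)). nra.
Qed.

Lemma root_at_opp f z x0 : root_at f z x0 -> root_at f (fun x => - z x)%C x0.
Proof.
  intros [H1 H2]. split; [intros x; rewrite <- H1; ring|]. cap Clim_opp; exact H2.
Qed.

Lemma Cderiv_vanish_mult u k x0 d : Cderiv u x0 d -> u x0 = (RtoC 0) -> Ccont k x0 ->
  Cderiv (fun x => u x * k x)%C x0 (d * k x0)%C.
Proof.
  intros [p [E [P L]]] U0 Hk. exists (fun x => p x * k x)%C. repeat split.
  - intros y. rewrite (E y), U0. ring.
  - congruence.
  - cap Clim_mult; assumption.
Qed.

(** The identity [z(x) - z(x0) = (f x - f x0) / (z x + z x0)] expresses the increment through that of [f]. *)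
Lemma root_at_diff f z x0 : Entire f -> root_at f z x0 -> f x0 <> (RtoC 0) -> Cdiff z x0.
Proof.
  intros Hf [H1 H2] N.
  assert (Nz : z x0 <> (RtoC 0)) by (intros E; apply N; rewrite <- H1, E; ring).
  assert (N2 : (z x0 + z x0)%C <> (RtoC 0)).
  { intros E. apply Nz. replace (z x0) with ((z x0 + z x0) / 2)%C by cfield. rewrite E. cfield. }
  assert (C2 : Ccont (fun x => z x + z x0)%C x0) by (cap Clim_plus; [exact H2|cap Clim_const]).
  destruct (Hf x0) as [d D].
  apply (Cdiff_ext_loc (fun x => z x0 + (f x - f x0) * / (z x + z x0))%C).
  - generalize (nonzero_near (fun x => z x + z x0)%C x0 C2 N2). apply filter_imp. intros x Nx.
    rewrite <- (H1 x), <- (H1 x0). field. exact Nx.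
  - apply Cdiff_plus; [apply Cdiff_const|].
    eexists. apply (Cderiv_vanish_mult (fun x => f x - f x0)%C (fun x => / (z x + z x0))%C).
    + apply Cderiv_minus; [exact D|apply Cderiv_const].
    + ring.
    + cap Clim_inv; [exact N2|exact C2].
Qed.

Lemma simple_zero_set_isolated f Z z0 : simple_zero_set f Z -> exists r, 0 < r /\ forall z, Cmod (z - z0) < r -> z <> z0 -> ~ Z z.
Proof.
  intros Hf. pose proof Hf as [Ef [Zf _]]. destruct (classic (f z0 = (RtoC 0))) as [E|N].
  - destruct (simple_zero_set_factor f Z z0 Hf E) as [g [Eg [G1 [Ng _]]]].
    pose proof (nonzero_near g z0 (Cdiff_cont _ _ (Eg z0)) Ng) as L. apply locally_Cmod in L.
    destruct L as [r [Hr L]]. exists r; split; auto. intros z Hz Nz HZ. apply Zf in HZ.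
    rewrite G1 in HZ. apply (Cmult_neq_0 (z - z0) (g z)); auto. apply Cminus_neq; auto.
  - pose proof (nonzero_near f z0 (Cdiff_cont _ _ (Ef z0)) N) as L. apply locally_Cmod in L.
    destruct L as [r [Hr L]]. exists r; split; auto. intros z Hz Nz HZ. apply Zf in HZ. apply (L z Hz HZ).
Qed.

Definition some_root (v : C) : C := nearby_root 0 v.
Lemma some_root_sq v : (some_root v * some_root v = v)%C.
Proof. apply nearby_root_sq. Qed.

Section Descent.
Variables (f g : C -> C) (W A : C -> Prop).
Hypothesis Hf : simple_zero_set f W.
Hypothesis Hg : simple_zero_set g A.

Definition on_roots (P : (C -> C) -> C -> Prop) (psi : C -> C -> C -> C) (x0 : C) : Prop :=
  forall z2 z3, root_at f z2 x0 -> root_at g z3 x0 -> P (fun x => psi x (z2 x) (z3 x)) x0.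

(** Continuity is required everywhere, differentiability only where [x] is a local parameter; the points
    of [W] are filled in by removable singularities. *)
Definition surface_holomorphic (psi : C -> C -> C -> C) : Prop :=
  (forall x0, on_roots (fun u x => Ccont u x) psi x0) /\
  (forall x0, ~ W x0 -> on_roots Cdiff psi x0).

(** The two sign changes generate the covering group of the surface over the plane. *)
Definition deck_invariant (psi : C -> C -> C -> C) : Prop :=
  forall x s t, (s * s = f x)%C -> (t * t = g x)%C -> psi x (- s)%C t = psi x s t /\ psi x s (- t)%C = psi x s t.

(** For a deck-invariant function the choice of the roots is immaterial ([descent_eq]). *)
Definition descent (psi : C -> C -> C -> C) (x : C) : C := psi x (some_root (f x)) (some_root (g x)).

Lemma descent_eq psi x s t : deck_invariant psi -> (s * s = f x)%C -> (t * t = g x)%C ->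
  descent psi x = psi x s t.
Proof.
  intros I Hs Ht. unfold descent.
  assert (E1 : (some_root (f x) * some_root (f x) = s * s)%C) by (rewrite some_root_sq; auto).
  assert (E2 : (some_root (g x) * some_root (g x) = t * t)%C) by (rewrite some_root_sq; auto).
  assert (Ht' : (- t * - t = g x)%C) by (rewrite <- Ht; ring).
  destruct (sq_eq _ _ E1) as [U|U]; destruct (sq_eq _ _ E2) as [V|V]; rewrite U, V.
  - reflexivity.
  - apply (I x s t Hs Ht).
  - apply (I x s t Hs Ht).
  - rewrite (proj1 (I x s (- t)%C Hs Ht')). apply (I x s t Hs Ht).
Qed.

Lemma descent_entire psi : surface_holomorphic psi -> deck_invariant psi -> Entire (descent psi).
Proof.
  intros [Hc Hd] I.
  assert (K : forall (P : (C -> C) -> C -> Prop) x0,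
     (forall u v x, (forall y, u y = v y) -> P u x -> P v x) -> on_roots P psi x0 -> P (descent psi) x0).
  { intros P x0 Ext H.
    destruct (root_at_exists f (some_root (f x0)) x0 (proj1 Hf) (some_root_sq _)) as [z2 [R2 _]].
    destruct (root_at_exists g (some_root (g x0)) x0 (proj1 Hg) (some_root_sq _)) as [z3 [R3 _]].
    apply (Ext (fun x => psi x (z2 x) (z3 x))); [|apply H; auto].
    intros y. symmetry. apply descent_eq; auto; [apply R2|apply R3]. }
  assert (Dc : forall x0, Ccont (descent psi) x0).
  { intros x0. apply (K (fun u x => Ccont u x)); auto.
    intros u v x E Hu. apply (Clim_ext _ u); [apply filter_forall; auto|]. rewrite <- E. exact Hu. }
  assert (Dd : forall x0, ~ W x0 -> Cdiff (descent psi) x0).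
  { intros x0 N. apply (K Cdiff); auto. intros u v x E. apply Cdiff_ext; auto. }
  intros x0. destruct (simple_zero_set_isolated f W x0 Hf) as [r [Hr Is]].
  apply (removable_singularity _ x0 r Hr (Dc x0)).
  intros z Hz Nz. apply Dd. apply Is; auto.
Qed.

Lemma surface_holomorphic_plus p q : surface_holomorphic p -> surface_holomorphic q -> surface_holomorphic (fun x s t => p x s t + q x s t)%C.
Proof.
  intros [A1 A2] [B1 B2]. split.
  - intros x0 z2 z3 R2 R3. cap Clim_plus; [apply (A1 x0 z2 z3)|apply (B1 x0 z2 z3)]; auto.
  - intros x0 N z2 z3 R2 R3. apply Cdiff_plus; [apply (A2 x0 N z2 z3)|apply (B2 x0 N z2 z3)]; auto.
Qed.
Lemma surface_holomorphic_minus p q : surface_holomorphic p -> surface_holomorphic q -> surface_holomorphic (fun x s t => p x s t - q x s t)%C.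
Proof.
  intros [A1 A2] [B1 B2]. split.
  - intros x0 z2 z3 R2 R3. cap Clim_minus; [apply (A1 x0 z2 z3)|apply (B1 x0 z2 z3)]; auto.
  - intros x0 N z2 z3 R2 R3. apply Cdiff_minus; [apply (A2 x0 N z2 z3)|apply (B2 x0 N z2 z3)]; auto.
Qed.
Lemma surface_holomorphic_mult p q : surface_holomorphic p -> surface_holomorphic q -> surface_holomorphic (fun x s t => p x s t * q x s t)%C.
Proof.
  intros [A1 A2] [B1 B2]. split.
  - intros x0 z2 z3 R2 R3. cap Clim_mult; [apply (A1 x0 z2 z3)|apply (B1 x0 z2 z3)]; auto.
  - intros x0 N z2 z3 R2 R3. apply Cdiff_mult; [apply (A2 x0 N z2 z3)|apply (B2 x0 N z2 z3)]; auto.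
Qed.
Lemma surface_holomorphic_neg2 p : surface_holomorphic p -> surface_holomorphic (fun x s t => p x (- s)%C t).
Proof.
  intros [A1 A2]. split.
  - intros x0 z2 z3 R2 R3. apply (A1 x0 (fun x => - z2 x)%C z3); auto. apply root_at_opp; auto.
  - intros x0 N z2 z3 R2 R3. apply (A2 x0 N (fun x => - z2 x)%C z3); auto. apply root_at_opp; auto.
Qed.
Lemma surface_holomorphic_neg3 p : surface_holomorphic p -> surface_holomorphic (fun x s t => p x s (- t)%C).
Proof.
  intros [A1 A2]. split.
  - intros x0 z2 z3 R2 R3. apply (A1 x0 z2 (fun x => - z3 x)%C); auto. apply root_at_opp; auto.
  - intros x0 N z2 z3 R2 R3. apply (A2 x0 N z2 (fun x => - z3 x)%C); auto. apply root_at_opp; auto.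
Qed.
End Descent.

(** A Lebesgue number for a cover of the square of side [2 M]. *)
Lemma locally_bounded_bounded (P : C -> R -> Prop) :
  (forall c K K', K <= K' -> P c K -> P c K') ->
  (forall c0, exists d K, 0 < d /\ forall c, Cmod (c - c0) < d -> P c K) ->
  forall M, exists K, forall c, Cmod c <= M -> P c K.
Proof.
  intros Mono Loc M.
  assert (Ch : forall c0 : C, exists d : posreal, forall c, Cmod (c - c0) < 2 * d -> P c (/ d)).
  { intros c0. destruct (Loc c0) as [d [K [Hd H]]].
    assert (Hp : 0 < Rmin (d / 2) (/ (Rmax K 1))).
    { pose proof (Rmax_r K 1). apply Rmin_pos; [lra|]. apply Rinv_0_lt_compat; lra. }
    exists (mkposreal _ Hp). simpl pos. intros c Hc.
    pose proof (Rmin_l (d / 2) (/ (Rmax K 1))). pose proof (Rmin_r (d / 2) (/ (Rmax K 1))).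
    apply (Mono c K); [|apply H; lra].
    apply Rle_trans with (Rmax K 1); [apply Rmax_l|].
    apply Rle_trans with (/ / Rmax K 1); [rewrite Rinv_inv; lra|]. apply Rinv_le_contravar; auto. }
  destruct (choice _ Ch) as [dl Hdl].
  destruct (compactness_value_2d (- M) M (- M) M (fun u v => dl (u, v))) as [d0 Hd0].
  exists (/ d0). intros c Hc.
  pose proof (Rmax_Cmod c) as RM. pose proof (Rmax_l (Rabs (fst c)) (Rabs (snd c))) as A1.
  pose proof (Rmax_r (Rabs (fst c)) (Rabs (snd c))) as A2.
  assert (B1 : - M <= fst c <= M) by (apply Rabs_le_between; lra).
  assert (B2 : - M <= snd c <= M) by (apply Rabs_le_between; lra).
  apply NNPP. intros NP. apply (Hd0 (fst c) (snd c) B1 B2). intros [u [v [_ [_ [H1 [H2 H3]]]]]].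
  apply NP. apply (Mono c (/ dl (u, v))).
  - apply Rinv_le_contravar; auto. apply cond_pos.
  - apply Hdl. pose proof (Cmod_2Rmax (c - (u, v))) as Q. simpl in Q.
    assert (S2 : sqrt 2 < 2).
    { rewrite <- (sqrt_pow2 2) at 2 by lra. apply sqrt_lt_1; lra. }
    assert (S0 : 0 < sqrt 2) by (apply sqrt_lt_R0; lra).
    pose proof (cond_pos (dl (u, v))) as Pd.
    assert (Rmax (Rabs (fst c + - u)) (Rabs (snd c + - v)) < dl (u, v)) by (apply Rmax_lub_lt; assumption).
    assert (0 <= Rmax (Rabs (fst c + - u)) (Rabs (snd c + - v))).
    { eapply Rle_trans; [apply Rabs_pos|apply Rmax_l]. }
    nra.
Qed.

Lemma NoDup_fiber4 x s t : s <> (RtoC 0) -> t <> (RtoC 0) ->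
  NoDup (pt x s t :: pt x s (- t)%C :: pt x (- s)%C t :: pt x (- s)%C (- t)%C :: nil).
Proof.
  intros Ns Nt.
  assert (O : forall z : C, z <> (RtoC 0) -> z <> (- z)%C).
  { intros z N E. apply N. replace z with ((z - (- z)) / 2)%C by cfield. rewrite <- E. cfield. }
  pose proof (O s Ns) as Os. pose proof (O t Nt) as Ot.
  assert (Inj : forall a b c d, pt x a b = pt x c d -> a = c /\ b = d).
  { intros a b c d E. split; [apply (f_equal c2) in E|apply (f_equal c3) in E]; exact E. }
  repeat constructor; simpl; intros H; repeat (destruct H as [H|H]); auto;
    apply Inj in H; destruct H as [H1 H2]; auto.
Qed.

Lemma NoDup_fiber2 x t : t <> (RtoC 0) -> NoDup (pt x 0 t :: pt x 0 (- t)%C :: nil).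
Proof.
  intros Nt. repeat constructor; simpl; intros H; repeat (destruct H as [H|H]); auto.
  apply (f_equal c3) in H. rewrite !c3_pt in H. apply Nt.
  replace t with ((t - (- t)) / 2)%C by cfield. rewrite <- H at 1. cfield.
Qed.

(** * From an isomorphism to an affine map *)

Definition has_arbitrarily_many (Z : C -> Prop) : Prop :=
  forall n, exists l, NoDup l /\ length l = n /\ forall a, In a l -> Z a.

Section Forward.
Variables (f g h : C -> C) (W A B : C -> Prop) (F G : C3 -> C3).
Hypotheses (Hf : simple_zero_set f W) (Hg : simple_zero_set g A) (Hh : simple_zero_set h B).
Hypotheses (AW : forall a, A a -> W a) (BW : forall b, B b -> W b).
Hypothesis (Wmany : has_arbitrarily_many W).
Notation S1 := (surface f g).
Notation S2 := (surface f h).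
Hypothesis Inv : inverse_maps S1 S2 F G.
Hypothesis CF : continuous_on_subset S1 F.
Hypothesis CG : continuous_on_subset S2 G.
Hypothesis HF : holomorphic_on (regular_part S1) F.

Lemma F_on p : S1 p -> S2 (F p). Proof. apply Inv. Qed.
Lemma GF p : S1 p -> G (F p) = p. Proof. apply Inv. Qed.
Lemma FG q : S2 q -> F (G q) = q. Proof. apply Inv. Qed.

Lemma F_inj p q : S1 p -> S1 q -> F p = F q -> p = q.
Proof. intros Hp Hq E. rewrite <- (GF p Hp), <- (GF q Hq), E. reflexivity. Qed.

Definition roots (k : C -> C) (x s t : C) : Prop := (s * s = f x)%C /\ (t * t = k x)%C.

Lemma roots_S1 x s t : roots g x s t <-> S1 (pt x s t).
Proof. unfold roots. symmetry. apply surface_pt. Qed.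

Lemma roots_S2 x s t : roots h x s t <-> S2 (pt x s t).
Proof. unfold roots. symmetry. apply surface_pt. Qed.

Lemma roots_neg2 k x s t : roots k x s t -> roots k x (- s)%C t.
Proof. intros [H1 H2]. split; auto. rewrite <- H1. ring. Qed.

Lemma roots_neg3 k x s t : roots k x s t -> roots k x s (- t)%C.
Proof. intros [H1 H2]. split; auto. rewrite <- H2. ring. Qed.

Lemma roots_some_root k x : roots k x (some_root (f x)) (some_root (k x)).
Proof. split; apply some_root_sq. Qed.

Definition base_coord (x s t : C) : C := c1 (F (pt x s t)).

Lemma node_over k Z p : simple_zero_set k Z -> (forall a, Z a -> W a) -> surface f k p -> Z (c1 p) -> p = pt (c1 p) 0 0.
Proof.
  intros Hk ZW Hp Za. apply surface_c in Hp. destruct Hp as [E2 E3].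
  assert (F0 : f (c1 p) = (RtoC 0)) by (apply Hf; auto).
  assert (K0 : k (c1 p) = (RtoC 0)) by (apply Hk; auto).
  rewrite F0 in E2. rewrite K0 in E3. apply Cmult_integral_iff in E2, E3.
  apply C3_ext; rewrite ?c1_pt, ?c2_pt, ?c3_pt; auto; tauto.
Qed.

Lemma local_cut_point_iff k Z p : simple_zero_set k Z -> (forall a, Z a -> W a) -> surface f k p ->
  (local_cut_point (surface f k) p <-> Z (c1 p)).
Proof.
  intros Hk ZW Hp. split.
  - intros Hc. apply NNPP. intros N. exact (surface_not_cut_point f k W Z Hf Hk p Hp N Hc).
  - intros Za. rewrite (node_over k Z p Hk ZW Hp Za).
    apply (surface_node_local_cut_point f k W Z); auto; [apply Hf; auto|apply Hk; auto].
Qed.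

(** Nodes are the local cut points of the surfaces. *)
Lemma nodes_match p : S1 p -> (A (c1 p) <-> B (c1 (F p))).
Proof.
  intros Hp. rewrite <- (local_cut_point_iff g A p Hg AW Hp), <- (local_cut_point_iff h B (F p) Hh BW (F_on p Hp)). split.
  - intros Hc. apply (local_cut_point_homeo S1 S2 F G); auto.
  - intros Hc. rewrite <- (GF p Hp). apply (local_cut_point_homeo S2 S1 G F); auto; [|apply F_on; auto].
    destruct Inv as [I1 [I2 [I3 I4]]]. repeat split; auto.
Qed.

Lemma regular_off_A p : S1 p -> ~ A (c1 p) -> regular_part S1 p.
Proof.
  intros Hp N. split; auto. intros Hs. apply N. apply (local_cut_point_iff g A p Hg AW Hp). apply Sing_local_cut_point, Hs.
Qed.

Lemma curve_lim z2 z3 x0 : root_at f z2 x0 -> root_at g z3 x0 ->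
  filterlim (fun x => pt x (z2 x) (z3 x)) (@locally C_UniformSpace x0) (locally (pt x0 (z2 x0) (z3 x0))).
Proof.
  intros [_ R2] [_ R3]. apply filterlim_C3; [exact _|]. split; [|split]; [apply Clim_id|exact R2|exact R3].
Qed.

Lemma curve_on z2 z3 x0 x : root_at f z2 x0 -> root_at g z3 x0 -> S1 (pt x (z2 x) (z3 x)).
Proof. intros [R2 _] [R3 _]. apply surface_pt. auto. Qed.

(** Off the nodes there are no singular points, so [F] has ambient holomorphic extensions. *)
Lemma base_coord_hol : surface_holomorphic f g W base_coord.
Proof.
  split.
  - intros x0 z2 z3 R2 R3.
    pose proof (curve_on z2 z3 x0 x0 R2 R3) as Sp.
    pose proof (CF _ Sp) as K. intros eps He.
    assert (L : locally (F (pt x0 (z2 x0) (z3 x0))) (fun q : C3 => Cmod (c1 q - c1 (F (pt x0 (z2 x0) (z3 x0)))) < eps)).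
    { apply locally_C3. exists eps. auto. }
    specialize (K _ L). unfold filtermap, within in K.
    pose proof (curve_lim z2 z3 x0 R2 R3 _ K) as K2. unfold filtermap in K2.
    revert K2. apply filter_imp. intros x Hx. apply Hx. apply (curve_on z2 z3 x0); auto.
  - intros x0 N z2 z3 R2 R3. set (p := pt x0 (z2 x0) (z3 x0)).
    assert (Nf : f x0 <> (RtoC 0)) by (intros E; apply N, Hf, E).
    assert (Ng : g x0 <> (RtoC 0)) by (intros E; apply N, AW, Hg, E).
    assert (Rp : regular_part S1 p).
    { apply regular_off_A; [apply (curve_on z2 z3 x0); auto|]. intros HA0. apply N, AW, HA0. }
    destruct (HF p Rp) as [U [Fl [OU [Up [DF EF]]]]].
    apply (Cdiff_ext_loc (fun x => c1 (Fl (pt x (z2 x) (z3 x))))).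
    + pose proof (curve_lim z2 z3 x0 R2 R3 _ (OU p Up)) as K2. unfold filtermap in K2.
      pose proof (nonzero_near f x0 (Cdiff_cont _ _ (proj1 Hf x0)) Nf) as K3.
      generalize (filter_and (F:=locally x0) _ _ K2 K3). apply filter_imp. intros x [Ux Nx].
      unfold base_coord. rewrite EF; auto. apply regular_off_A; [apply (curve_on z2 z3 x0); auto|].
      rewrite c1_pt. intros Ax. apply Nx, Hf, AW, Ax.
    + apply ex_filterdiff_curve; [apply DF; exact Up| |].
      * apply (root_at_diff f); auto. apply Hf.
      * apply (root_at_diff g); auto. apply Hg.
Qed.

(** Every point of the surface over a number near [c0] is near one of the four points over [c0], where
    [G] is continuous. *)
Lemma G_locally_bounded c0 : exists d K, 0 < d /\ forall c, Cmod (c - c0) < d ->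
  forall q, S2 q -> c1 q = c -> Cmod (c1 (G q)) <= K.
Proof.
  pose proof (roots_some_root h c0) as R0. set (s := some_root (f c0)) in *. set (t := some_root (h c0)) in *.
  assert (Loc : forall s t, roots h c0 s t -> exists d, 0 < d /\ forall q, S2 q ->
     Cmod (c1 q - c0) < d -> Cmod (c2 q - s) < d -> Cmod (c3 q - t) < d ->
     Cmod (c1 (G q)) <= Cmod (c1 (G (pt c0 s t))) + 1).
  { intros s' t' R. apply roots_S2 in R. pose proof (CG _ R) as K.
    assert (L : locally (G (pt c0 s' t')) (fun q : C3 => Cmod (c1 q - c1 (G (pt c0 s' t'))) < 1)).
    { apply locally_C3. exists 1. split; [lra|auto]. }
    specialize (K _ L). unfold filtermap, within in K. apply locally_C3 in K.
    destruct K as [d [Hd K]]. exists d. split; auto. intros q Sq H1 H2 H3.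
    specialize (K q H1 H2 H3 Sq).
    replace (c1 (G q)) with ((c1 (G q) - c1 (G (pt c0 s' t'))) + c1 (G (pt c0 s' t')))%C by ring.
    eapply Rle_trans; [apply Cmod_triangle|]. lra. }
  destruct (Loc s t R0) as [d1 [D1 H1]].
  destruct (Loc s (- t)%C (roots_neg3 _ _ _ _ R0)) as [d2 [D2 H2]].
  destruct (Loc (- s)%C t (roots_neg2 _ _ _ _ R0)) as [d3 [D3 H3]].
  destruct (Loc (- s)%C (- t)%C (roots_neg3 _ _ _ _ (roots_neg2 _ _ _ _ R0))) as [d4 [D4 H4]].
  set (d := Rmin (Rmin d1 d2) (Rmin d3 d4)).
  assert (Hd : 0 < d) by (repeat apply Rmin_pos; auto).
  assert (Ld : d <= d1 /\ d <= d2 /\ d <= d3 /\ d <= d4).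
  { unfold d, Rmin. repeat destruct Rle_dec; lra. }
  assert (d20 : 0 < d * d) by nra.
  destruct (Ccont_loc f c0 _ d20 (Cdiff_cont _ _ (proj1 Hf c0))) as [r1 [R1 Q1]].
  destruct (Ccont_loc h c0 _ d20 (Cdiff_cont _ _ (proj1 Hh c0))) as [r2 [R2 Q2]].
  exists (Rmin d (Rmin r1 r2)).
  set (k1 := Cmod (c1 (G (pt c0 s t)))) in H1. set (k2 := Cmod (c1 (G (pt c0 s (- t)%C)))) in H2.
  set (k3 := Cmod (c1 (G (pt c0 (- s)%C t)))) in H3. set (k4 := Cmod (c1 (G (pt c0 (- s)%C (- t)%C)))) in H4.
  assert (Pk : 0 <= k1 /\ 0 <= k2 /\ 0 <= k3 /\ 0 <= k4) by (repeat split; apply Cmod_ge_0).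
  exists (k1 + k2 + k3 + k4 + 1).
  split; [repeat apply Rmin_pos; auto|]. intros c Hc q Sq <-.
  pose proof (Rmin_l d (Rmin r1 r2)). pose proof (Rmin_r d (Rmin r1 r2)).
  pose proof (Rmin_l r1 r2). pose proof (Rmin_r r1 r2).
  specialize (Q1 (c1 q) ltac:(lra)). specialize (Q2 (c1 q) ltac:(lra)).
  destruct R0 as [E2 E3]. rewrite <- E2 in Q1. rewrite <- E3 in Q2.
  pose proof (proj1 (surface_c f h q) Sq) as [F2 F3]. rewrite <- F2 in Q1. rewrite <- F3 in Q2.
  assert (Near : forall u v : C, Cmod (u * u - v * v) < d * d -> Cmod (u - v) < d \/ Cmod (u - - v) < d).
  { intros u v Huv. replace (u * u - v * v)%C with ((u - v) * (u - - v))%C in Huv by ring.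
    rewrite Cmod_mult in Huv. pose proof (Cmod_ge_0 (u - v)). pose proof (Cmod_ge_0 (u - - v)).
    destruct (Rlt_dec (Cmod (u - v)) d); auto. right. nra. }
  destruct Ld as [L1 [L2 [L3 L4]]].
  destruct (Near _ _ Q1) as [N1|N1]; destruct (Near _ _ Q2) as [N2|N2].
  - specialize (H1 q Sq ltac:(lra) ltac:(lra) ltac:(lra)). lra.
  - specialize (H2 q Sq ltac:(lra) ltac:(lra) ltac:(lra)). lra.
  - specialize (H3 q Sq ltac:(lra) ltac:(lra) ltac:(lra)). lra.
  - specialize (H4 q Sq ltac:(lra) ltac:(lra) ltac:(lra)). lra.
Qed.

(** The inverse of [F] is bounded over bounded sets. *)
Lemma base_coord_proper M : at_infinity (fun x => forall s t, roots g x s t -> M <= Cmod (base_coord x s t)).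
Proof.
  destruct (locally_bounded_bounded (fun c K => forall q, S2 q -> c1 q = c -> Cmod (c1 (G q)) <= K))
    with (M := M) as [K HK].
  - intros c K K' HKK H q Sq E. eapply Rle_trans; [apply H; auto|auto].
  - apply G_locally_bounded.
  - exists (K + 1). intros x Hx s t R. apply Rnot_lt_le. intros Lt.
    apply roots_S1 in R. specialize (HK (base_coord x s t) ltac:(lra) (F (pt x s t)) (F_on _ R) eq_refl).
    rewrite GF, c1_pt in HK by auto. lra.
Qed.

Lemma fibre_product_entire : Entire (descent f g (fun x s t => base_coord x s t * base_coord x (- s)%C t * (base_coord x s (- t)%C * base_coord x (- s)%C (- t)%C))%C)
  /\ deck_invariant f g (fun x s t => base_coord x s t * base_coord x (- s)%C t * (base_coord x s (- t)%C * base_coord x (- s)%C (- t)%C))%C.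
Proof.
  assert (D : deck_invariant f g (fun x s t => base_coord x s t * base_coord x (- s)%C t * (base_coord x s (- t)%C * base_coord x (- s)%C (- t)%C))%C).
  { intros x s t _ _. replace (- - s)%C with s by ring. replace (- - t)%C with t by ring. split; ring. }
  split; auto. apply (descent_entire f g W A); auto.
  pose proof base_coord_hol as Y. pose proof (surface_holomorphic_neg2 _ _ _ _ Y) as Y2.
  pose proof (surface_holomorphic_neg3 _ _ _ _ Y) as Y3. pose proof (surface_holomorphic_neg3 _ _ _ _ Y2) as Y23.
  apply surface_holomorphic_mult; apply surface_holomorphic_mult; assumption.
Qed.

(** The product of the four values over [x] is a proper entire function of [x]. Where all values have
    modulus at least one, each of them is bounded by the product. *)
Lemma base_coord_growth : exists N K, 0 <= K /\
  at_infinity (fun x => forall s t, roots g x s t -> Cmod (base_coord x s t) <= K * Cmod x ^ N).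
Proof.
  destruct fibre_product_entire as [E4 D4]. set (psi := fun x s t : C => _) in E4, D4.
  assert (Big : forall M, at_infinity (fun x => M <= Cmod (descent f g psi x))).
  { intros M. generalize (base_coord_proper (Rmax M 1)). apply at_infinity_imp. intros x H.
    pose proof (roots_some_root g x) as R. pose proof (Rmax_l M 1). pose proof (Rmax_r M 1).
    unfold descent, psi. rewrite !Cmod_mult.
    pose proof (H _ _ R) as A1. pose proof (H _ _ (roots_neg2 _ _ _ _ R)) as A2.
    pose proof (H _ _ (roots_neg3 _ _ _ _ R)) as A3.
    pose proof (H _ _ (roots_neg3 _ _ _ _ (roots_neg2 _ _ _ _ R))) as A4.
    set (a := Cmod (base_coord x _ _)) in A1. set (b := Cmod (base_coord x _ _)) in A2.
    set (c := Cmod (base_coord x _ _)) in A3. set (e := Cmod (base_coord x _ _)) in A4.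
    fold a b c e.
    assert (1 <= b * (c * e)).
    { assert (1 <= c * e) by nra. nra. }
    replace (a * b * (c * e)) with (a * (b * (c * e))) by ring. nra. }
  destruct (proper_poly_growth _ E4 Big) as [N [K [R [HR [HK H]]]]].
  exists N, K. split; auto.
  generalize (at_infinity_and _ _ (at_infinity_ge R) (base_coord_proper 1)). apply at_infinity_imp.
  intros x [Hx Hp] s t Rst. specialize (H x Hx).
  destruct Rst as [Rs Rt]. rewrite (descent_eq f g psi x s t D4 Rs Rt) in H. unfold psi in H.
  assert (Rst : roots g x s t) by (split; auto).
  rewrite !Cmod_mult in H. eapply Rle_trans; [|exact H].
  pose proof (Hp _ _ Rst) as A1. pose proof (Hp _ _ (roots_neg2 _ _ _ _ Rst)) as A2.
  pose proof (Hp _ _ (roots_neg3 _ _ _ _ Rst)) as A3.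
  pose proof (Hp _ _ (roots_neg3 _ _ _ _ (roots_neg2 _ _ _ _ Rst))) as A4.
  set (a := Cmod (base_coord x s t)) in *. set (b := Cmod (base_coord x (- s)%C t)) in *.
  set (c := Cmod (base_coord x s (- t)%C)) in *. set (e := Cmod (base_coord x (- s)%C (- t)%C)) in *.
  assert (1 <= b * (c * e)).
  { assert (1 <= c * e) by nra. nra. }
  replace (a * b * (c * e)) with (a * (b * (c * e))) by ring. nra.
Qed.

Definition fibre_growth (n : nat) (psi : C -> C -> C -> C) : Prop :=
  exists K, 0 <= K /\ at_infinity (fun x => forall s t, roots g x s t -> Cmod (psi x s t) <= K * Cmod x ^ n).

Lemma fibre_growth_plus n p q : fibre_growth n p -> fibre_growth n q -> fibre_growth n (fun x s t => p x s t + q x s t)%C.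
Proof.
  intros [K1 [P1 H1]] [K2 [P2 H2]]. exists (K1 + K2). split; [lra|].
  generalize (at_infinity_and _ _ H1 H2). apply at_infinity_imp. intros x [U V] s t R.
  specialize (U s t R). specialize (V s t R). eapply Rle_trans; [apply Cmod_triangle|]. lra.
Qed.

Lemma fibre_growth_minus n p q : fibre_growth n p -> fibre_growth n q -> fibre_growth n (fun x s t => p x s t - q x s t)%C.
Proof.
  intros [K1 [P1 H1]] [K2 [P2 H2]]. exists (K1 + K2). split; [lra|].
  generalize (at_infinity_and _ _ H1 H2). apply at_infinity_imp. intros x [U V] s t R.
  specialize (U s t R). specialize (V s t R). eapply Rle_trans; [apply Cmod_triangle|].
  rewrite Cmod_opp. lra.
Qed.

Lemma fibre_growth_mult n m p q : fibre_growth n p -> fibre_growth m q -> fibre_growth (n + m) (fun x s t => p x s t * q x s t)%C.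
Proof.
  intros [K1 [P1 H1]] [K2 [P2 H2]]. exists (K1 * K2). split; [nra|].
  generalize (at_infinity_and _ _ H1 H2). apply at_infinity_imp. intros x [U V] s t R.
  specialize (U s t R). specialize (V s t R). rewrite Cmod_mult, pow_add.
  replace (K1 * K2 * (Cmod x ^ n * Cmod x ^ m)) with ((K1 * Cmod x ^ n) * (K2 * Cmod x ^ m)) by ring.
  apply Rmult_le_compat; auto; apply Cmod_ge_0.
Qed.

Lemma fibre_growth_neg2 n p : fibre_growth n p -> fibre_growth n (fun x s t => p x (- s)%C t).
Proof.
  intros [K [P H]]. exists K. split; auto. revert H. apply at_infinity_imp.
  intros x H s t R. apply H, roots_neg2, R.
Qed.

Lemma fibre_growth_neg3 n p : fibre_growth n p -> fibre_growth n (fun x s t => p x s (- t)%C).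
Proof.
  intros [K [P H]]. exists K. split; auto. revert H. apply at_infinity_imp.
  intros x H s t R. apply H, roots_neg3, R.
Qed.

Lemma fibre_growth_descent n psi : fibre_growth n psi -> poly_growth n (descent f g psi).
Proof.
  intros [K [P H]]. apply (poly_growth_intro _ _ K); auto. revert H. apply at_infinity_imp.
  intros x H. apply H, roots_some_root.
Qed.

Lemma invariant_zero n psi Z : surface_holomorphic f g W psi -> deck_invariant f g psi -> fibre_growth n psi ->
  has_arbitrarily_many Z -> (forall x s t, Z x -> roots g x s t -> psi x s t = (RtoC 0)) ->
  forall x s t, roots g x s t -> psi x s t = (RtoC 0).
Proof.
  intros H D Gr HZ Z0 x s t [Rs Rt]. rewrite <- (descent_eq f g psi x s t D Rs Rt).
  destruct (HZ (S n)) as [l [Nl [Ll Hl]]].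
  apply (many_zeros n _ l); auto.
  - apply (descent_entire f g W A); auto.
  - apply fibre_growth_descent; auto.
  - intros a Ha. apply Z0; [auto|apply roots_some_root].
Qed.

Lemma Csqr_0 (z : C) : (z * z = 0)%C -> z = (RtoC 0).
Proof. intros E. apply Cmult_integral_iff in E. tauto. Qed.

(** The differences [u] and [v] of the values on the two sheets of [z2] change sign with [z2] and are
    exchanged by [z3]. So the squares of [u + v] and [u - v] descend to the plane, and they vanish
    on [W], where the two sheets meet. *)
Lemma base_coord_neg2 x s t : roots g x s t -> base_coord x (- s)%C t = base_coord x s t.
Proof.
  pose proof base_coord_hol as Y. pose proof (surface_holomorphic_neg2 _ _ _ _ Y) as Y2.
  pose proof (surface_holomorphic_neg3 _ _ _ _ Y) as Y3. pose proof (surface_holomorphic_neg3 _ _ _ _ Y2) as Y23.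
  destruct base_coord_growth as [N [K [PK HK]]].
  assert (Gy : fibre_growth N base_coord) by (exists K; auto).
  pose proof (fibre_growth_neg2 _ _ Gy) as G2. pose proof (fibre_growth_neg3 _ _ Gy) as G3. pose proof (fibre_growth_neg3 _ _ G2) as G23.
  set (u := fun x s t => (base_coord x s t - base_coord x (- s) t)%C).
  set (v := fun x s t => (base_coord x s (- t) - base_coord x (- s) (- t))%C).
  set (P := fun x s t => (u x s t + v x s t)%C). set (Q := fun x s t => (u x s t - v x s t)%C).
  assert (Hu : surface_holomorphic f g W u) by (apply (surface_holomorphic_minus f g W); auto).
  assert (Hv : surface_holomorphic f g W v) by (apply (surface_holomorphic_minus f g W); auto).
  assert (Gu : fibre_growth N u) by (apply fibre_growth_minus; auto).
  assert (Gv : fibre_growth N v) by (apply fibre_growth_minus; auto).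
  assert (HP : surface_holomorphic f g W P) by (apply (surface_holomorphic_plus f g W); auto).
  assert (HQ : surface_holomorphic f g W Q) by (apply (surface_holomorphic_minus f g W); auto).
  assert (GP : fibre_growth N P) by (apply fibre_growth_plus; auto).
  assert (GQ : fibre_growth N Q) by (apply fibre_growth_minus; auto).
  assert (u2 : forall x s t, u x (- s)%C t = (- u x s t)%C).
  { intros. unfold u. replace (- - s0)%C with s0 by ring. ring. }
  assert (v2 : forall x s t, v x (- s)%C t = (- v x s t)%C).
  { intros. unfold v. replace (- - s0)%C with s0 by ring. ring. }
  assert (u3 : forall x s t, u x s (- t)%C = v x s t) by reflexivity.
  assert (v3 : forall x s t, v x s (- t)%C = u x s t).
  { intros. unfold u, v. replace (- - t0)%C with t0 by ring. reflexivity. }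
  assert (Z : forall x s t, W x -> roots g x s t -> s = (RtoC 0)).
  { intros x' s' t' Wx [E _]. apply Csqr_0. rewrite E. apply Hf, Wx. }
  assert (u0 : forall x t, u x (RtoC 0) t = (RtoC 0)).
  { intros. unfold u. replace (- 0)%C with (RtoC 0) by ring. ring. }
  assert (v0 : forall x t, v x (RtoC 0) t = (RtoC 0)).
  { intros. unfold v. replace (- 0)%C with (RtoC 0) by ring. ring. }
  intros R.
  assert (EP : (P x s t * P x s t)%C = (RtoC 0)).
  { apply (invariant_zero (N + N) (fun x s t => P x s t * P x s t)%C W); auto.
    - apply (surface_holomorphic_mult f g W); auto.
    - intros x' s' t' _ _. unfold P. rewrite u2, v2, u3, v3. split; ring.
    - apply fibre_growth_mult; auto.
    - intros x' s' t' Wx Rx. rewrite (Z x' s' t' Wx Rx). unfold P. rewrite u0, v0. ring. }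
  assert (EQ : (Q x s t * Q x s t)%C = (RtoC 0)).
  { apply (invariant_zero (N + N) (fun x s t => Q x s t * Q x s t)%C W); auto.
    - apply (surface_holomorphic_mult f g W); auto.
    - intros x' s' t' _ _. unfold Q. rewrite u2, v2, u3, v3. split; ring.
    - apply fibre_growth_mult; auto.
    - intros x' s' t' Wx Rx. rewrite (Z x' s' t' Wx Rx). unfold Q. rewrite u0, v0. ring. }
  apply Csqr_0 in EP, EQ.
  assert (Eu : u x s t = (RtoC 0)).
  { replace (u x s t) with ((P x s t + Q x s t) / 2)%C by (unfold P, Q; cfield). rewrite EP, EQ. cfield. }
  unfold u in Eu. replace (base_coord x s t) with ((base_coord x s t - base_coord x (- s) t) + base_coord x (- s)%C t)%C by ring. rewrite Eu. ring.
Qed.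

Lemma F_curve z2 z3 x0 (P : C3 -> Prop) : root_at f z2 x0 -> root_at g z3 x0 ->
  locally (F (pt x0 (z2 x0) (z3 x0))) P ->
  locally x0 (fun x => P (F (pt x (z2 x) (z3 x)))).
Proof.
  intros R2 R3 HP. pose proof (CF _ (curve_on z2 z3 x0 x0 R2 R3) P HP) as K. unfold filtermap, within in K.
  pose proof (curve_lim z2 z3 x0 R2 R3 _ K) as K2. unfold filtermap in K2.
  revert K2. apply filter_imp. intros x Hx. apply Hx. apply (curve_on z2 z3 x0); auto.
Qed.

(** Near such a point there are pairs of distinct points with opposite [z2], on which [base_coord] agrees.
    If the image point did not lie over [W], the first coordinate would be injective near it, and both
    points would have the same image. *)
Lemma base_coord_ramified x t : f x = (RtoC 0) -> t <> (RtoC 0) -> roots g x (RtoC 0) t -> W (base_coord x (RtoC 0) t).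
Proof.
  intros Fx Nt R. apply NNPP. intros NW.
  set (q := F (pt x 0 t)). assert (Sq : S2 q) by (apply F_on, roots_S1, R).
  change (base_coord x (RtoC 0) t) with (c1 q) in NW.
  pose proof (proj1 (surface_c f h q) Sq) as [E2 E3].
  assert (N2 : c2 q <> (RtoC 0)).
  { intros E. apply NW, Hf. rewrite <- E2, E. ring. }
  assert (N3 : c3 q <> (RtoC 0)).
  { intros E. apply NW, BW, Hh. rewrite <- E3, E. ring. }
  destruct (root_at_exists f 0 x (proj1 Hf) (proj1 R)) as [z2 [R2 Z2]].
  destruct (root_at_exists g t x (proj1 Hg) (proj2 R)) as [z3 [R3 Z3]].
  pose proof (root_at_opp _ _ _ R2) as R2'.
  set (P := fun q' : C3 => Cmod (c2 q' - c2 q) < Cmod (c2 q) /\ Cmod (c3 q' - c3 q) < Cmod (c3 q)).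
  assert (LP : locally q P).
  { apply Cmod_gt_0 in N2 as M2. apply Cmod_gt_0 in N3 as M3.
    apply locally_C3. exists (Rmin (Cmod (c2 q)) (Cmod (c3 q))). split; [apply Rmin_pos; auto|].
    intros q' _ H2 H3. pose proof (Rmin_l (Cmod (c2 q)) (Cmod (c3 q))). pose proof (Rmin_r (Cmod (c2 q)) (Cmod (c3 q))).
    split; lra. }
  pose proof (F_curve z2 z3 x P R2 R3) as L1. rewrite Z2, Z3 in L1. specialize (L1 LP).
  pose proof (F_curve _ z3 x P R2' R3) as L2. cbv beta in L2. rewrite Z2, Z3 in L2.
  replace (- 0)%C with (RtoC 0) in L2 by ring. specialize (L2 LP).
  destruct (simple_zero_set_isolated f W x Hf) as [r [Hr Is]].
  pose proof (filter_and (F:=locally x) _ _ L1 L2) as L. apply locally_Cmod in L. destruct L as [d [Hd L]].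
  set (eta := Rmin (d / 2) (r / 2)).
  assert (Eta : 0 < eta) by (apply Rmin_pos; lra).
  assert (Eta1 : eta <= d / 2) by apply Rmin_l. assert (Eta2 : eta <= r / 2) by apply Rmin_r.
  set (x' := (x + RtoC eta)%C).
  assert (Dx : Cmod (x' - x) = eta).
  { unfold x'. rewrite Cmod_shift, Cmod_R, Rabs_pos_eq; lra. }
  destruct (L x' ltac:(lra)) as [[A2 A3] [B2 B3]].
  assert (Nx : x' <> x) by (intros E; rewrite E, Cmod_self in Dx; lra).
  assert (NWx : ~ W x') by (apply Is; auto; lra).
  set (p1 := pt x' (z2 x') (z3 x')) in *. set (p2 := pt x' (- z2 x')%C (z3 x')) in *.
  assert (S1p : S1 p1) by (apply (curve_on z2 z3 x); auto).
  assert (S1p' : S1 p2) by (apply (curve_on (fun x => - z2 x)%C z3 x); auto).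
  assert (E1 : c1 (F p1) = c1 (F p2)).
  { change (base_coord x' (z2 x') (z3 x') = base_coord x' (- z2 x')%C (z3 x')). symmetry. apply base_coord_neg2. apply roots_S1. exact S1p. }
  pose proof (proj1 (surface_c f h _) (F_on _ S1p)) as [U2 U3].
  pose proof (proj1 (surface_c f h _) (F_on _ S1p')) as [V2 V3].
  assert (EF : F p1 = F p2).
  { apply C3_ext; auto.
    - apply (root_unique (c2 q)); auto. rewrite U2, V2, E1. reflexivity.
    - apply (root_unique (c3 q)); auto. rewrite U3, V3, E1. reflexivity. }
  apply F_inj in EF; auto. apply (f_equal c2) in EF. unfold p1, p2 in EF. rewrite !c2_pt in EF.
  apply NWx, Hf. rewrite <- (proj1 R2 x').
  assert (Z : z2 x' = (RtoC 0)).
  { replace (z2 x') with ((z2 x' - - z2 x') / 2)%C by cfield. rewrite <- EF. cfield. }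
  rewrite Z. ring.
Qed.

Lemma fiber4 k x s t p : roots k x s t -> surface f k p -> c1 p = x ->
  In p (pt x s t :: pt x s (- t)%C :: pt x (- s)%C t :: pt x (- s)%C (- t)%C :: nil).
Proof.
  intros [Hs Ht] Hp E. apply surface_c in Hp. destruct Hp as [E2 E3]. rewrite E in E2, E3.
  assert (U2 : (c2 p * c2 p = s * s)%C) by congruence.
  assert (U3 : (c3 p * c3 p = t * t)%C) by congruence.
  rewrite (pt_eta p), E.
  destruct (sq_eq _ _ U2) as [A2|A2]; destruct (sq_eq _ _ U3) as [A3|A3]; rewrite A2, A3; simpl; tauto.
Qed.

Lemma fiber2 k x t p : roots k x (RtoC 0) t -> surface f k p -> c1 p = x ->
  In p (pt x 0 t :: pt x 0 (- t)%C :: nil).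
Proof.
  intros R Hp E. pose proof (fiber4 k x (RtoC 0) t p R Hp E) as H.
  replace (- 0)%C with (RtoC 0) in H by ring. simpl in H |- *. tauto.
Qed.

Lemma incl_fiber l fib c : (forall p, In p l -> S1 p /\ c1 (F p) = c) ->
  (forall q, S2 q -> c1 q = c -> In q fib) -> incl l (map G fib).
Proof.
  intros Hl Hfib p Hp. destruct (Hl p Hp) as [Sp Ep].
  rewrite <- (GF p Sp). apply in_map. apply Hfib; auto. apply F_on, Sp.
Qed.

(** An injective map from a list that is at least as long as the fibre exhausts the fibre. *)
Lemma fiber_pigeon l fib c : NoDup l -> (forall p, In p l -> S1 p /\ c1 (F p) = c) ->
  (forall q, S2 q -> c1 q = c -> In q fib) -> (length fib <= length l)%nat ->
  forall p, S1 p -> c1 (F p) = c -> In p l.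
Proof.
  intros Nd Hl Hfib Len p Sp Ep.
  assert (K : incl (map G fib) l).
  { apply NoDup_length_incl; [exact Nd|rewrite length_map; exact Len|]. eapply incl_fiber; eauto. }
  apply K. rewrite <- (GF p Sp). apply in_map. apply Hfib; auto. apply F_on, Sp.
Qed.

Lemma roots_nonzero k Z c s t : simple_zero_set k Z -> (forall a, Z a -> W a) -> roots k c s t -> ~ W c ->
  s <> (RtoC 0) /\ t <> (RtoC 0).
Proof.
  intros Hk ZW [Hs Ht] N. split; intros E; apply N.
  - apply Hf. rewrite <- Hs, E. ring.
  - apply ZW, Hk. rewrite <- Ht, E. ring.
Qed.

Lemma base_coord_W x s t : roots g x s t -> W x -> W (base_coord x s t).
Proof.
  intros R Wx. destruct (classic (A x)) as [Ax|NA].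
  - apply BW. apply (nodes_match (pt x s t)); [apply roots_S1; auto|exact Ax].
  - destruct R as [Rs Rt]. assert (E : s = (RtoC 0)).
    { apply Csqr_0. rewrite Rs. apply Hf, Wx. }
    subst s. apply base_coord_ramified.
    + apply Hf, Wx.
    + intros E. apply NA, Hg. rewrite <- Rt, E. ring.
    + split; auto.
Qed.

(** Off [W] the points over [c] are at most four, and their preimages come in pairs with opposite [z2]. *)
Lemma base_coord_value_two c x1 s1 t1 x2 s2 t2 x3 s3 t3 : ~ W c ->
  roots g x1 s1 t1 -> roots g x2 s2 t2 -> roots g x3 s3 t3 ->
  base_coord x1 s1 t1 = c -> base_coord x2 s2 t2 = c -> base_coord x3 s3 t3 = c -> x1 = x2 \/ x2 = x3 \/ x1 = x3.
Proof.
  intros Nc R1 R2 R3 E1 E2 E3. apply NNPP. intros N.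
  assert (Nz : forall x s t, roots g x s t -> base_coord x s t = c -> s <> (- s)%C).
  { intros x s t R E Es. 
    assert (NW : ~ W x) by (intros Wx; apply Nc; rewrite <- E; apply base_coord_W; auto).
    apply (proj1 (roots_nonzero g A x s t Hg AW R NW)).
    replace s with ((s - - s) / 2)%C by cfield. rewrite <- Es. cfield. }
  pose proof (Nz _ _ _ R1 E1) as O1. pose proof (Nz _ _ _ R2 E2) as O2. pose proof (Nz _ _ _ R3 E3) as O3.
  (* six distinct points cannot be mapped injectively into a fibre of four *)
  set (l := pt x1 s1 t1 :: pt x1 (- s1)%C t1 :: pt x2 s2 t2 :: pt x2 (- s2)%C t2 :: pt x3 s3 t3 :: pt x3 (- s3)%C t3 :: nil).
  assert (Inj : forall a b c a' b' c', pt a b c = pt a' b' c' -> a = a' /\ b = b').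
  { intros a b d a' b' d' E. split; [apply (f_equal c1) in E|apply (f_equal c2) in E]; exact E. }
  assert (Nd : NoDup l).
  { unfold l. repeat (apply NoDup_cons || apply NoDup_nil);
      simpl; intros Hin; repeat (destruct Hin as [Hin|Hin]); try contradiction;
      apply Inj in Hin; destruct Hin as [I1 I2]; (tauto || (apply N; auto; fail) || congruence || idtac). all: try (symmetry in I2; tauto). }
  assert (Hl : forall p, In p l -> S1 p /\ c1 (F p) = c).
  { assert (Two : forall x s t, roots g x s t -> base_coord x s t = c ->
      (S1 (pt x s t) /\ c1 (F (pt x s t)) = c) /\ (S1 (pt x (- s)%C t) /\ c1 (F (pt x (- s)%C t)) = c)).
    { intros x s t R E. split; split; [apply roots_S1; auto|exact E|apply roots_S1, roots_neg2; auto|].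
      rewrite <- E. apply base_coord_neg2, R. }
    intros p Hp. unfold l in Hp. simpl in Hp.
    repeat (destruct Hp as [<-|Hp]); [..|contradiction]; first
      [apply (Two _ _ _ R1 E1)|apply (Two _ _ _ R2 E2)|apply (Two _ _ _ R3 E3)]. }
  pose proof (roots_some_root h c) as Rc.
  pose proof (incl_fiber l _ c Hl (fun q => fiber4 h c _ _ q Rc)) as I.
  pose proof (NoDup_incl_length Nd I) as Len. simpl in Len. lia.
Qed.

Variables a1 a2 : C.
Hypotheses (Ha1 : A a1) (Ha2 : A a2) (Na : a1 <> a2).

Lemma node_roots a : A a -> roots g a (RtoC 0) (RtoC 0).
Proof.
  intros Ha. split.
  - transitivity (RtoC 0); [ring|]. symmetry. apply Hf, AW, Ha.
  - transitivity (RtoC 0); [ring|]. symmetry. apply Hg, Ha.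
Qed.

(** Over a point of [B] there is only the node, so only the node over [a] is mapped there. *)
Lemma node_value_unique a x s t : A a -> roots g x s t -> base_coord x s t = base_coord a (RtoC 0) (RtoC 0) -> x = a.
Proof.
  intros Ha R E. pose proof (node_roots a Ha) as R0. apply roots_S1 in R, R0.
  assert (Ba : B (c1 (F (pt a 0 0)))) by (apply nodes_match; auto).
  assert (Bx : B (c1 (F (pt x s t)))).
  { change (B (base_coord x s t)). rewrite E. exact Ba. }
  pose proof (node_over h B _ Hh BW (F_on _ R) Bx) as P1.
  pose proof (node_over h B _ Hh BW (F_on _ R0) Ba) as P2.
  assert (EF : F (pt x s t) = F (pt a 0 0)).
  { rewrite P1, P2. change (pt (base_coord x s t) 0 0 = pt (base_coord a (RtoC 0) (RtoC 0)) 0 0). rewrite E. reflexivity. }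
  apply F_inj in EF; auto. exact (f_equal c1 EF).
Qed.

(** The zeros of [f] are isolated. *)
Lemma off_W_large M : exists c, M <= Cmod c /\ ~ W c.
Proof.
  set (m := Rabs M). destruct (classic (W (RtoC m))) as [H|H].
  - destruct (simple_zero_set_isolated f W (RtoC m) Hf) as [r [Hr Is]].
    exists (RtoC m + RtoC (r / 2))%C. split.
    + rewrite <- RtoC_plus, Cmod_R, Rabs_pos_eq; unfold m; pose proof (Rle_abs M); pose proof (Rabs_pos M); lra.
    + apply Is.
      * rewrite Cmod_shift, Cmod_R, Rabs_pos_eq; lra.
      * intros E. apply (f_equal (fun z => z - RtoC m)%C) in E. rewrite Cplus_comm in E.
        replace (RtoC (r / 2) + RtoC m - RtoC m)%C with (RtoC (r/2)) in E by ring.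
        replace (RtoC m - RtoC m)%C with (RtoC 0) in E by ring. apply RtoC_inj in E. lra.
  - exists (RtoC m). split; auto. rewrite Cmod_R. unfold m. rewrite Rabs_Rabsolu. apply Rle_abs.
Qed.

(** The sum and the product of the two values descend to the coefficients of a correspondence that is
    totally ramified at the nodes over [a1] and [a2]. *)
Lemma base_coord_neg3 x s t : roots g x s t -> base_coord x s (- t)%C = base_coord x s t.
Proof.
  pose proof base_coord_hol as Y. pose proof (surface_holomorphic_neg3 _ _ _ _ Y) as Y3.
  destruct base_coord_growth as [N [K [PK HK]]].
  assert (Gy : fibre_growth N base_coord) by (exists K; auto). pose proof (fibre_growth_neg3 _ _ Gy) as G3.
  set (p := fun x s t => (base_coord x s t + base_coord x s (- t))%C). set (m := fun x s t => (base_coord x s t * base_coord x s (- t))%C).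
  assert (Dp : deck_invariant f g p).
  { intros x' s' t' Hs Ht. assert (R : roots g x' s' t') by (split; auto). unfold p.
    rewrite (base_coord_neg2 _ _ _ R), (base_coord_neg2 _ _ _ (roots_neg3 _ _ _ _ R)).
    replace (- - t')%C with t' by ring. split; ring. }
  assert (Dm : deck_invariant f g m).
  { intros x' s' t' Hs Ht. assert (R : roots g x' s' t') by (split; auto). unfold m.
    rewrite (base_coord_neg2 _ _ _ R), (base_coord_neg2 _ _ _ (roots_neg3 _ _ _ _ R)).
    replace (- - t')%C with t' by ring. split; ring. }
  assert (Hp : surface_holomorphic f g W p) by (apply (surface_holomorphic_plus f g W); auto).
  assert (Hm : surface_holomorphic f g W m) by (apply (surface_holomorphic_mult f g W); auto).
  assert (Gp : poly_growth (N + N) (descent f g p)).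
  { apply (poly_growth_le N); [lia|]. apply fibre_growth_descent, fibre_growth_plus; auto. }
  assert (Gm : poly_growth (N + N) (descent f g m)) by (apply fibre_growth_descent, fibre_growth_mult; auto).
  set (al := descent f g p) in *. set (be := descent f g m) in *.
  assert (Q : forall x s t c, roots g x s t -> (c * c - c * al x + be x = (c - base_coord x s t) * (c - base_coord x s (- t)))%C).
  { intros x' s' t' c [Rs Rt]. unfold al, be.
    rewrite (descent_eq f g p x' s' t' Dp Rs Rt), (descent_eq f g m x' s' t' Dm Rs Rt). unfold p, m. ring. }
  assert (Root : forall x c, (c * c - c * al x + be x)%C = (RtoC 0) -> exists s t, roots g x s t /\ base_coord x s t = c).
  { intros x' c E. pose proof (roots_some_root g x') as R. rewrite (Q _ _ _ c R) in E.
    apply Cmult_integral_iff in E. destruct E as [E|E].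
    - exists (some_root (f x')), (some_root (g x')). split; auto. symmetry.
      apply NNPP. intros Ne. apply (Cminus_neq _ _ Ne E).
    - exists (some_root (f x')), (- some_root (g x'))%C. split; [apply roots_neg3; auto|]. symmetry.
      apply NNPP. intros Ne. apply (Cminus_neq _ _ Ne E). }
  intros R.
  assert (Disc0 : (al x * al x = 4 * be x)%C).
  { apply (ramified_correspondence al be (N + N) a1 a2 (base_coord a1 (RtoC 0) (RtoC 0)) (base_coord a2 (RtoC 0) (RtoC 0)) (fun c => ~ W c)); auto.
    - apply (descent_entire f g W A); auto.
    - apply (descent_entire f g W A); auto.
    - intros E. apply Na. apply (node_value_unique a2 a1 (RtoC 0) (RtoC 0)); auto. apply node_roots; auto.
    - intros x' E. destruct (Root _ _ E) as [s' [t' [R' E']]]. eapply node_value_unique; eauto.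
    - intros x' E. destruct (Root _ _ E) as [s' [t' [R' E']]]. eapply node_value_unique; eauto.
    - intros c. rewrite (Q _ _ _ c (node_roots a1 Ha1)). replace (- 0)%C with (RtoC 0) by ring. reflexivity.
    - intros c. rewrite (Q _ _ _ c (node_roots a2 Ha2)). replace (- 0)%C with (RtoC 0) by ring. reflexivity.
    - intros c c' eps He. set (dl := Cmod (c' - c)).
      assert (Pd : 0 <= dl) by apply Cmod_ge_0.
      (* (u1 + d)(u2 + d) - u1 u2 = d u1 + d u2 + d^2 is small against u1 u2 once both exceed M *)
      set (M := 3 * dl / eps + dl).
      assert (M1 : 3 * dl <= M * eps).
      { unfold M. rewrite Rmult_plus_distr_r. replace (3 * dl / eps * eps) with (3 * dl) by (field; lra). nra. }
      assert (M0 : 0 <= 3 * dl / eps) by (apply Rle_div_r; lra).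
      generalize (base_coord_proper (M + Cmod c)). apply at_infinity_imp. intros x' Hx.
      pose proof (roots_some_root g x') as R'. set (s' := some_root (f x')) in *. set (t' := some_root (g x')) in *.
      rewrite (Q _ _ _ c R'), (Q _ _ _ c' R').
      pose proof (Hx _ _ R') as B1. pose proof (Hx _ _ (roots_neg3 _ _ _ _ R')) as B2.
      assert (L : forall v, M + Cmod c <= Cmod v -> M <= Cmod (c - v)).
      { intros v Hv. pose proof (Cmod_tri3 v c 0) as T. rewrite (Cmod_sub_sym v c) in T.
        replace (v - 0)%C with v in T by ring. replace (c - 0)%C with c in T by ring. lra. }
      apply L in B1, B2. set (u1 := (c - base_coord x' s' t')%C) in *. set (u2 := (c - base_coord x' s' (- t'))%C) in *.
      replace ((c' - base_coord x' s' t') * (c' - base_coord x' s' (- t')) - u1 * u2)%C with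
        ((c' - c) * u1 + (c' - c) * u2 + (c' - c) * (c' - c))%C by (unfold u1, u2; ring).
      eapply Rle_trans; [apply Cmod_triangle|].
      eapply Rle_trans; [apply Rplus_le_compat_r, Cmod_triangle|]. rewrite !Cmod_mult. fold dl.
      set (v1 := Cmod u1) in *. set (v2 := Cmod u2) in *.
      assert (X1 : 3 * dl <= v1 * eps) by (apply Rle_trans with (M * eps); [auto|apply Rmult_le_compat_r; lra]).
      assert (X2 : 3 * dl <= v2 * eps) by (apply Rle_trans with (M * eps); [auto|apply Rmult_le_compat_r; lra]).
      assert (T1 : 3 * dl * v1 <= v2 * eps * v1) by (apply Rmult_le_compat_r; auto; apply Cmod_ge_0).
      assert (T2 : 3 * dl * v2 <= v1 * eps * v2) by (apply Rmult_le_compat_r; auto; apply Cmod_ge_0).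
      assert (T3 : 3 * dl * dl <= v1 * eps * v2).
      { apply Rle_trans with (v1 * eps * dl); [apply Rmult_le_compat_r; auto|].
        apply Rmult_le_compat_l; [|unfold M in *; lra]. pose proof (Cmod_ge_0 u1). unfold v1. nra. }
      nra.
    - intros c Nc x1 x2 x3 E1 E2 E3.
      destruct (Root _ _ E1) as [s1 [t1 [R1 F1]]]. destruct (Root _ _ E2) as [s2 [t2 [R2 F2]]].
      destruct (Root _ _ E3) as [s3 [t3 [R3 F3]]].
      apply (base_coord_value_two c x1 s1 t1 x2 s2 t2 x3 s3 t3); auto.
    - apply off_W_large. }
  assert (E : ((base_coord x s t - base_coord x s (- t)) * (base_coord x s t - base_coord x s (- t)) = 0)%C).
  { assert (Ea : al x = p x s t) by (apply descent_eq; auto; apply R).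
    assert (Eb : be x = m x s t) by (apply descent_eq; auto; apply R).
    rewrite Ea, Eb in Disc0. unfold p, m in Disc0.
    replace ((base_coord x s t - base_coord x s (- t)) * (base_coord x s t - base_coord x s (- t)))%C with
      ((base_coord x s t + base_coord x s (- t)) * (base_coord x s t + base_coord x s (- t)) - 4 * (base_coord x s t * base_coord x s (- t)))%C by ring.
    rewrite Disc0. ring. }
  apply Csqr_0 in E. replace (base_coord x s t) with ((base_coord x s t - base_coord x s (- t)) + base_coord x s (- t))%C by ring.
  rewrite E. ring.
Qed.

Definition base_map : C -> C := descent f g base_coord.

Lemma base_coord_invariant : deck_invariant f g base_coord.
Proof.
  intros x s t Hs Ht. split; [apply base_coord_neg2|apply base_coord_neg3]; split; auto.
Qed.

Lemma base_map_eq x s t : roots g x s t -> base_map x = base_coord x s t.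
Proof. intros [Hs Ht]. apply descent_eq; auto. apply base_coord_invariant. Qed.

Lemma base_map_F p : S1 p -> c1 (F p) = base_map (c1 p).
Proof.
  intros Hp. rewrite (pt_eta p) in Hp |- *. rewrite c1_pt. symmetry. apply base_map_eq. apply roots_S1, Hp.
Qed.

Lemma base_map_A x : A x <-> B (base_map x).
Proof.
  pose proof (roots_some_root g x) as R. rewrite (base_map_eq x _ _ R).
  apply (nodes_match (pt x _ _)). apply roots_S1, R.
Qed.

Lemma fiber_list4 x s t c : roots g x s t -> base_map x = c ->
  forall p, In p (pt x s t :: pt x s (- t)%C :: pt x (- s)%C t :: pt x (- s)%C (- t)%C :: nil) ->
  S1 p /\ c1 (F p) = c.
Proof.
  intros R E p Hp. pose proof (roots_neg2 _ _ _ _ R) as R2.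
  assert (K : forall s t, roots g x s t -> S1 (pt x s t) /\ c1 (F (pt x s t)) = c).
  { intros s' t' R'. apply roots_S1 in R'. split; auto. rewrite base_map_F, c1_pt; auto. }
  simpl in Hp. repeat (destruct Hp as [<-|Hp]); [..|contradiction]; apply K; auto using roots_neg2, roots_neg3.
Qed.

(** A point off [W] has four points over it, a point of [W] at most two. *)
Lemma base_map_W x : W x <-> W (base_map x).
Proof.
  pose proof (roots_some_root g x) as R. split.
  - intros Wx. rewrite (base_map_eq x _ _ R). apply base_coord_W; auto.
  - intros Wc. apply NNPP. intros Nx.
    destruct (roots_nonzero g A x _ _ Hg AW R Nx) as [N2 N3].
    pose proof (roots_some_root h (base_map x)) as Rc.
    assert (E0 : some_root (f (base_map x)) = (RtoC 0)).
    { apply Csqr_0. rewrite some_root_sq. apply Hf, Wc. }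
    rewrite E0 in Rc.
    pose proof (incl_fiber _ _ (base_map x) (fiber_list4 x _ _ _ R eq_refl)
      (fun q => fiber2 h _ _ q Rc)) as I.
    pose proof (NoDup_incl_length (NoDup_fiber4 x _ _ N2 N3) I) as Len. simpl in Len. lia.
Qed.

(** The fibre over [x1] already fills the fibre over its image. *)
Lemma base_map_inj x1 x2 : base_map x1 = base_map x2 -> x1 = x2.
Proof.
  intros E. set (c := base_map x2) in *.
  pose proof (roots_some_root g x1) as R1. pose proof (roots_some_root g x2) as R2. pose proof (roots_some_root h c) as Rc.
  assert (S2p : S1 (pt x2 (some_root (f x2)) (some_root (g x2)))) by (apply roots_S1, R2).
  assert (E2 : c1 (F (pt x2 (some_root (f x2)) (some_root (g x2)))) = c) by (rewrite base_map_F, c1_pt; auto).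
  destruct (classic (W c)) as [Wc|Nc].
  - assert (W1 : W x1) by (apply base_map_W; rewrite E; auto).
    destruct (classic (A x1)) as [A1|NA].
    + symmetry. apply (node_value_unique x1 x2 (some_root (f x2)) (some_root (g x2))); auto.
      rewrite <- (base_map_eq x2 _ _ R2), <- (base_map_eq x1 _ _ (node_roots x1 A1)). symmetry. exact E.
    + assert (Z1 : some_root (f x1) = (RtoC 0)) by (apply Csqr_0; rewrite some_root_sq; apply Hf, W1).
      assert (Zc : some_root (f c) = (RtoC 0)) by (apply Csqr_0; rewrite some_root_sq; apply Hf, Wc).
      rewrite Z1 in R1. rewrite Zc in Rc.
      assert (N3 : some_root (g x1) <> (RtoC 0)).
      { intros E0. apply NA, Hg. rewrite <- (some_root_sq (g x1)), E0. ring. }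
      pose proof (fiber_pigeon _ _ c (NoDup_fiber2 x1 _ N3)
        (fun p Hp => fiber_list4 x1 _ _ c R1 E p ltac:(simpl in Hp |- *; tauto))
        (fun q => fiber2 h c _ q Rc) (le_n _) _ S2p E2) as H.
      simpl in H. destruct H as [H|[H|[]]]; exact (f_equal c1 H).
  - assert (N1 : ~ W x1).
    { intros W1. apply Nc. rewrite <- E. exact (proj1 (base_map_W x1) W1). }
    destruct (roots_nonzero g A x1 _ _ Hg AW R1 N1) as [N2 N3].
    pose proof (fiber_pigeon _ _ c (NoDup_fiber4 x1 _ _ N2 N3) (fiber_list4 x1 _ _ c R1 E)
      (fun q => fiber4 h c _ _ q Rc) (le_n _) _ S2p E2) as H.
    simpl in H. destruct H as [H|[H|[H|[H|[]]]]]; exact (f_equal c1 H).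
Qed.

(** By injectivity [base_map x - base_map 0] has no root but zero, so it is [k x^m]; and [x^m] identifies
    the m-th roots of unity. *)
Theorem base_map_affine : exists k c0, k <> (RtoC 0) /\ forall x, base_map x = (c0 + k * x)%C.
Proof.
  destruct base_coord_growth as [N [K [PK HK]]].
  assert (Gb : poly_growth N base_map) by (apply fibre_growth_descent; exists K; auto).
  assert (Eb : Entire base_map) by (apply (descent_entire f g W A); auto using base_coord_hol, base_coord_invariant).
  set (b := fun x => (base_map x - base_map (RtoC 0))%C).
  assert (E1 : Entire b) by (apply Entire_minus; [exact Eb|apply Entire_const]).
  assert (G1 : poly_growth N b).
  { apply (poly_growth_ext _ (fun x => base_map x + (- base_map (RtoC 0)))%C); [reflexivity|].
    apply poly_growth_plus; auto. apply (poly_growth_le 0); [lia|apply poly_growth_const]. }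
  assert (Rb : forall x, b x = (RtoC 0) -> x = (RtoC 0)).
  { intros x E. apply base_map_inj. apply NNPP. intros Ne. apply (Cminus_neq _ _ Ne E). }
  destruct (leading_term_exists N b E1 G1) as [Z|[m [k L]]].
  { exfalso. specialize (Rb (RtoC 1) (Z _)). apply RtoC_inj in Rb. lra. }
  pose proof (single_root m b (RtoC 0) k E1 L Rb) as P.
  assert (Nk : k <> (RtoC 0)) by apply L.
  destruct m as [|[|m]].
  - exfalso. specialize (P (RtoC 0)). unfold b in P. simpl in P. apply Nk.
    replace k with (k * 1)%C by ring. rewrite <- P. ring.
  - exists k, (base_map (RtoC 0)). split; auto. intros x. specialize (P x). unfold b in P. simpl in P.
    replace (base_map x) with ((base_map x - base_map (RtoC 0)) + base_map (RtoC 0))%C by ring. rewrite P. ring.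
  (* a root of unity other than 1 contradicts injectivity *)
  - exfalso. set (om := Cexp (Ci * RtoC (2 * PI / INR (S (S m))))).
    assert (In0 : INR (S (S m)) <> 0) by (apply not_0_INR; lia).
    assert (On : Cpow om (S (S m)) = (RtoC 1)).
    { unfold om. rewrite Cexp_pow.
      replace (RtoC (INR (S (S m))) * (Ci * RtoC (2 * PI / INR (S (S m)))))%C with
        (Ci * (RtoC (INR (S (S m))) * RtoC (2 * PI / INR (S (S m)))))%C by ring.
      rewrite <- RtoC_mult. replace (INR (S (S m)) * (2 * PI / INR (S (S m)))) with (2 * PI) by (field; auto).
      apply Cexp_2PI. }
    apply (primitive_root_neq_1 (S (S m))); [lia|]. fold om.
    apply base_map_inj.
    assert (Eo : b om = b (RtoC 1)).
    { rewrite !P. replace (om - 0)%C with om by ring. replace (RtoC 1 - 0)%C with (RtoC 1) by ring.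
      rewrite On, Cpow_1_l. reflexivity. }
    unfold b in Eo. replace (base_map om) with ((base_map om - base_map (RtoC 0)) + base_map (RtoC 0))%C by ring.
    rewrite Eo. ring.
Qed.

End Forward.

(** * The classification *)

Lemma sequence_many (w : nat -> C) : (forall i j, w i = w j -> i = j) -> has_arbitrarily_many (range_of w).
Proof.
  intros Hw n. exists (map w (seq 0 n)). split; [|split].
  - apply Injective_map_NoDup; [exact Hw|apply seq_NoDup].
  - rewrite length_map, length_seq. reflexivity.
  - intros a Ha. apply in_map_iff in Ha. destruct Ha as [i [<- _]]. exists i. reflexivity.
Qed.

Lemma marked_set_sub w A : finite_even_subset w A \/ subsequence_set w A ->
  forall a, A a -> range_of w a.
Proof.
  intros [[s [_ [_ [_ H]]]]|[phi [_ H]]] a Ha; auto.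
  apply H in Ha. destruct Ha as [k ->]. exists (phi k). reflexivity.
Qed.

(** Parity excludes a single marked point. *)
Lemma marked_set_two w A : (forall i j, w i = w j -> i = j) ->
  finite_even_subset w A \/ subsequence_set w A -> exists a1 a2, A a1 /\ A a2 /\ a1 <> a2.
Proof.
  intros Hw [[s [[Nd Hs] [Ns [Ev _]]]]|[phi [Mono H]]].
  - destruct s as [|a [|b s]]; [contradiction| |].
    + destruct Ev as [k Hk]. simpl in Hk. lia.
    + exists a, b. split; [apply Hs; left; auto|]. split; [apply Hs; right; left; auto|].
      intros ->. inversion Nd as [|? ? Nb _]; subst. apply Nb. left; auto.
  - exists (w (phi 0%nat)), (w (phi 1%nat)). split; [apply H; eauto|]. split; [apply H; eauto|].
    intros E. apply Hw in E. specialize (Mono 0%nat 1%nat ltac:(lia)). lia.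
Qed.

Theorem theorem4p7 :
  forall (w : nat -> C) (f g h : C -> C) (A B : C -> Prop),
    (forall i j : nat, w i = w j -> i = j) ->
    is_lim_seq (fun l : nat => Cmod (w l)) p_infty ->
    entire f ->
    simple_zeros_exactly f (range_of w) ->
    (finite_even_subset w A \/ subsequence_set w A) ->
    (finite_even_subset w B \/ subsequence_set w B) ->
    associated_function A g ->
    associated_function B h ->
    (isomorphic (surface f g) (surface f h)
     <->
     (equipotent A B /\
      exists t : C -> C,
        biholomorphism_C t /\
        maps_onto t (range_of w) (range_of w) /\
        maps_onto t A B)).
Proof.
  intros w f g h A B Hw _ Ef Sf HA HB Ag Bh.
  pose proof (simple_zero_set_of_simple f _ Ef Sf) as Hf.
  pose proof (simple_zero_set_associated A g Ag) as Hg. pose proof (simple_zero_set_associated B h Bh) as Hh.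
  split.
  - intros [F [[G [Inv [CF CG]]] [_ HF]]].
    pose proof (marked_set_sub w A HA) as AW. pose proof (marked_set_sub w B HB) as BW.
    pose proof (sequence_many w Hw) as Wm.
    destruct (marked_set_two w A Hw HA) as [a1 [a2 [Ha1 [Ha2 Na]]]].
    set (t := base_map f g F).
    assert (Ti : forall x y, t x = t y -> x = y).
    { intros x y. apply (base_map_inj f g h (range_of w) A B F G) with (a1 := a1) (a2 := a2); auto. }
    assert (TW : forall x, range_of w x <-> range_of w (t x)).
    { intros x. apply (base_map_W f g h (range_of w) A B F G) with (a1 := a1) (a2 := a2); auto. }
    assert (TA : forall x, A x <-> B (t x)).
    { intros x. apply (base_map_A f g h (range_of w) A B F G) with (a1 := a1) (a2 := a2); auto. }
    destruct (base_map_affine f g h (range_of w) A B F G) with (a1 := a1) (a2 := a2)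
      as [k [c0 [Nk Tk]]]; auto. fold t in Tk.
    set (s := fun z => ((z - c0) / k)%C).
    assert (ts : forall z, t (s z) = z) by (intros z; rewrite Tk; unfold s; field; auto).
    assert (st : forall z, s (t z) = z) by (intros z; rewrite Tk; unfold s; field; auto).
    assert (MA : maps_onto t A B).
    { intros b. split.
      - intros Hb. exists (s b). split; [apply TA; rewrite ts; auto|apply ts].
      - intros [a [Ha <-]]. apply TA, Ha. }
    split.
    + exists t. split; auto.
    + exists t. split; [|split; auto].
      * split.
        -- apply entire_Cdiff. intros z. apply (Cdiff_ext (fun x => c0 + k * x)%C); [intros; symmetry; apply Tk|].
           apply Cdiff_plus; [apply Cdiff_const|]. apply Cdiff_mult; [apply Cdiff_const|apply Cdiff_id].
        -- exists s. split; [|auto]. apply entire_Cdiff. intros z.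
           apply Cdiff_mult; [|apply Cdiff_const]. apply Cdiff_minus; [apply Cdiff_id|apply Cdiff_const].
      * intros b. split.
        -- intros Hb. exists (s b). split; [apply TW; rewrite ts; auto|apply ts].
        -- intros [a [Ha <-]]. apply (TW a), Ha.
  - intros [_ [t [[Et [s [Es [st ts]]]] [MW MA]]]].
    assert (Pull : forall X Y : C -> Prop, maps_onto t X Y -> forall z, X z <-> Y (t z)).
    { intros X Y M z. split.
      - intros Hz. apply M. exists z; auto.
      - intros Hz. apply M in Hz. destruct Hz as [x [Hx E]].
        rewrite <- (st z), <- E, st. exact Hx. }
    apply (isomorphic_of_biholomorphism (range_of w) A B f g h t s); auto.
    + exact (proj1 (entire_Cdiff t) Et).
    + exact (proj1 (entire_Cdiff s) Es).
Qed.
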